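(* Let $\Gamma$ be an admissible vector field for a fundamental network with symmetry monoid $\Sigma$ and let $x_0$ be a fully synchronous steady state of $\Gamma$. Then there exists a $\Sigma$-invariant local center manifold $\mathcal{M}^c$ for $\Gamma$ near $x_0$. The restriction $\Gamma|_{\mathcal{M}^c}$ to this local center manifold is $\Sigma$-equivariant and can therefore be interpreted as an admissible vector field in an appropriate way. A center manifold of each quotient of the fundamental network is contained in the center manifold of the fundamental network as a robust synchrony space.
   Context: $V$ is a finite-dimensional real vector space. $\Sigma=\{\sigma_1,\dots,\sigma_n\}$ is a set of $n$ distinct maps from $\{1,\dots,N\}$ to itself that is closed under composition and has $\sigma_1$ equal to the identity, so $\Sigma$ is a finite monoid. Write $V^n=\bigoplus_{\sigma_i\in\Sigma}V$, with components $X_{\sigma_i}$. Define linear maps $A_{\sigma_i}:V^n\to V^n$ by $(A_{\sigma_i}X)_{\sigma_j}:=X_{\sigma_j\circ\sigma_i}$; they form a representation of $\Sigma$. The fundamental network with symmetry monoid $\Sigma$ has the elements of $\Sigma$ as its cells, and its admissible vector fields are the vector fields $\Gamma=\Gamma_f:V^n\to V^n$ given by $(\Gamma_f)_{\sigma_i}:=f\circ A_{\sigma_i}$ for a response function $f:V^n\to V$, which is taken of class $C^k$ for some $k\ge 1$. The admissible vector fields are exactly the vector fields on $V^n$ that commute with all $A_{\sigma_i}$. A steady state $x_0$ (that is, $\Gamma(x_0)=0$) is fully synchronous if all its components are equal. A subset $M\subset V^n$ is $\Sigma$-invariant if $A_{\sigma_i}(M)\subset M$ for all $\sigma_i\in\Sigma$;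 a vector field on such a set is $\Sigma$-equivariant if it commutes with all $A_{\sigma_i}$. For a partition of the cells of a network, the corresponding synchrony space is the subspace of the phase space in which the states of any two cells in the same element of the partition are equal. It is robust if it is mapped into itself by every admissible vector field (for every choice of response function). A quotient of the fundamental network is a network whose vector fields are the restrictions of the admissible vector fields $\Gamma_f$ to a robust synchrony space of the fundamental network. Center manifolds: for a $C^k$ vector field $F$ with steady state $x_0$, let $X_c$ and $X_h$ be the center and hyperbolic subspaces of $DF(x_0)$ (the sums of the generalized eigenspaces for eigenvalues on, respectively off, the imaginary axis), and let $\pi_h$ be the projection onto $X_h$ along $X_c$. A (global) center manifold of $F$ at $x_0$ is the invariant set $\{x:\sup_{t\in\mathbb{R}}\|\pi_h(\phi^t(x)-x_0)\|<\infty\}$, with $\phi^t$ the flow of $F$, when this set is of the form $\{x_0+x_c+\psi(x_c):x_c\in X_c\}$ for a $C^k$ map $\psi:X_c\to X_h$ with $\psi(0)=0$ and $D\psi(0)=0$. A local center manifold for $F$ near $x_0$ is obtained as the global center manifold of a vector field that agrees with $F$ on an open neighborhood of $x_0$; dynamical statements about the restriction of $F$ to it are understood near $x_0$. *)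

(* Defs.v *)
From HB Require Import structures.
From mathcomp Require Import all_boot all_order all_algebra.
From mathcomp Require Import complex.
From mathcomp Require Import all_classical all_reals all_analysis.

Set Implicit Arguments.
Unset Strict Implicit.
Unset Printing Implicit Defensive.

Import Order.TTheory GRing.Theory Num.Theory.
Import numFieldNormedType.Exports.
Import passmx.

Local Open Scope classical_set_scope.
Local Open Scope ring_scope.

(* [nvect E] is the space [E] with the sup norm of the coordinates in a fixed
   basis. As [E] is finite dimensional, every other norm gives the same topology,
   the same derivatives and the same bounded sets. *)
Definition nvect (R : realType) (E : vectType R) : Type := E.

Section NormedVect.
Variables (R : realType) (E : vectType R).

HB.instance Definition _ := Vector.copy (nvect E) E.

Let basisE : basis_of fullv (vbasis {: E}) := vbasisP fullv.

Let nvect_norm (x : nvect E) : R := `|rVof (vbasis {: E}) x|.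

Let nvect_normD (x y : nvect E) :
  nvect_norm (x + y) <= nvect_norm x + nvect_norm y.
Proof. by rewrite /nvect_norm linearD ler_normD. Qed.

Let nvect_normZ (l : R) (x : nvect E) :
  nvect_norm (l *: x) = `|l| * nvect_norm x.
Proof. by rewrite /nvect_norm linearZ normrZ. Qed.

Let nvect_norm0_eq0 (x : nvect E) : nvect_norm x = 0 -> x = 0.
Proof. by move=> /eqP; rewrite normr_eq0 rVof_eq0// => /eqP. Qed.

HB.instance Definition _ := Lmodule_isNormed.Build R (nvect E)
  nvect_normD nvect_normZ nvect_norm0_eq0.

End NormedVect.

(* f is of class C^(k+1) iff it is differentiable and all its directional
   derivatives are of class C^k. *)
Fixpoint Ck (R : realType) (k : nat) (E E' : vectType R)
    (f : nvect E -> nvect E') : Prop :=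
  if k is k'.+1 then
    (forall x, differentiable f x) /\ (forall v, Ck k' (fun x => 'd f x v))
  else continuous f.

Definition linearization (R : realType) (E : vectType R)
  (F : nvect E -> nvect E) (x : nvect E) : 'End(E) := linfun ('d F x : E -> E).

Section Spectral.
Variables (R : realType) (E : vectType R) (L : 'End(E)).
Local Notation C := (R[i]%C).
Local Notation e := (vbasis {: E}).

(* Coordinates are row vectors, on which L acts by right multiplication. *)
Definition complexified : 'M[C]_(\dim {: E}) :=
  map_mx (real_complex R) (mxof e e L).

Definition spectrum : seq C :=
  undup (sval (closed_field_poly_normal (char_poly complexified))).

Definition spectral_mx (S : pred C) : 'M[C]_(\dim {: E}) :=
  (\sum_(l <- spectrum | S l) geigenspace complexified l)%MS.

(* The real points of the row space W of [spectral_mx S]: the equation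
   [x *m cokermx W = 0] is split into its real and imaginary parts. *)
Definition spectral_space (S : pred C) : {vspace E} :=
  let K := cokermx (spectral_mx S) in
  vsof e (kermx (row_mx (map_mx (@complex.Re R) K) (map_mx (@complex.Im R) K))).

Definition center_space := spectral_space (fun l => complex.Re l == 0).
Definition hyperbolic_space := spectral_space (fun l => complex.Re l != 0).

Definition pi_c : 'End(E) := daddv_pi center_space hyperbolic_space.
Definition pi_h : 'End(E) := daddv_pi hyperbolic_space center_space.

Lemma mem_spectrum (l : C) : (l \in spectrum) = eigenvalue complexified l.
Proof.
rewrite eigenvalue_root_char /spectrum mem_undup.
case: closed_field_poly_normal => s /= ->.
by rewrite (monicP (char_poly_monic _)) scale1r root_prod_XsubC.
Qed.

Lemma mem_spectral_space (S : pred C) (x : E) :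
  (x \in spectral_space S) =
  (map_mx (real_complex R) (rVof e x) <= spectral_mx S)%MS.
Proof.
rewrite /spectral_space -rVof_sub; last exact: vbasisP.
rewrite [RHS]submxE; set K := cokermx _; set u := rVof e x.
have reE (z : C) (a : R) : a%:C%C * z = (a * complex.Re z +i* (a * complex.Im z))%C.
  by case: z => p q; rewrite /= /GRing.mul /= !mul0r subr0 addr0.
have eq0C (z : C) : complex.Im z = 0 -> complex.Re z = 0 -> z = 0.
  by case: z => p q /= -> ->.
have ReD : {morph (@complex.Re R) : a b / a + b} by case=> ? ? [].
have ImD : {morph (@complex.Im R) : a b / a + b} by case=> ? ? [].
have uRe : map_mx (@complex.Re R) (map_mx (real_complex R) u *m K) =
           u *m map_mx (@complex.Re R) K.
  apply/matrixP => i j; rewrite !mxE (big_morph _ ReD (erefl _)).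
  by apply: eq_bigr => k _; rewrite !mxE reE.
have uIm : map_mx (@complex.Im R) (map_mx (real_complex R) u *m K) =
           u *m map_mx (@complex.Im R) K.
  apply/matrixP => i j; rewrite !mxE (big_morph _ ImD (erefl _)).
  by apply: eq_bigr => k _; rewrite !mxE reE.
apply/sub_kermxP/eqP; rewrite mul_mx_row -uRe -uIm.
  rewrite -[X in _ = X]row_mx0 => /eq_row_mx[].
  move: (_ *m K) => W re0 im0; apply/matrixP => i j.
  move/matrixP: re0 => /(_ i j); move/matrixP: im0 => /(_ i j).
  by rewrite !mxE; exact: eq0C.
by move=> ->; apply/matrixP => i j; rewrite !mxE; case: fintype.split => k; rewrite !mxE.
Qed.

End Spectral.

Section CenterManifold.
Variables (R : realType) (E : vectType R) (k : nat).
Implicit Types (F : nvect E -> nvect E) (x : nvect E) (M : set (nvect E)).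

Definition is_flow F (phi : R -> nvect E -> nvect E) : Prop :=
  (forall x, phi 0 x = x) /\
  (forall x (t : R), is_derive t (1 : R) (phi^~ x) (F (phi t x))).

Definition global_center_manifold F x0 M : Prop :=
  let L := linearization F x0 in
  [/\ Ck k F, F x0 = 0 &
      exists phi, [/\ is_flow F phi,
        M = [set x | exists c : R,
               forall t, `|(pi_h L (phi t x - x0) : nvect E)| <= c] &
        exists psi : nvect (subvs_of (center_space L)) ->
                     nvect (subvs_of (hyperbolic_space L)),
          [/\ Ck k psi, psi 0 = 0, (forall v, 'd psi 0 v = 0) &
              M = range (fun xc : subvs_of (center_space L) =>
                           x0 + vsval xc + vsval (psi xc))]]].

Definition local_center_manifold F x0 M : Prop :=
  exists F', (\forall x \near x0, F' x = F x) /\ global_center_manifold F' x0 M.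

(* v is the velocity at x of a curve in M *)
Definition tangent_to M x (v : nvect E) : Prop :=
  exists c : R -> nvect E,
    [/\ forall t, M (c t), c 0 = x & is_derive (0 : R) (1 : R) c v].

End CenterManifold.

(* F restricted to the subspace U; meant for F mapping U into itself *)
Definition restrict_to (R : realType) (E : vectType R) (U : {vspace E})
    (F : E -> E) : subvs_of U -> subvs_of U :=
  fun u => vsproj U (F (vsval u)).

Section Network.
Variables (N : nat).
Local Notation map_N := {ffun 'I_N -> 'I_N}.

Definition is_symmetry_monoid (Sigma : {set map_N}) : Prop :=
  [ffun i => i] \in Sigma /\
  {in Sigma &, forall s t : map_N, [ffun i => s (t i)] \in Sigma}.

Variable Sigma : {set map_N}.

Definition cell : finType := {s : map_N | s \in Sigma}.

(* t \o s; the default value t of insubd is irrelevant when Sigma is closed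
   under composition *)
Definition cell_comp (t s : cell) : cell :=
  insubd t [ffun i => val t (val s i)].

Variables (R : realType) (V : vectType R).

Definition phase : vectType R := {ffun cell -> V}.

Definition act (s : cell) (X : phase) : phase := [ffun t => X (cell_comp t s)].

Definition admissible (f : phase -> V) (X : phase) : phase :=
  [ffun s => f (act s X)].

Definition fully_synchronous (X : phase) : Prop := forall s t, X s = X t.

Definition invariant_set (M : set phase) : Prop :=
  forall s, act s @` M `<=` M.

Definition equivariant_on (M : set phase) (G : phase -> phase) : Prop :=
  forall s X, M X -> G (act s X) = act s (G X).

Definition cell_partition (P : {set {set cell}}) : bool :=
  finset.partition P [set: cell]%SET.

Definition same_block (P : {set {set cell}}) (s t : cell) : bool :=
  [exists B in P, (s \in B) && (t \in B)].

Definition synchrony_space (P : {set {set cell}}) : {vspace phase} :=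
  (\bigcap_(st : cell * cell | same_block P st.1 st.2)
     lker (linfun (fun X : phase => X st.1 - X st.2)))%VS.

Lemma mem_synchrony_space (P : {set {set cell}}) (X : phase) :
  (X \in synchrony_space P) <-> (forall s t, same_block P s t -> X s = X t).
Proof.
have linE st : linfun (fun X : phase => X st.1 - X st.2) X = X st.1 - X st.2.
  have lin : linear (fun X : phase => X st.1 - X st.2).
    by move=> a Y Z; rewrite !ffunE scalerBr opprD addrACA.
  pose h := GRing.isLinear.Build R phase V _ _ lin.
  pose g : {linear phase -> V} := HB.pack (fun X : phase => X st.1 - X st.2) h.
  by rewrite (lfunE g).
rewrite memvE; split=> [/subv_bigcapP XP s t st|XP].
  have := XP (s, t) st; rewrite -memvE memv_ker (linE (s, t)) subr_eq0.
  by move=> /eqP.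
apply/subv_bigcapP => -[s t] /= st; rewrite -memvE memv_ker.
by rewrite (linE (s, t)) subr_eq0 (XP _ _ st).
Qed.

Definition robust (k : nat) (P : {set {set cell}}) : Prop :=
  forall g : phase -> V, Ck k (g : nvect phase -> nvect V) ->
  forall X, X \in synchrony_space P -> admissible g X \in synchrony_space P.

(* G is not asked to be tangent to M: this covers all Sigma-equivariant vector
   fields on M as well as those, like Gamma itself, which are tangent to a
   local center manifold only near x0. *)
Definition robust_inside (M : set phase) (P : {set {set cell}}) : Prop :=
  forall G : phase -> phase, equivariant_on M G ->
  forall X, M X -> X \in synchrony_space P -> G X \in synchrony_space P.

(* M is a graph over its center subspace, so that x |-> pi_c (x - x0) is a
   chart of M, with inverse x_c |-> x0 + x_c + psi x_c. The chart is required to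
   be Sigma-equivariant and to map Gamma|M, near x0, to the restriction to the
   center subspace of an admissible vector field. *)
Definition admissible_on (k : nat) (Gamma : nvect phase -> nvect phase)
    (x0 : nvect phase) (M : set phase) : Prop :=
  let L := linearization Gamma x0 in
  let chart (X : phase) : phase := pi_c L (X - x0) in
  [/\ set_bij M [set Y | Y \in center_space L] chart,
      forall s X, M X -> chart (act s X) = act s (chart X) &
      exists g : phase -> V,
        [/\ Ck k (g : nvect phase -> nvect V),
            forall Y, Y \in center_space L ->
              admissible g Y \in center_space L &
            \forall X \near x0,
              M X -> pi_c L (Gamma X) = admissible g (chart X)]].

End Network.

(* Main.v *)
(* Cutting off the response function f outside a small ball turns Gamma into a field
   x |-> L (x - x0) + G (x - x0) which is still admissible, with G bounded, of class
   C^k and of small Lipschitz constant. For such a field the solutions whose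
   hyperbolic part is bounded are the solutions of y' = L y + G y which grow at most
   like e^(m |t|) for some small m > 0, and these are parametrized by pi_c (y 0): this
   is a fixed point problem in spaces of curves with an exponential weight
   (Lyapunov-Perron). Their dependence on pi_c (y 0) is of class C^k provided
   that every derivative is measured in a larger weight (Vanderbauwhede).

   The center manifold is thus described by the flow and pi_h only, so it is preserved
   by every linear map which fixes x0 and commutes with the field, and it is compatible
   with the restriction to an invariant subspace. Robustness enters in two ways: a
   robust synchrony space is invariant under the truncated field, and, for the linear
   response functions X |-> X_u, robustness says that act s X = act t X when X is in the
   synchrony space and s, t are in the same block, so that a map H commuting with
   the action satisfies H(X)_s = H(act s X)_id = H(act t X)_id = H(X)_t. *)
From HB Require Import structures.
Require Import Defs.
From mathcomp Require Import all_boot all_order all_algebra.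
From mathcomp Require Import complex ring lra.
From mathcomp Require Import all_classical all_reals all_analysis.

Set Implicit Arguments.
Unset Strict Implicit.
Unset Printing Implicit Defensive.

Import Order.TTheory GRing.Theory Num.Theory.
Import numFieldNormedType.Exports.
Import passmx.

Local Open Scope classical_set_scope.
Local Open Scope ring_scope.

(** * Coordinates and curves *)

(** A cutoff on the phase space would have to respect the action, and over a monoid of possibly
    non-invertible maps there is no averaging that yields an invariant cutoff or norm. Truncating
    the response function avoids this, since every response function gives an admissible field. The
    Lipschitz constant that can be allowed depends only on the linear part and on [k]. It is
    therefore fixed before the radius of truncation, and one radius serves the finitely many
    partitions as well.

    No improper integral is formed. The Lyapunov-Perron operator is the relation between a forcing
    term and the slowly growing solution of the linear equation, and its estimates come from the
    mean value inequality. Their constant is the same for all exponents in an interval [m0, m1]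
    below the spectral gap, so that one contraction bound serves at every order of differentiation.
    The remainder of a superposition operator is quadratic in curves growing like e^(m |t|). Each
    derivative thus multiplies the exponent, and m0 is a fraction of m1 that depends on [k]. *)

Section Coordinates.
Variables (R : realType) (E : vectType R).
Local Notation e := (vbasis {: E}).
Implicit Types x y : nvect E.

Definition coord_of (i : 'I_(\dim {: E})) (x : nvect E) : R := rVof e x 0 i.

Lemma coord_of_linear i : linear (coord_of i : nvect E -> R^o).
Proof. by move=> a x y; rewrite /coord_of linearP !mxE. Qed.

HB.instance Definition _ i := GRing.isLinear.Build R (nvect E) R^o _ (coord_of i)
  (coord_of_linear i).

Definition base (i : 'I_(\dim {: E})) : nvect E := e`_i.

Lemma coord_baseE x : x = \sum_i coord_of i x *: base i.
Proof.
have := rVofK (vbasisP {: E}) x; rewrite /vecof => {1}<-.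
by apply: eq_bigr => i _.
Qed.

Lemma coord_norm i x : `|coord_of i x| <= `|x|.
Proof.
have -> : `|x| = `|rVof e (x : E)| by [].
rewrite [leRHS]mx_normrE (le_trans _ (le_bigmax _ _ (ord0, i)))//=.
Qed.

Lemma norm_coord x (b : R) : 0 <= b -> (forall i, `|coord_of i x| <= b) ->
  `|x| <= b.
Proof.
move=> b0 xb; have -> : `|x| = `|rVof e (x : E)| by [].
rewrite [leLHS]mx_normrE; apply/bigmax_leP; split => // -[i j] _ /=.
by rewrite (ord1 i); exact: xb.
Qed.

Lemma coord_inj x y : (forall i, coord_of i x = coord_of i y) -> x = y.
Proof.
by move=> xy; rewrite (coord_baseE x) (coord_baseE y); apply: eq_bigr => i _; rewrite xy.
Qed.

Lemma lin_bounded (W : normedModType R) (f : {linear nvect E -> W}) :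
  exists2 c : R, 0 < c & forall x, `|f x| <= c * `|x|.
Proof.
exists (1 + \sum_i `|f (base i)|).
  by rewrite ltr_wpDr// sumr_ge0.
move=> x; rewrite {1}(coord_baseE x) linear_sum (le_trans (ler_norm_sum _ _ _))//.
rewrite mulrDl mul1r ler_wpDl// mulr_suml ler_sum// => i _.
by rewrite linearZ normrZ mulrC ler_wpM2l// coord_norm.
Qed.

Lemma lin_continuous (W : normedModType R) (f : {linear nvect E -> W}) :
  continuous f.
Proof.
have [c c0 fc] := lin_bounded f.
apply/linear_bounded_continuous/linear_boundedP.
exists c; split; first exact: num_real.
by move=> d cd x; rewrite (le_trans (fc x))// ler_wpM2r// ltW.
Qed.

Lemma coord_of_continuous i : continuous (coord_of i : nvect E -> R).
Proof. exact: (@lin_continuous R^o (coord_of i)). Qed.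

(* In the sup norm, pairwise intersecting balls have a common point: this gives
   completeness and limits of Cauchy nets without any filter. *)
Lemma ball_helly (I : Type) (i0 : I) (u : I -> nvect E) (c : I -> R) :
  (forall n m, `|u n - u m| <= c n + c m) ->
  exists l, forall n, `|u n - l| <= c n.
Proof.
move=> uc.
(* In coordinate [i] the balls are intervals and [S i] collects their left ends. As any two
   intervals meet, every right end is an upper bound of [S i], so that the supremum lies in all of
   them. *)
pose S i := [set coord_of i (u n) - c n | n in [set: I]].
have ub i m : ubound (S i) (coord_of i (u m) + c m).
  move=> _ [n _ <-]; rewrite lerBlDr -addrA -lerBlDl addrC.
  rewrite -linearB/= (le_trans (ler_norm _))// (le_trans (coord_norm _ _))//.
  exists (\sum_i sup (S i) *: base i) => n.
have cn : 0 <= c n by have := uc n n; rewrite subrr normr0 -mulr2n pmulrn_lge0.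
apply: norm_coord => // i.
have coE : coord_of i (\sum_j sup (S j) *: base j) = sup (S i).
  rewrite /coord_of.
  have -> : (\sum_j sup (S j) *: base j) = vecof (vbasis {: E}) (\row_j sup (S j)).
    by rewrite /vecof; apply: eq_bigr => j _; rewrite mxE.
  by rewrite vecofK ?mxE//; exact: vbasisP.
rewrite linearB/= coE ler_norml; apply/andP; split.
  suff : sup (S i) <= coord_of i (u n) + c n by lra.
  apply: ge_sup; last exact: ub.
  by exists (coord_of i (u n) - c n), n.
rewrite lerBlDr -lerBlDl; apply: ub_le_sup; last by exists n.
by exists (coord_of i (u n) + c n).
Qed.

End Coordinates.

Section Curves.
Variables (R : realType).

Lemma is_derive_lin (V W : normedModType R) (f : {linear V -> W})
    (y : R -> V) t v : continuous f ->
  is_derive t (1 : R) y v -> is_derive t (1 : R) (f \o y) (f v).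
Proof.
move=> fc yv.
have dy : differentiable y t by apply/derivable1_diffP.
have df x : differentiable f x by exact: linear_differentiable.
apply: DeriveDef; first by apply/derivable1_diffP; exact: differentiable_comp.
rewrite deriveE; last exact: differentiable_comp.
rewrite diff_comp// diff_lin//= -deriveE//.
by rewrite derive_val.
Qed.

Lemma is_derive_continuous (V : normedModType R) (y : R -> V) t v :
  is_derive t (1 : R) y v -> {for t, continuous y}.
Proof. by move=> yv; apply/differentiable_continuous/derivable1_diffP. Qed.

(** The form in which derivative rules are applied: after [move/is_derive_eqfun; apply] only the
    equality of the curves and that of the derivatives remain. *)
Lemma is_derive_eqfun (V : normedModType R) (y z : R -> V) t v w :
  is_derive t (1 : R) y v -> y =1 z -> v = w -> is_derive t (1 : R) z w.
Proof. by move=> yv /funext <- <-. Qed.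

Lemma is_derive_coord (E : vectType R) (y : R -> nvect E) t v i :
  is_derive t (1 : R) y v -> is_derive t (1 : R) (fun s => coord_of i (y s)) (coord_of i v).
Proof.
move=> yv.
by have := @is_derive_lin (nvect E) _ (coord_of i) y t v (@lin_continuous R E _ (coord_of i)) yv.
Qed.

Lemma is_derive_coordP (E : vectType R) (y : R -> nvect E) t v :
  (forall i, is_derive t (1 : R) (fun s => coord_of i (y s)) (coord_of i v)) ->
  is_derive t (1 : R) y v.
Proof.
move=> yv.
have yE : (\sum_i (fun s => coord_of i (y s) *: base i)) = y.
  by apply/funext => s; rewrite fct_sumE -coord_baseE.
have := @is_derive_sum R R (nvect E) _ (fun i s => coord_of i (y s) *: base i) t 1
  (fun i => coord_of i v *: base i).
rewrite yE -coord_baseE; apply => i.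
have dc : differentiable (fun s => coord_of i (y s)) t by apply/derivable1_diffP; case: (yv i).
apply: DeriveDef.
  apply/derivable1_diffP; exact: differentiableZl.
rewrite deriveE; last exact: differentiableZl.
rewrite diffZl//= -deriveE//.
by congr (_ *: _); case: (yv i).
Qed.

Lemma is_deriveZ_curve (E : vectType R) (a : R -> R) (y : R -> nvect E) t a' v :
  is_derive t (1 : R) a a' -> is_derive t (1 : R) y v ->
  is_derive t (1 : R) (fun s => a s *: y s) (a' *: y t + a t *: v).
Proof.
move=> da dy; apply: is_derive_coordP => i.
have dyi := is_derive_coord i dy.
have := is_deriveM da dyi; move/is_derive_eqfun; apply.
  by move=> s /=; rewrite linearZ.
by rewrite linearD !linearZ/= addrC; congr (_ + _); rewrite /GRing.scale/= mulrC.
Qed.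

Lemma derive_ge0_le (f df : R -> R) (a b : R) : a <= b ->
  (forall t, a <= t <= b -> is_derive t (1 : R) f (df t)) ->
  (forall t, a <= t <= b -> 0 <= df t) -> f a <= f b.
Proof.
move=> ab fd df0.
have [||c cab fE] := @MVT_segment R f df a b ab.
- by move=> x /andP[]; rewrite !bnd_simp => /ltW ax /ltW xb; apply: fd; rewrite ax xb.
- apply: derivable_within_continuous => x; rewrite in_itv/= => /fd xd.
  by case: xd.
- rewrite -subr_ge0 fE mulr_ge0 ?subr_ge0// df0//.
Qed.

(** In the sup norm this reduces to the monotonicity of [h] plus or minus each coordinate of [y].
    With exponentials for [h] it replaces the integral estimates of the classical proof. *)
Lemma mean_value_ineq (E : vectType R) (y dy : R -> nvect E) (h dh : R -> R) (a b : R) :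
  a <= b ->
  (forall t, a <= t <= b -> is_derive t (1 : R) y (dy t)) ->
  (forall t, a <= t <= b -> is_derive t (1 : R) h (dh t)) ->
  (forall t, a <= t <= b -> `|dy t| <= dh t) ->
  `|y b - y a| <= h b - h a.
Proof.
move=> ab yd hd yh.
have cyh i t : a <= t <= b -> `|coord_of i (dy t)| <= dh t.
  by move=> tab; rewrite (le_trans (coord_norm _ _))// yh.
apply: norm_coord.
  rewrite subr_ge0; apply: (derive_ge0_le ab hd) => t tab.
  by rewrite (le_trans _ (yh t tab)).
move=> i; rewrite linearB/= ler_norml; apply/andP; split.
  suff : h a + coord_of i (y a) <= h b + coord_of i (y b) by lra.
  apply: (@derive_ge0_le (fun t => h t + coord_of i (y t))
    (fun t => dh t + coord_of i (dy t))) => // t tab.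
    by apply: is_deriveD; [exact: hd|apply: is_derive_coord; exact: yd].
  by have := cyh i t tab; rewrite ler_norml => /andP[]; lra.
suff : h a - coord_of i (y a) <= h b - coord_of i (y b) by lra.
apply: (@derive_ge0_le (fun t => h t - coord_of i (y t))
  (fun t => dh t - coord_of i (dy t))) => // t tab.
  by apply: is_deriveB; [exact: hd|apply: is_derive_coord; exact: yd].
by have := cyh i t tab; rewrite ler_norml => /andP[]; lra.
Qed.

(** The fundamental theorem of calculus is applied to integrals with the fixed lower end [- n],
    hence only for |x| < n. The primitives [J n], normalised at 0, agree wherever two of them are
    valid and can be glued. *)
Lemma real_primitive (g : R -> R) : continuous g ->
  exists G : R -> R, G 0 = 0 /\ forall t, is_derive t (1 : R) G (g t).
Proof.
move=> gc.
pose I (n x : R) := (\int[lebesgue_measure]_(s in `[- n, x]) g s)%R.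
have dI n x : `|x| < n -> is_derive x (1 : R) (I n) (g x).
  move=> xn.
  have xn' : x < n by rewrite (le_lt_trans (ler_norm _)).
  have nx : - n < x by move: xn; rewrite ltr_norml => /andP[].
  have ig : lebesgue_measure.-integrable `[- n, n] (EFin \o g).
    apply: continuous_compact_integrable; first exact: segment_compact.
    exact: continuous_subspaceT.
  have [d1 d2] := continuous_FTC1_closed xn' ig nx (gc x).
  apply: DeriveDef; first exact: d1.
  by rewrite -derive1E; exact: d2.
pose J n x := I n x - I n 0.
have dJ n x : `|x| < n -> is_derive x (1 : R) (J n) (g x).
  move=> xn; rewrite -[X in is_derive _ _ _ X]subr0.
  by apply: is_deriveB; exact: dI.
have JJ n m x : `|x| < n -> `|x| < m -> J n x = J m x.
  move=> xn xm.
  have D t : `|t| <= `|x| -> is_derive t (1 : R) (fun s => J n s - J m s) 0.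
    move=> tx; rewrite -[X in is_derive _ _ _ X](subrr (g t)).
    by apply: is_deriveB; apply: dJ; exact: le_lt_trans tx _.
  have D' t : `|t| <= `|x| -> is_derive t (1 : R) (fun s => - (J n s - J m s)) 0.
    by move=> tx; rewrite -[X in is_derive _ _ _ X]oppr0; apply: is_deriveN; exact: D.
  have J0 k : J k 0 = 0 by rewrite /J subrr.
  have [x0|/ltW x0] := leP 0 x.
    have T t : 0 <= t <= x -> `|t| <= `|x|.
      by move=> /andP[t0 tx]; rewrite !ger0_norm.
    have := derive_ge0_le x0 (fun t h => D t (T t h)) (fun _ _ => lexx _).
    have := derive_ge0_le x0 (fun t h => D' t (T t h)) (fun _ _ => lexx _).
    by rewrite !J0; lra.
  have T t : x <= t <= 0 -> `|t| <= `|x|.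
    by move=> /andP[t0 tx]; rewrite !ler0_norm ?lerN2.
  have := derive_ge0_le x0 (fun t h => D t (T t h)) (fun _ _ => lexx _).
  have := derive_ge0_le x0 (fun t h => D' t (T t h)) (fun _ _ => lexx _).
  by rewrite !J0; lra.
(* The radius moves with [x]. To differentiate at [t], all the primitives used near [t] are compared
   with the fixed one of radius |t| + 2. *)
exists (fun x => J (`|x| + 1) x); split; first by rewrite /J subrr.
move=> t; have := dJ (`|t| + 2) t; rewrite ltrDl => /(_ (ltr0n _ 2)).
apply: near_eq_is_derive.
near=> s.
have st : `|s| < `|t| + 1.
  have : ball (t : R^o) 1 s by near: s; exact: nbhsx_ballx.
  rewrite -ball_normE /= distrC => st.
  by rewrite -{1}(subrK (t : R) s) addrC (le_lt_trans (ler_normD _ _))// ltrD2l.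
by apply: JJ; rewrite ?ltrDl// (lt_trans st)// ltrD2l ltr1n.
Unshelve. all: by end_near. Qed.

Lemma primitive (E : vectType R) (g : R -> nvect E) : continuous g ->
  exists G : R -> nvect E, G 0 = 0 /\ forall t, is_derive t (1 : R) G (g t).
Proof.
move=> gc.
have cg i : continuous (fun s => coord_of i (g s)).
  by move=> s; apply: (@continuous_comp _ _ _ g (coord_of i)); [exact: gc|exact: coord_of_continuous].
pose G i := sval (cid (real_primitive (cg i))).
have G0 i : G i 0 = 0 by rewrite /G; case: cid => ? [].
have dG i t : is_derive t (1 : R) (G i) (coord_of i (g t)) by rewrite /G; case: cid => ? [].
have coE i t : coord_of i (\sum_j G j t *: base j) = G i t.
  have -> : (\sum_j G j t *: base j) = vecof (vbasis {: E}) (\row_j G j t).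
    by rewrite /vecof; apply: eq_bigr => j _; rewrite mxE.
  by rewrite /coord_of vecofK ?mxE//; exact: vbasisP.
exists (fun t => \sum_j G j t *: base j); split.
  by rewrite big1// => j _; rewrite G0 scale0r.
move=> t; apply: is_derive_coordP => i.
by have := dG i t; move/is_derive_eqfun; apply.
Qed.

End Curves.

(** * Ordinary differential equations *)

Section Weights.
Variable R : realType.
Implicit Types m t c : R.

(** The curves bounded by a multiple of [weight m] form the Banach space of the method. The
    multiples are carried along explicitly and no norm on curves is defined. *)
Definition weight m t : R := expR (m * `|t|).

Lemma weight_gt0 m t : 0 < weight m t. Proof. exact: expR_gt0. Qed.

Lemma weight_ge0 m t : 0 <= weight m t. Proof. exact: expR_ge0. Qed.

Lemma weight_ge1 m t : 0 <= m -> 1 <= weight m t.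
Proof. by move=> m0; rewrite -expR0 ler_expR mulr_ge0. Qed.

Lemma weight_le m n t : m <= n -> weight m t <= weight n t.
Proof. by move=> mn; rewrite ler_expR ler_wpM2r. Qed.

Lemma weightD m n t : weight m t * weight n t = weight (m + n) t.
Proof. by rewrite -expRD -mulrDl. Qed.

Lemma weight0 m : weight m 0 = 1.
Proof. by rewrite /weight normr0 mulr0 expR0. Qed.

Lemma weightN m t : weight m (- t) = weight m t.
Proof. by rewrite /weight normrN. Qed.

Lemma weight_shift m s t : 0 <= m -> weight m s <= weight m t * weight m (s - t).
Proof.
move=> m0; rewrite -expRD ler_expR -mulrDr ler_wpM2l//.
by rewrite -{1}(subrK t s) addrC ler_normD.
Qed.

Lemma is_derive_expRM (a t : R) :
  is_derive t (1 : R) (fun s : R => expR (a * s)) (a * expR (a * t)).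
Proof.
have d1 : is_derive t (1 : R) (fun s : R => a * s) a.
  have := is_deriveZ a (is_derive_id t (1 : R)); move/is_derive_eqfun; apply => //.
  by rewrite /GRing.scale/= mulr1.
have d2 : is_derive (a * t) (1 : R) expR (expR (a * t)) by exact: is_derive_expR.
have := is_derive1_comp d2 d1; move/is_derive_eqfun; apply => //.
by rewrite mulrC.
Qed.

(** The derivative of the product is [(de t - C * e t) * expR (- C * t)], which has constant
    sign. *)
Lemma gronwall_up (e de : R -> R) (C s t : R) :
  (forall t, is_derive t (1 : R) e (de t)) -> (forall t, de t <= C * e t) ->
  s <= t -> e t * expR (- C * t) <= e s * expR (- C * s).
Proof.
move=> ed eC st; rewrite -lerN2.
apply: (@derive_ge0_le _ (fun t => - (e t * expR (- C * t)))
   (fun t => - ((de t - C * e t) * expR (- C * t)))) => //.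
  move=> r _; apply: is_deriveN.
  have := is_deriveM (ed r) (is_derive_expRM (- C) r); move/is_derive_eqfun; apply => //.
  by rewrite /GRing.scale/=; ring.
by move=> r _; rewrite -mulNr mulr_ge0 ?expR_ge0// oppr_ge0 subr_le0.
Qed.

Lemma gronwall_down (e de : R -> R) (C s t : R) :
  (forall t, is_derive t (1 : R) e (de t)) -> (forall t, C * e t <= de t) ->
  s <= t -> e s * expR (- C * s) <= e t * expR (- C * t).
Proof.
move=> ed eC st; rewrite -lerN2 -2!mulNr.
apply: (@gronwall_up (fun t => - e t) (fun t => - de t)) => //.
by move=> r; rewrite mulrN lerN2.
Qed.

Lemma gronwall_abs (e de : R -> R) (C t : R) :
  (forall t, is_derive t (1 : R) e (de t)) -> (forall t, `|de t| <= C * e t) ->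
  e t <= e 0 * weight C t.
Proof.
move=> ed eC; rewrite /weight; have [t0|/ltW t0] := leP 0 t.
  have H r : de r <= C * e r by rewrite (le_trans (ler_norm _)).
  have := gronwall_up ed H t0; rewrite mulr0 expR0 mulr1 mulNr expRN => h.
  by rewrite ger0_norm// -ler_pdivrMr ?expR_gt0.
have H r : - C * e r <= de r.
  by have := eC r; rewrite ler_norml mulNr => /andP[].
have := gronwall_down ed H t0; rewrite mulr0 expR0 mulr1 opprK => h.
by rewrite ler0_norm// mulrN expRN -ler_pdivrMr ?invr_gt0 ?expR_gt0// invrK.
Qed.

End Weights.

Lemma eps_continuous (R : realType) (V W : normedModType R) (f : V -> W) (x : V) :
  (forall e : R, 0 < e -> exists2 d : R, 0 < d &
    forall y, `|x - y| <= d -> `|f x - f y| <= e) <-> {for x, continuous f}.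
Proof.
split=> [H|fc e e0].
  apply/cvgrPdist_le => /= e /H[d d0 xd]; near=> y; apply: xd.
  by near: y; move/cvgrPdist_le : (@cvg_id _ (nbhs x)); exact.
move/cvgrPdist_le : fc => /(_ e e0)/nbhs_ballP[d /= d0 xd].
exists (d / 2); first by rewrite divr_gt0.
move=> y xy; apply: xd; rewrite -ball_normE /=.
by rewrite (le_lt_trans xy)// ltr_pdivrMr// ltr_pMr// ltr1n.
Unshelve. all: by end_near. Qed.

Section Ode.
Variables (R : realType) (E : vectType R).

(** Integration divides the constant by [m]. This makes the Picard operator a contraction as soon as
    [m] is large compared with the Lipschitz constant. *)
Lemma mean_value_weight (z dz : R -> nvect E) (c m t : R) : 0 < m ->
  (forall t, is_derive t (1 : R) z (dz t)) ->
  (forall t, `|dz t| <= c * weight m t) ->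
  `|z t - z 0| <= c / m * weight m t.
Proof.
move=> m0 zd dzc.
have c0 : 0 <= c.
  by have := dzc 0; rewrite weight0 mulr1; exact: le_trans.
have cm0 : 0 <= c / m by rewrite divr_ge0// ltW.
have hd (a : R) s : a != 0 ->
    is_derive s (1 : R) (fun s : R => c / a * expR (a * s)) (c * expR (a * s)).
  move=> a0; have := is_deriveZ (c / a) (is_derive_expRM a s).
  move/is_derive_eqfun; apply => //.
  by rewrite /GRing.scale/= mulrA divfK.
have [t0|/ltW t0] := leP 0 t.
  have := @mean_value_ineq _ _ z dz _ _ 0 t t0 (fun s _ => zd s)
    (fun s _ => hd m s (lt0r_neq0 m0)).
  rewrite mulr0 expR0 mulr1 /weight ger0_norm// => H.
  rewrite (le_trans (H _)) ?gerBl// => s /andP[s0 _].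
  by have := dzc s; rewrite /weight ger0_norm.
have mN0 : - m != 0 by rewrite oppr_eq0 lt0r_neq0.
have := @mean_value_ineq _ _ z dz _ _ t 0 t0 (fun s _ => zd s)
    (fun s _ => hd (- m) s mN0).
rewrite mulr0 expR0 mulr1 /weight ler0_norm// distrC => H.
rewrite (le_trans (H _))// => [s /andP[_ s0]|].
  by have := dzc s; rewrite /weight ler0_norm// mulrN mulNr.
by rewrite invrN mulrN mulNr opprK mulNr mulrN gerDr oppr_le0.
Qed.

(** The e / 3 argument, with the weight bounded by [W t + 1] near [t]. It supplies the closedness
    condition of [contraction_fixpoint] for continuous curves. *)
Lemma near_uniform_continuous (y : R -> nvect E) (W : R -> R) : continuous W ->
  (forall e : R, 0 < e -> exists z : R -> nvect E, continuous z /\ forall t, `|y t - z t| <= e * W t) ->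
  continuous y.
Proof.
move=> Wc yz t; apply/cvgrPdist_le => /= e e0.
have W0 : 0 <= W t.
  have [z [_ /(_ t)]] := yz 1 ltr01; rewrite mul1r; exact: le_trans.
have d0 : 0 < e / 3 / (W t + 1) by rewrite !divr_gt0// ltr_wpDl.
have [z [zc yzd]] := yz _ d0.
near=> s.
have Ws : W s <= W t + 1.
  suff : `|W t - W s| <= 1 by rewrite ler_norml; lra.
  by near: s; move/cvgrPdist_le : (Wc t); apply.
have b u : W u <= W t + 1 -> `|y u - z u| <= e / 3.
  move=> Wu; rewrite (le_trans (yzd u))// -[leRHS](@divfK _ (W t + 1)) ?ler_wpM2l//.
    by rewrite ltW.
  by rewrite gt_eqF// ltr_wpDl.
have zs : `|z t - z s| <= e / 3.
  by near: s; move/cvgrPdist_le : (zc t); apply; rewrite divr_gt0.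
have -> : y t - y s = (y t - z t) + (z t - z s) - (y s - z s).
  by rewrite opprB !addrA !subrK.
rewrite (le_trans (ler_normB _ _))// (le_trans (lerD (ler_normD _ _) (lexx _)))//.
rewrite (le_trans (lerD (lerD (b t _) zs) (b s Ws)))//; last by lra.
by rewrite lerDl.
Unshelve. all: by end_near. Qed.

(** Banach's theorem for an operator given as a relation [T], because the solution operators below
    are known only through existence statements. The limit is found time by time with [ball_helly],
    the radii being the tails of the geometric series. *)
Lemma contraction_fixpoint (W : R -> R) (P : (R -> nvect E) -> Prop)
    (T : (R -> nvect E) -> (R -> nvect E) -> Prop) (y0 : R -> nvect E) :
  (forall t, 0 <= W t) -> P y0 ->
  (forall y, P y -> exists2 z, P z & T y z) ->
  (forall y z, P y -> P z -> exists c, forall t, `|y t - z t| <= c * W t) ->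
  (forall y z y' z' c, P y -> P z -> T y y' -> T z z' ->
    (forall t, `|y t - z t| <= c * W t) ->
    forall t, `|y' t - z' t| <= c / 2 * W t) ->
  (forall y, (forall e : R, 0 < e -> exists2 z, P z & forall t, `|y t - z t| <= e * W t) ->
    P y) ->
  exists2 y, P y & T y y.
Proof.
move=> W0 Py0 Tex Pb Tc Pcl.
have Tsig (y : {y | P y}) : exists z : {y | P y}, T (sval y) (sval z).
  by case: y => y Py; have [z Pz Tz] := Tex y Py; exists (exist _ z Pz).
have [f fT] := choice Tsig.
pose u n := iter n f (exist _ y0 Py0).
have [c uc] := Pb _ _ (svalP (u 0%N)) (svalP (u 1%N)).
have uS n t : `|sval (u n) t - sval (u n.+1) t| <= c / 2 ^+ n * W t.
  elim: n t => [|n IH] t; first by rewrite expr0 divr1.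
  have := Tc _ _ _ _ _ (svalP (u n)) (svalP (u n.+1)) (fT (u n)) (fT (u n.+1)) IH t.
  by rewrite exprSr invfM mulrA.
(* The tail of the series with terms [c / 2 ^+ n], starting at index [n]. *)
pose d n := 2 * c / 2 ^+ n.
have dS n : d n - d n.+1 = c / 2 ^+ n.
  rewrite /d exprS; have : (2 ^+ n : R) != 0 by rewrite expf_neq0.
  by move=> h; field.
have uD n k t : `|sval (u n) t - sval (u (n + k)%N) t| <= (d n - d (n + k)%N) * W t.
  elim: k => [|k IH]; first by rewrite addn0 !subrr normr0 mul0r.
  rewrite addnS -(subrK (sval (u (n + k)%N) t) (sval (u n) t)) -addrA.
  rewrite (le_trans (ler_normD _ _))// (le_trans (lerD IH (uS _ _)))//.
  by rewrite -dS -mulrDl addrA subrK.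
have c00 : 0 <= c * W 0 by exact: le_trans (uc 0).
have dW n t : 0 <= d n * W t.
  have := uS n t; have := uS n.+1 t; have := W0 t; have := dS n; have := dS n.+1.
  rewrite /d => *.
  have : 0 <= c / 2 ^+ n * W t by exact: le_trans (uS n t).
  by rewrite (_ : 2 * c / 2 ^+ n * W t = 2 * (c / 2 ^+ n * W t)); [lra|ring].
have uL t : exists l, forall n, `|sval (u n) t - l| <= d n * W t.
  apply: (@ball_helly _ _ nat 0%N) => n m.
  wlog nm : n m / (n <= m)%N.
    move=> H; case: (leqP n m) => [/H//|/ltnW mn].
    by rewrite distrC [leRHS]addrC; exact: H.
  rewrite -(subnKC nm) (le_trans (uD _ _ _))// mulrBl lerD2l.
  by rewrite (le_trans _ (dW _ _))// oppr_le0.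
have [l lu] := choice uL.
have dsmall (e : R) : 0 < e -> exists n, d n <= e.
  move=> e0; have /(upper_nthrootP (x := 2 * c / e)) H := leqnn (Num.Def.archi_bound (2 * c / e)).
  exists (Num.Def.archi_bound (2 * c / e)); rewrite /d ler_pdivrMr ?exprn_gt0//.
  by move: H; rewrite ltr_pdivrMr// => /ltW; rewrite [leRHS]mulrC.
have Pl : P l.
  apply: Pcl => e /dsmall[n ne]; exists (sval (u n)); first exact: svalP.
  by move=> t; rewrite distrC (le_trans (lu t n))// ler_wpM2r.
have [z Pz lz] := Tex l Pl; exists l => //.
suff lzE : (l : R -> nvect E) = z by move: lz; rewrite -lzE.
apply/funext => t.
(* The limit [l] is at distance [d n.+1] from iterate [n.+1], and its image [z] at distance
   [d n / 2]; the two add up to [d n]. *)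
have zl n : `|l t - z t| <= d n * W t.
  rewrite -(subrK (sval (u n.+1) t) (l t)) -addrA.
  rewrite (le_trans (ler_normD _ _))//.
  have := Tc _ _ _ _ _ (svalP (u n)) Pl (fT (u n)) lz (fun t => lu t n) t.
  have := lu t n.+1; rewrite distrC -[f (u n)]/(u n.+1).
  have -> : d n * W t = d n.+1 * W t + d n / 2 * W t.
    have : (2 ^+ n : R) != 0 by rewrite expf_neq0.
    by rewrite /d exprS => ?; field.
  exact: lerD.
apply/eqP; rewrite -subr_eq0 -normr_le0; apply/ler_addgt0Pl => e e0; rewrite addr0.
have [n ne] : exists n, d n <= e / (W t + 1).
  by apply: dsmall; rewrite divr_gt0// ltr_wpDl.
rewrite (le_trans (zl n))// (le_trans (ler_wpM2r (W0 t) ne))//.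
have W1 : 0 < W t + 1 by rewrite ltr_wpDl.
rewrite mulrAC ler_pdivrMr// ler_wpM2l// ?lerDl//.
exact: ltW.
Qed.

Lemma lipschitz_continuous (E' : vectType R) (F : nvect E -> nvect E') (l : R) :
  (forall x y, `|F x - F y| <= l * `|x - y|) -> continuous F.
Proof.
move=> Fl x; apply/eps_continuous => e e0.
have l0 : 0 <= Num.max l 0 by rewrite le_max lexx orbT.
have l1 : 0 < Num.max l 0 + 1 by rewrite ltr_wpDl.
exists (e / (Num.max l 0 + 1)); first by rewrite divr_gt0.
move=> y; rewrite ler_pdivlMr// => xy; rewrite (le_trans (Fl x y))// (le_trans _ xy)//.
by rewrite mulrC ler_wpM2l// (@le_trans _ _ (Num.max l 0))// ?le_max ?lexx// lerDl.
Qed.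

Lemma weight_continuous (m : R) : continuous (weight m).
Proof.
move=> t; apply: (@continuous_comp _ _ _ (fun t : R => m * `|t|) expR); last exact: continuous_expR.
by apply: (@continuousM R R (cst m) (fun t => `|t|)); [exact: cvg_cst|exact: norm_continuous].
Qed.

(** Picard iteration in the weight of exponent [2 * l + 1], where its contraction factor [l / m] is
    below 1 / 2. The solution is obtained on the whole line at once, without continuation of local
    solutions. *)
Lemma lipschitz_ode (F : nvect E -> nvect E) (l : R) (x : nvect E) : 0 <= l ->
  (forall x y, `|F x - F y| <= l * `|x - y|) ->
  exists2 y : R -> nvect E, y 0 = x & forall t, is_derive t (1 : R) y (F (y t)).
Proof.
move=> l0 Fl; have Fc := lipschitz_continuous Fl.
pose m := 2 * l + 1; have m0 : 0 < m by rewrite /m; lra.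
pose P (y : R -> nvect E) := continuous y /\ exists c, forall t, `|y t| <= c * weight m t.
pose T (y z : R -> nvect E) := z 0 = x /\ forall t, is_derive t (1 : R) z (F (y t)).
have [||||||y Py [y0 yF]] := @contraction_fixpoint (weight m) P T (cst 0).
- by move=> t; exact: weight_ge0.
- split; first by move=> t; exact: cvg_cst.
  by exists 0 => t; rewrite mul0r normr0.
- move=> y [yc [c yb]].
  have [|G [G0 dG]] := @primitive R E (F \o y).
    by move=> t; apply: continuous_comp; [exact: yc|exact: Fc].
  have dz t : is_derive t (1 : R) (fun t => x + G t) (F (y t)).
    by rewrite -[F _]add0r; apply: is_deriveD; exact: dG.
  exists (fun t => x + G t); last first.
    by split => //; rewrite G0 addr0.
  split; first by move=> t; exact: is_derive_continuous (dz t).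
  exists (`|x| + (`|F 0| + l * c) / m) => t.
  rewrite mulrDl (le_trans (ler_normD _ _))// lerD//.
    by rewrite ler_peMr// weight_ge1// ltW.
  rewrite -[G t]subr0 -[X in _ - X]G0; apply: mean_value_weight => // s /=.
  rewrite mulrDl -[F (y s)](subrK (F 0)) addrC (le_trans (ler_normD _ _))// lerD//.
    by rewrite ler_peMr// weight_ge1// ltW.
  by rewrite (le_trans (Fl _ _))// subr0 -mulrA ler_wpM2l.
- move=> y z [_ [c yb]] [_ [d zb]]; exists (c + d) => t.
  by rewrite mulrDl (le_trans (ler_normB _ _))// lerD.
- move=> y z y' z' c Py Pz [y0 dy] [z0 dz] yz t.
  have c0 : 0 <= c by have := yz 0; rewrite weight0 mulr1; exact: le_trans.
  have := @mean_value_weight (fun t => y' t - z' t) (fun t => F (y t) - F (z t)) (l * c) m t m0.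
  rewrite y0 z0 !subrr subr0 => /(_ _ _)/le_trans; apply.
  + by move=> s; rewrite (le_trans (Fl _ _))// -mulrA ler_wpM2l.
  + rewrite ler_wpM2r ?weight_ge0// ler_pdivrMr// mulrAC ler_pdivlMr// mulrC mulrA.
    by rewrite mulrC ler_wpM2l// /m; lra.
- move=> y yP; split.
    apply: (@near_uniform_continuous _ (weight m)); first exact: weight_continuous.
    by move=> e /yP[z [zc _] yz]; exists z.
  have [z [_ [c zb]] yz] := yP 1 ltr01; exists (1 + c) => t.
  by rewrite mulrDl -[y t](subrK (z t)) (le_trans (ler_normD _ _))// lerD.
by exists y.
Qed.

(* [`|u|] need not be differentiable, so Gronwall's inequality is applied to the
   sum of the squares of the coordinates. *)
Lemma gronwall_curve (l : R) : 0 <= l -> exists m K : R, [/\ 0 < m, 0 < K &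
  forall (u du : R -> nvect E), (forall t, is_derive t (1 : R) u (du t)) ->
  (forall t, `|du t| <= l * `|u t|) -> forall t, `|u t| <= K * `|u 0| * weight m t].
Proof.
move=> l0; pose n : R := (\dim {: E})%:R.
have n0 : 0 <= n by rewrite ler0n.
have e0 : 0 <= n * l by rewrite mulr_ge0.
exists (n * l + 1), (n + 1); split; [lra|lra|move=> u du ud uldu t].
pose e t := \sum_i coord_of i (u t) ^+ 2.
pose de t := \sum_i 2 * coord_of i (u t) * coord_of i (du t).
have ed s : is_derive s (1 : R) e (de s).
  have := @is_derive_sum R R R _ (fun i s => coord_of i (u s) ^+ 2) s 1
    (fun i => 2 * coord_of i (u s) * coord_of i (du s)).
  rewrite (_ : (\sum_i _) = e); last by apply/funext => r; rewrite fct_sumE.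
  apply => i; have := is_deriveX 2 (is_derive_coord i (ud s)); move/is_derive_eqfun; apply => //.
have ue s : `|u s| ^+ 2 <= e s.
  have e_ge0 : 0 <= e s by apply: sumr_ge0 => i _; rewrite sqr_ge0.
  rewrite -[leRHS]sqr_sqrtr// lerXn2r ?nnegrE ?sqrtr_ge0//.
  apply: norm_coord; rewrite ?sqrtr_ge0// => i.
  rewrite -sqrtr_sqr ler_sqrt//; rewrite /e (bigD1 i)//= lerDl.
  by apply: sumr_ge0 => j _; rewrite sqr_ge0.
have eu s : e s <= n * `|u s| ^+ 2.
  rewrite mulr_natl -[X in _ *+ X]card_ord -sumr_const; apply: ler_sum => i _.
  by rewrite -[leLHS]real_normK ?num_real// lerXn2r ?nnegrE ?coord_norm.
have H s : `|de s| <= (2 * (n * l)) * e s.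
  rewrite (le_trans (ler_norm_sum _ _ _))//.
  apply: (@le_trans _ _ (\sum_(i < \dim {: E}) 2 * l * `|u s| ^+ 2)).
    apply: ler_sum => i _; rewrite !normrM (ger0_norm (ler0n _ 2)) -mulrA -[leRHS]mulrA.
    rewrite ler_wpM2l// mulrC expr2 mulrA ler_pM// ?coord_norm//.
    by rewrite (le_trans (coord_norm _ _)).
  rewrite sumr_const card_ord -[leLHS]mulr_natl -/n.
  rewrite (_ : n * _ = 2 * (n * l) * `|u s| ^+ 2); last by ring.
  by rewrite ler_wpM2l// mulr_ge0.
have := gronwall_abs t ed H => {}H.
rewrite -(@ler_pXn2r _ 2)// ?nnegrE ?mulr_ge0 ?weight_ge0//; last lra.
rewrite (le_trans (ue t))// (le_trans H)//.
rewrite exprMn ler_pM//.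
- by rewrite (le_trans _ (ue 0))// sqr_ge0.
- exact: weight_ge0.
- rewrite (le_trans (eu 0))// exprMn ler_wpM2r ?sqr_ge0//; nra.
- by rewrite expr2 weightD weight_le//; lra.
Qed.

Lemma ode_unique (F : nvect E -> nvect E) (l : R) (y z : R -> nvect E) : 0 <= l ->
  (forall x y, `|F x - F y| <= l * `|x - y|) ->
  (forall t, is_derive t (1 : R) y (F (y t))) ->
  (forall t, is_derive t (1 : R) z (F (z t))) ->
  y 0 = z 0 -> y = z.
Proof.
move=> l0 Fl yF zF yz; have [m [K [_ _ H]]] := gronwall_curve l0.
apply/funext => t; apply/eqP; rewrite -subr_eq0 -normr_le0.
have := H (fun t => y t - z t) (fun t => F (y t) - F (z t)) _ _ t.
rewrite yz subrr normr0 mulr0 mul0r; by apply => s; last exact: Fl.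
Qed.

End Ode.

(** * Spectral projections and growth rates *)

Lemma addr_cross (V : zmodType) (p q w z : V) : p + q = w + z -> p - w = z - q.
Proof.
by move=> H; apply/eqP; rewrite subr_eq addrAC [z + w]addrC -H addrK.
Qed.

Lemma sqr_le_norm (R : realDomainType) (x y : R) : `|x| <= y -> x ^+ 2 <= y ^+ 2.
Proof.
move=> xy; rewrite -[leLHS]real_normK ?num_real// lerXn2r// ?nnegrE//.
exact: le_trans xy.
Qed.

Lemma term_le_sum (R : realDomainType) (I : eqType) (r : seq I) (P : pred I)
    (f : I -> R) (a : I) : a \in r -> P a -> (forall i, 0 <= f i) ->
  f a <= \sum_(i <- r | P i) f i.
Proof. by move=> ar Pa f0; rewrite (big_rem a ar)/= Pa lerDl sumr_ge0. Qed.

Section SpectralProjectors.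
Variable F : fieldType.

Lemma coprime_XsubC_exp (a b : F) m n : a != b ->
  coprimep (('X - a%:P) ^+ m) (('X - b%:P) ^+ n).
Proof.
move=> ab; apply: coprimep_expl; apply: coprimep_expr.
by rewrite coprimep_XsubC root_XsubC eq_sym.
Qed.

(** The [p l] are the idempotents of the Chinese remainder theorem modulo the product of the
    pairwise coprime [d l]. Evaluated at a matrix they become its spectral projections. *)
Lemma bezout_family (d : F -> {poly F}) (s : seq F) : uniq s ->
  (forall a b, a != b -> coprimep (d a) (d b)) ->
  exists p : F -> {poly F}, exists q : {poly F},
    \sum_(l <- s) p l + q * \prod_(l <- s) d l = 1 /\
    forall l, l \in s -> \prod_(l <- s) d l %| d l * p l.
Proof.
move=> + dc; elim: s => [_|a s IH /= /andP[as_ us]].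
  by exists (fun=> 0), 1; rewrite !big_nil add0r mulr1.
have [p [q [pq dp]]] := IH us.
have : coprimep (d a) (\prod_(l <- s) d l).
  rewrite (@big_morph _ _ (coprimep (d a)) true andb).
  - rewrite big_all; apply/allP => b bs; apply: dc.
    by apply: contraNneq as_ => ->.
  - by move=> x y; rewrite coprimepMr.
  - exact: coprimep1.
move=> /Bezout_eq1_coprimepP[[u v] /= uv].
exists (fun l => if l == a then v * \prod_(l <- s) d l else u * d a * p l), (u * q).
rewrite !big_cons eqxx; split.
  rewrite (_ : \sum_(j <- s) _ = u * d a * \sum_(j <- s) p j).
    move: pq uv; set P := \prod_(l <- s) d l; set T := \sum_(l <- s) p l => pq uv.
    transitivity (v * P + u * d a * (T + q * P)); first by ring.
    by rewrite pq mulr1 addrC.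
  rewrite mulr_sumr big_seq [RHS]big_seq; apply: eq_bigr => b bs.
  by case: eqP => // ba; rewrite -ba bs in as_.
move=> l; rewrite in_cons; case: eqP => [-> _|_ /= /dp H].
  by rewrite mulrCA dvdp_mull.
rewrite (_ : d l * _ = u * (d a * (d l * p l))); last by ring.
by rewrite dvdp_mull// dvdp_mul.
Qed.

Lemma map_mx_exp (F' : fieldType) (f : {rmorphism F -> F'}) n (M : 'M[F]_n) k :
  map_mx f (M ^+ k) = (map_mx f M) ^+ k.
Proof.
elim: k => [|k IH]; first by rewrite !expr0 [LHS]map_scalar_mx rmorph1.
by rewrite !exprS [LHS](map_mxM f M (M ^+ k)) IH.
Qed.

Lemma daddv_piE (vT : vectType F) (U V : {vspace vT}) y z : (U :&: V = 0)%VS ->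
  y \in U -> z \in V -> daddv_pi U V (y + z) = y.
Proof.
move=> cap yU zV; rewrite linearD/= daddv_pi_id//.
have cap' : (V :&: U = 0)%VS by rewrite capvC.
have := @daddv_pi_add _ _ U V z cap.
rewrite (daddv_pi_id cap' zV) => /(_ _)/eqP; rewrite -subr_eq0 addrK => H.
suff /eqP -> : daddv_pi U V z == 0 by rewrite addr0.
by apply: H; rewrite -[z]add0r memv_add// mem0v.
Qed.

(** A Bezout relation between the two coprime powers, evaluated at [A], writes [w] as a combination
    of two vanishing vectors. *)
Lemma killed_coprime n (A : 'M[F]_n) (w : 'rV_n) a b i j : a != b ->
  w *m (A - a%:M) ^+ i = 0 -> w *m (A - b%:M) ^+ j = 0 -> w = 0.
Proof.
case: n => [|n] in A w *; first by move=> *; rewrite [w]thinmx0.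
move=> ab wa wb; have := coprime_XsubC_exp i j ab.
move=> /Bezout_eq1_coprimepP[[u v] /= uv].
have hE c k : (A - c%:M) ^+ k = horner_mx A (('X - c%:P) ^+ k).
  by rewrite rmorphXn/= rmorphB/= horner_mx_X horner_mx_C.
rewrite hE in wa; rewrite hE in wb.
have := congr1 (fun p => w *m horner_mx A p) uv.
rewrite /= rmorph1 mulmx1 rmorphD/= mulmxDr [u * _]mulrC [v * _]mulrC !rmorphM/=.
by rewrite -!mulmxE !mulmxA wa wb !mul0mx addr0 => <-.
Qed.

(** The common exponent [n] bounds every algebraic multiplicity, so that none has to be tracked. By
    Cayley-Hamilton the whole product annihilates [A]. *)
Lemma spectral_projectors n (A : 'M[F]_n) (s : seq F) : uniq s ->
  char_poly A %| \prod_(l <- s) ('X - l%:P) ^+ n ->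
  exists Pr : F -> 'M[F]_n,
    [/\ forall l, Pr l *m A = A *m Pr l,
        forall l, l \in s -> Pr l *m (A - l%:M) ^+ n = 0 &
        \sum_(l <- s) Pr l = 1%:M].
Proof.
case: n => [|n] in A *.
  by move=> _ _; exists (fun=> 0); split => // *; apply/matrixP => -[].
move=> us /dvdpP[c cP].
have P0 : horner_mx A (\prod_(l <- s) ('X - l%:P) ^+ n.+1) = 0.
  by rewrite cP rmorphM/= Cayley_Hamilton mulr0.
have [p [q [pq dp]]] := bezout_family us (fun a b ab => coprime_XsubC_exp n.+1 n.+1 ab).
exists (fun l => horner_mx A (p l)); split.
- by move=> l; apply/esym; apply: comm_mx_horner.
- move=> l /dp/dvdpP[r rP].
  have -> : (A - l%:M) ^+ n.+1 = horner_mx A (('X - l%:P) ^+ n.+1).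
    by rewrite rmorphXn/= rmorphB/= horner_mx_X horner_mx_C.
  by rewrite mulmxE -rmorphM/= mulrC rP rmorphM/= P0 mulr0.
- have := congr1 (horner_mx A) pq.
  by rewrite rmorphD rmorphM/= P0 mulr0 addr0 rmorph_sum/= rmorph1.
Qed.

Lemma sub_geigenspace n (A : 'M[F]_n) (w : 'rV_n) l :
  (w <= geigenspace A l)%MS = (w *m (A - l%:M) ^+ n == 0).
Proof.
case: n => [|n] in A w *; first by rewrite [w]thinmx0 sub0mx mul0mx eqxx.
by rewrite geigenspaceE; apply/sub_kermxP/eqP.
Qed.

End SpectralProjectors.

Section SpectralSpaces.
Variables (R : realType) (E : vectType R) (L : 'End(E)).
Local Notation C := (R[i]%C).
Local Notation e := (vbasis {: E}).
Local Notation n := (\dim {: E}).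
Local Notation A := (complexified L).
Local Notation sp := (spectrum L).

Definition cvec (x : E) : 'rV[C]_n := map_mx (real_complex R) (rVof e x).

Lemma cvec_inj : injective cvec.
Proof.
move=> x y xy; apply: (can_inj (rVofK (vbasisP _))).
apply/matrixP => i j; move/matrixP : xy => /(_ i j).
by rewrite !mxE => /complexI.
Qed.

Lemma cvecD x y : cvec (x + y) = cvec x + cvec y.
Proof. by rewrite /cvec linearD/= map_mxD. Qed.

Lemma cvecZ (a : R) x : cvec (a *: x) = (a%:C)%C *: cvec x.
Proof. by rewrite /cvec linearZ/= map_mxZ. Qed.

Lemma cvec0 : cvec 0 = 0.
Proof. by rewrite /cvec linear0 map_mx0. Qed.

Lemma cvec_app x : cvec (L x) = cvec x *m A.
Proof. rewrite /cvec /complexified -map_mxM/=; congr map_mx.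
by apply: rVof_app; exact: vbasisP. Qed.

Lemma spectrum_uniq : uniq sp. Proof. exact: undup_uniq. Qed.

Lemma char_poly_dvd_spectrum :
  char_poly A %| \prod_(l <- sp) ('X - l%:P) ^+ n.
Proof.
rewrite /spectrum; case: closed_field_poly_normal => s /= sE.
have ss : size s = n.
  have := congr1 (fun p : {poly C} => size p) sE.
  by rewrite size_char_poly size_scale ?lead_coef_eq0 ?monic_neq0 ?char_poly_monic// size_prod_XsubC => -[].
rewrite sE (monicP (char_poly_monic _)) scale1r.
rewrite -[X in X %| _](@prodr_undup_exp_count _ _ s predT).
elim: (undup s) => [|a u IH]; first by rewrite !big_nil.
rewrite !big_cons dvdp_mul// dvdp_exp2l//.
by rewrite -ss count_size.
Qed.

Lemma cvecP (w : 'rV[C]_n) : map_mx conjc w = w -> exists x, cvec x = w.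
Proof.
move=> wr; exists (vecof e (map_mx (@complex.Re R) w)).
rewrite /cvec vecofK; last exact: vbasisP.
apply/matrixP => i j; rewrite !mxE.
move/matrixP : wr => /(_ i j); rewrite !mxE.
by case: (w i j) => a b /= [] /eqP; rewrite eq_sym -addr_eq0 -mulr2n mulrn_eq0/= => /eqP ->.
Qed.

Lemma conj_cvec x : map_mx conjc (cvec x) = cvec x.
Proof. by apply/matrixP => i j; rewrite !mxE /= oppr0. Qed.

Lemma conj_complexified : map_mx conjc A = A.
Proof. by apply/matrixP => i j; rewrite !mxE /= oppr0. Qed.

Definition projector : C -> 'M[C]_n :=
  sval (cid (spectral_projectors spectrum_uniq char_poly_dvd_spectrum)).

Local Notation Pr := projector.

Lemma projectorC l : Pr l *m A = A *m Pr l.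
Proof. by move: l; rewrite /Pr; case: cid => p []. Qed.

Lemma projector_ker l : l \in sp -> Pr l *m (A - l%:M) ^+ n = 0.
Proof. by move: l; rewrite /Pr; case: cid => p []. Qed.

Lemma projector_sum : \sum_(l <- sp) Pr l = 1%:M.
Proof. by rewrite /Pr; case: cid => p []. Qed.

Lemma projector_comm (M : 'M[C]_n) a k : M *m A = A *m M ->
  M *m (A - a%:M) ^+ k = (A - a%:M) ^+ k *m M.
Proof.
move=> MA; elim: k => [|k IH]; first by rewrite !expr0 mulmx1 mul1mx.
rewrite exprS -[_ * _]/(_ *m _) mulmxA mulmxBr MA scalar_mxC -mulmxBl.
by rewrite -!mulmxA IH.
Qed.

Lemma killed_projector (w : 'rV[C]_n) l l' k : l \in sp -> l != l' ->
  w *m (A - l'%:M) ^+ k = 0 -> w *m Pr l = 0.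
Proof.
move=> ls ll' wk; apply: (@killed_coprime _ _ A _ l l' n k) => //.
  by rewrite -mulmxA projector_ker// mulmx0.
by rewrite -mulmxA projector_comm ?projectorC// mulmxA wk mul0mx.
Qed.

(** A generalized eigenvector for another eigenvalue is killed by [Pr l] by coprimality, and
    conversely [w] is the sum of its projections. Sums of eigenspaces are thereby traded for linear
    conditions. *)
Lemma sub_spectral_mx (S : pred C) (w : 'rV[C]_n) :
  (w <= spectral_mx L S)%MS <-> (forall l, l \in sp -> ~~ S l -> w *m Pr l = 0).
Proof.
split=> [wS l ls Sl|H].
  apply/sub_kermxP; apply: (submx_trans wS).
  rewrite /spectral_mx; apply: (big_ind (fun M => (M <= kermx (Pr l))%MS)).
  - exact: sub0mx.
  - by move=> M N HM HN; rewrite addsmx_sub HM.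
  - move=> l' Sl'; apply/rV_subP => v; rewrite (sub_geigenspace A v l') => /eqP vl'.
    apply/sub_kermxP; apply: killed_projector vl' => //.
    by apply: contraNneq Sl => ->.
rewrite -[w]mulmx1 -projector_sum mulmx_sumr big_seq.
apply: (big_ind (fun v : 'rV_n => (v <= spectral_mx L S)%MS)).
- exact: sub0mx.
- by move=> x y; exact: addmx_sub.
- move=> l ls; have [Sl|Sl] := boolP (S l); last by rewrite H// sub0mx.
  have wl : (w *m Pr l <= geigenspace A l)%MS.
    by rewrite sub_geigenspace -mulmxA projector_ker// mulmx0.
  apply: (submx_trans wl); rewrite /spectral_mx (big_rem l)//= Sl.
  exact: addsmxSl.
Qed.

Lemma spectral_spaceP (S : pred C) x : x \in spectral_space L S <->
  (forall l, l \in sp -> ~~ S l -> cvec x *m Pr l = 0).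
Proof. by rewrite mem_spectral_space; exact: sub_spectral_mx. Qed.

(** The condition under which the spectral projection for [S] maps real vectors to real vectors. *)
Definition conj_closed (S : pred C) := forall l : C, S l -> S (conjc l).

Lemma spectral_part (S : pred C) (x : E) : conj_closed S ->
  exists y, cvec y = \sum_(l <- sp | S l) cvec x *m Pr l.
Proof.
move=> Scl; apply: cvecP.
set w := \sum_(l <- sp | S l) _.
have Scl' l : ~~ S l -> ~~ S (conjc l).
  by apply: contra => /Scl; rewrite conjcK.
pose w' := \sum_(l <- sp | ~~ S l) cvec x *m Pr l.
have ww' : w + w' = cvec x.
  rewrite -[RHS]mulmx1 -projector_sum mulmx_sumr.
  by rewrite [RHS](bigID S).
have part (T : pred C) l0 : conj_closed T -> l0 \in sp -> ~~ T l0 ->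
  (\sum_(l <- sp | T l) cvec x *m Pr l) *m Pr l0 = 0 /\
  map_mx conjc (\sum_(l <- sp | T l) cvec x *m Pr l) *m Pr l0 = 0.
  move=> Tcl ls Tl0; split.
    rewrite mulmx_suml big_seq_cond big1// => l /andP[lsp Tl].
    apply: (@killed_projector _ _ l n) => //.
      by apply: contraNneq Tl0 => ->.
    by rewrite -mulmxA projector_ker// mulmx0.
  rewrite map_mx_sum mulmx_suml big_seq_cond big1// => l /andP[lsp Tl].
  apply: (@killed_projector _ _ (conjc l) n) => //.
    by apply: contraNneq Tl0 => ->; exact: Tcl.
  have -> : (A - (conjc l)%:M) ^+ n = map_mx conjc ((A - l%:M) ^+ n).
    have -> : A - (conjc l)%:M = map_mx conjc (A - l%:M).
      by rewrite map_mxB conj_complexified map_scalar_mx.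
    by rewrite map_mx_exp.
  by rewrite -map_mxM -mulmxA projector_ker// mulmx0 map_mx0.
(* The difference [u] between the conjugate of [w] and [w] has two expressions, one through the
   eigenvalues in [S] and one through those outside. The first shows that [u] is killed by the
   projectors outside [S], the second that it is killed by those in [S]. *)
apply/eqP; rewrite -subr_eq0; apply/eqP; set u := _ - w.
have uE : u = w' - map_mx conjc w'.
  have := congr1 (map_mx (@conjc R)) ww'; rewrite conj_cvec map_mxD -ww' /u.
  exact: addr_cross.
rewrite -[u]mulmx1 -projector_sum mulmx_sumr big_seq big1// => l ls.
have [Sl|Sl] := boolP (S l); last first.
  by have [h1 h2] := part S l Scl ls Sl; rewrite /u mulmxBl h1 h2 subrr.
have [|h1 h2] := part (fun l => ~~ S l) l Scl' ls; first by rewrite negbK.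
by rewrite uE mulmxBl h1 h2 subrr.
Qed.

Lemma spectral_capv (S T : pred C) : (forall l, T l = ~~ S l) ->
  (spectral_space L S :&: spectral_space L T = 0)%VS.
Proof.
move=> TS; apply/eqP; rewrite -subv0; apply/subvP => x.
rewrite memv_cap => /andP[/spectral_spaceP xS /spectral_spaceP xT].
suff -> : x = 0 by rewrite mem0v.
apply: cvec_inj; rewrite cvec0 -[LHS]mulmx1 -projector_sum mulmx_sumr.
rewrite big_seq big1// => l ls.
have [Sl|Sl] := boolP (S l); last exact: xS.
by apply: xT => //; rewrite TS negbK.
Qed.

(** This formula makes the real projections computable: their sums, their compositions and their
    naturality are all read off from the complex projectors. *)
Lemma cvec_daddv (S T : pred C) (x : E) : conj_closed S -> (forall l, T l = ~~ S l) ->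
  cvec (daddv_pi (spectral_space L S) (spectral_space L T) x) =
  \sum_(l <- sp | S l) cvec x *m Pr l.
Proof.
move=> Scl TS; have Tcl : conj_closed T.
  by move=> l; rewrite !TS; apply: contra => /Scl; rewrite conjcK.
have mem (P : pred C) y l : l \in sp -> ~~ P l ->
    cvec y = \sum_(l <- sp | P l) cvec x *m Pr l -> cvec y *m Pr l = 0.
  move=> ls Pl ->; rewrite mulmx_suml big_seq_cond big1// => l' /andP[lsp Pl'].
  apply: (@killed_projector _ _ l' n) => //.
    by apply: contraNneq Pl => ->.
  by rewrite -mulmxA projector_ker// mulmx0.
have [y yE] := spectral_part x Scl; have [z zE] := spectral_part x Tcl.
have yS : y \in spectral_space L S by apply/spectral_spaceP => l ls Sl; exact: mem yE.
have zT : z \in spectral_space L T by apply/spectral_spaceP => l ls Sl; exact: mem zE.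
have xyz : x = y + z.
  apply: cvec_inj; rewrite cvecD yE zE -[LHS]mulmx1 -projector_sum mulmx_sumr.
  rewrite (bigID S)/=; congr (_ + _); by under [RHS]eq_bigl do rewrite TS.
rewrite -yE; congr cvec; rewrite xyz.
exact: daddv_piE (spectral_capv TS) yS zT.
Qed.

(** On the chain of matrices [Pr l *m (A - l%:M) ^+ j] the map acts as [l] plus a shift. These
    chains replace a Jordan basis. *)
Lemma projector_step l j :
  A *m (Pr l *m (A - l%:M) ^+ j) =
  l *: (Pr l *m (A - l%:M) ^+ j) + Pr l *m (A - l%:M) ^+ j.+1.
Proof.
rewrite mulmxA -projectorC -mulmxA exprS -[(A - _) * _]/((A - l%:M) *m _).
by rewrite mulmxBl mul_scalar_mx mulmxBr -scalemxAr [RHS]addrC subrK.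
Qed.

(** [cre] and [cim] are the real coordinates of [x] along the chain of [l]. The chain stops at
    [j = n], where [projector_ker] gives 0. *)
Definition cre (l : C) (j : nat) (i : 'I_n) (x : nvect E) : R :=
  complex.Re ((cvec x *m (Pr l *m (A - l%:M) ^+ j)) 0 i).
Definition cim (l : C) (j : nat) (i : 'I_n) (x : nvect E) : R :=
  complex.Im ((cvec x *m (Pr l *m (A - l%:M) ^+ j)) 0 i).

Lemma cre_linear l j i : linear (cre l j i : nvect E -> R^o).
Proof.
move=> a x y; rewrite /cre cvecD cvecZ mulmxDl -scalemxAl !mxE.
case: (\sum_j0 _) => p q; case: (\sum_j0 _) => p' q'.
by rewrite -[_ * _]/(mulc _ _) /= mul0r subr0.
Qed.

Lemma cim_linear l j i : linear (cim l j i : nvect E -> R^o).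
Proof.
move=> a x y; rewrite /cim cvecD cvecZ mulmxDl -scalemxAl !mxE.
case: (\sum_j0 _) => p q; case: (\sum_j0 _) => p' q'.
by rewrite -[_ * _]/(mulc _ _) /= mul0r addr0.
Qed.

HB.instance Definition _ l j i := GRing.isLinear.Build R (nvect E) R^o _ (cre l j i)
  (cre_linear l j i).
HB.instance Definition _ l j i := GRing.isLinear.Build R (nvect E) R^o _ (cim l j i)
  (cim_linear l j i).

Lemma cre_app (l : C) j i x :
  cre l j i (L x) = complex.Re l * cre l j i x - complex.Im l * cim l j i x + cre l j.+1 i x.
Proof.
rewrite /cre /cim cvec_app -mulmxA projector_step mulmxDr -scalemxAr !mxE.
by case: l (\sum_j0 _) (\sum_j0 _) => a b [p q] [p' q'].
Qed.

Lemma cim_app (l : C) j i x :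
  cim l j i (L x) = complex.Re l * cim l j i x + complex.Im l * cre l j i x + cim l j.+1 i x.
Proof.
rewrite /cre /cim cvec_app -mulmxA projector_step mulmxDr -scalemxAr !mxE.
by case: l (\sum_j0 _) (\sum_j0 _) => a b [p q] [p' q'].
Qed.

Lemma cre_last l i x : l \in sp -> cre l n i x = 0.
Proof. by move=> ls; rewrite /cre projector_ker// mulmx0 mxE. Qed.

Lemma cim_last l i x : l \in sp -> cim l n i x = 0.
Proof. by move=> ls; rewrite /cim projector_ker// mulmx0 mxE. Qed.

(** From 2 r_j r_(j+1) <= d r_j^2 + d^-1 r_(j+1)^2. The weight d^-2 per step turns the second term
    into [d] times the next summand, and the vanishing of [r m] closes the shifted sum. *)
Lemma weighted_shift_bound (m : nat) (r : nat -> R) (d : R) : 0 < d -> r m = 0 ->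
  `|\sum_(j < m) (d^-1 ^+ 2) ^+ j * (2 * (r j * r j.+1))| <=
  2 * d * \sum_(j < m) (d^-1 ^+ 2) ^+ j * r j ^+ 2.
Proof.
move=> d0 rm; set th := d^-1 ^+ 2.
have th0 j : 0 <= th ^+ j by rewrite exprn_ge0// exprn_ge0// invr_ge0 ltW.
pose f j := th ^+ j * r j ^+ 2.
have f0 j : 0 <= f j by rewrite mulr_ge0// sqr_ge0.
have shiftE : \sum_(j < m) f j.+1 <= \sum_(j < m) f j.
  have E1 : \sum_(j < m.+1) f j = \sum_(j < m) f j + f m by rewrite big_ord_recr.
  have E2 : \sum_(j < m.+1) f j = f 0%N + \sum_(j < m) f j.+1 by rewrite big_ord_recl.
  have fm : f m = 0 by rewrite /f rm expr0n/= mulr0.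
  by have := f0 0%N; lra.
rewrite (le_trans (ler_norm_sum _ _ _))//.
apply: (@le_trans _ _ (\sum_(j < m) (d * f j + d * f j.+1))).
  apply: ler_sum => j _; rewrite normrM ger0_norm//.
  rewrite (_ : d * f j + _ = th ^+ j * (d * r j ^+ 2 + d^-1 * r j.+1 ^+ 2)).
    rewrite ler_wpM2l// ler_norml.
    have dd : d * d^-1 = 1 by rewrite mulfV// gt_eqF.
    have di : 0 < d^-1 by rewrite invr_gt0.
    have h1 : 0 <= d^-1 * (d * r j - r j.+1) ^+ 2 by rewrite mulr_ge0// ?sqr_ge0 ?ltW.
    have h2 : 0 <= d^-1 * (d * r j + r j.+1) ^+ 2 by rewrite mulr_ge0// ?sqr_ge0 ?ltW.
    have e1 : d^-1 * (d * r j - r j.+1) ^+ 2 = d * r j ^+ 2 + d^-1 * r j.+1 ^+ 2 - 2 * (r j * r j.+1).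
      by field; rewrite gt_eqF.
    have e2 : d^-1 * (d * r j + r j.+1) ^+ 2 = d * r j ^+ 2 + d^-1 * r j.+1 ^+ 2 + 2 * (r j * r j.+1).
      by field; rewrite gt_eqF.
    by rewrite e1 in h1; rewrite e2 in h2; lra.
  have dth : d^-1 = d * th by rewrite /th expr2 mulrA divff ?mul1r// gt_eqF.
  rewrite /f (exprS th j) dth mulrDr; congr (_ + _); first by rewrite mulrCA.
  have r4 (a b p q : R) : a * (b * p * q) = p * (a * b * q) by ring.
  exact: r4.
rewrite big_split/= -!mulr_sumr -mulrA mulr_natl mulr2n lerD2l ler_wpM2l// ltW//.
Qed.

(* The factor d^-2 per step along a Jordan chain makes the contribution of the
   nilpotent part at most d, whence growth rates within d of [complex.Re l]. *)
Definition energy (S : pred C) (d : R) (x : nvect E) : R :=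
  \sum_(l <- sp | S l) \sum_(i < n) \sum_(j < n)
    (d^-1 ^+ 2) ^+ j * (cre l j i x ^+ 2 + cim l j i x ^+ 2).

Definition denergy (S : pred C) (d : R) (x : nvect E) : R :=
  \sum_(l <- sp | S l) \sum_(i < n) \sum_(j < n)
    (d^-1 ^+ 2) ^+ j * (2 * (cre l j i x * cre l j i (L x) + cim l j i x * cim l j i (L x))).

Lemma denergy_bound l i (d : R) (x : nvect E) : 0 < d -> l \in sp ->
  `|\sum_(j < n) (d^-1 ^+ 2) ^+ j *
       (2 * (cre l j i x * cre l j i (L x) + cim l j i x * cim l j i (L x)))
    - 2 * complex.Re l * \sum_(j < n) (d^-1 ^+ 2) ^+ j * (cre l j i x ^+ 2 + cim l j i x ^+ 2)|
  <= 2 * d * \sum_(j < n) (d^-1 ^+ 2) ^+ j * (cre l j i x ^+ 2 + cim l j i x ^+ 2).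
Proof.
move=> d0 ls.
have h1 := @weighted_shift_bound n (fun j => cre l j i x) d d0 (cre_last i x ls).
have h2 := @weighted_shift_bound n (fun j => cim l j i x) d d0 (cim_last i x ls).
rewrite mulr_sumr -sumrB.
rewrite (eq_bigr (fun j : 'I_n => (d^-1 ^+ 2) ^+ j * (2 * (cre l j i x * cre l j.+1 i x)) +
   (d^-1 ^+ 2) ^+ j * (2 * (cim l j i x * cim l j.+1 i x)))); last first.
  by move=> j _; rewrite cre_app cim_app; ring.
rewrite big_split/= (le_trans (ler_normD _ _))// (le_trans (lerD h1 h2))//.
rewrite -mulrDr -big_split/= le_eqVlt; apply/orP; left; apply/eqP.
by congr (_ * _); apply: eq_bigr => j _; rewrite mulrDr.
Qed.

Lemma energy_term_ge0 l i (d : R) (x : nvect E) :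
  0 <= \sum_(j < n) (d^-1 ^+ 2) ^+ j * (cre l j i x ^+ 2 + cim l j i x ^+ 2).
Proof.
apply: sumr_ge0 => j _; rewrite mulr_ge0 ?addr_ge0 ?sqr_ge0//.
by rewrite exprn_ge0// sqr_ge0.
Qed.

Lemma energy_ge0 S d x : 0 <= energy S d x.
Proof. by apply: sumr_ge0 => l _; apply: sumr_ge0 => i _; exact: energy_term_ge0. Qed.

Lemma denergy_up (S : pred C) (d b : R) x : 0 < d ->
  (forall l : C, l \in sp -> S l -> complex.Re l + d <= b) ->
  denergy S d x <= 2 * b * energy S d x.
Proof.
move=> d0 H; rewrite /denergy /energy mulr_sumr big_seq_cond [leRHS]big_seq_cond.
apply: ler_sum => l /andP[ls Sl]; rewrite mulr_sumr; apply: ler_sum => i _.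
have := denergy_bound i x d0 ls; have := energy_term_ge0 l i d x.
have := H l ls Sl; rewrite ler_norml.
set p := \sum_(j < n) _; set q := \sum_(j < n) _.
by move=> ? ? /andP[]; nra.
Qed.

Lemma denergy_down (S : pred C) (d b : R) x : 0 < d ->
  (forall l : C, l \in sp -> S l -> b <= complex.Re l - d) ->
  2 * b * energy S d x <= denergy S d x.
Proof.
move=> d0 H; rewrite /denergy /energy mulr_sumr big_seq_cond [leRHS]big_seq_cond.
apply: ler_sum => l /andP[ls Sl]; rewrite mulr_sumr; apply: ler_sum => i _.
have := denergy_bound i x d0 ls; have := energy_term_ge0 l i d x.
have := H l ls Sl; rewrite ler_norml.
set p := \sum_(j < n) _; set q := \sum_(j < n) _.
by move=> ? ? /andP[]; nra.
Qed.

Lemma is_derive_bigsum (I : Type) (r : seq I) (P : pred I) (h : I -> R -> R)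
    (dh : I -> R) (t : R) : (forall i, is_derive t (1 : R) (h i) (dh i)) ->
  is_derive t (1 : R) (fun s => \sum_(i <- r | P i) h i s) (\sum_(i <- r | P i) dh i).
Proof.
move=> H; elim: r => [|i r IH].
  by under eq_fun do rewrite big_nil; rewrite big_nil; exact: is_derive_cst.
under eq_fun do rewrite big_cons; rewrite big_cons.
by case: (P i) => //; apply: is_deriveD.
Qed.

Lemma is_derive_sqr (h : R -> R) (dh t : R) : is_derive t (1 : R) h dh ->
  is_derive t (1 : R) (fun s => h s ^+ 2) (2 * (h t * dh)).
Proof.
move=> H; have := is_deriveX 2 H; move/is_derive_eqfun; apply => //.
by rewrite /GRing.scale/= expr1 mulrA.
Qed.

Lemma energy_derive S d (v : R -> nvect E) (t : R) :
  is_derive t (1 : R) v (L (v t)) ->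
  is_derive t (1 : R) (fun s => energy S d (v s)) (denergy S d (v t)).
Proof.
move=> vd; apply: is_derive_bigsum => l; apply: is_derive_bigsum => i.
apply: is_derive_bigsum => j.
have cd : is_derive t (1 : R) (fun s => cre l j i (v s)) (cre l j i (L (v t))).
  exact: (@is_derive_lin _ (nvect E) _ (cre l j i) v t _ (@lin_continuous R E _ (cre l j i)) vd).
have md : is_derive t (1 : R) (fun s => cim l j i (v s)) (cim l j i (L (v t))).
  exact: (@is_derive_lin _ (nvect E) _ (cim l j i) v t _ (@lin_continuous R E _ (cim l j i)) vd).
have := is_deriveZ ((d^-1 ^+ 2) ^+ j) (is_deriveD (is_derive_sqr cd) (is_derive_sqr md)).
by move/is_derive_eqfun; apply => //; rewrite mulrDr.
Qed.

Lemma energy_le S d : exists2 K : R, 0 < K & forall x, energy S d x <= K * `|x| ^+ 2.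
Proof.
pose qb (f : nvect E -> R) := exists2 K : R, 0 < K & forall x, f x <= K * `|x| ^+ 2.
have qsum (I : Type) (r : seq I) (P : pred I) (f : I -> nvect E -> R) :
    (forall i, qb (f i)) -> qb (fun x => \sum_(i <- r | P i) f i x).
  move=> H; elim: r => [|i r [K K0 IH]].
    by exists 1 => // x; rewrite big_nil mul1r sqr_ge0.
  have [K' K'0 Hi] := H i; exists (K' + K); first exact: addr_gt0.
  move=> x; rewrite big_cons mulrDl; case: (P i); first exact: lerD.
  by rewrite (le_trans (IH x))// lerDr mulr_ge0 ?sqr_ge0// ltW.
apply: (qsum) => l; apply: (qsum) => i; apply: (qsum) => j.
have [a a0 ab] := @lin_bounded R E _ (cre l j i).
have [b b0 bb] := @lin_bounded R E _ (cim l j i).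
have c0 : 0 <= (d^-1 ^+ 2) ^+ j :> R by rewrite exprn_ge0// sqr_ge0.
exists ((d^-1 ^+ 2) ^+ j * (a ^+ 2 + b ^+ 2) + 1).
  by rewrite ltr_wpDl// mulr_ge0// addr_ge0// sqr_ge0.
move=> x; rewrite mulrDl mul1r ler_wpDr ?sqr_ge0// -mulrA ler_wpM2l//.
rewrite mulrDl -!exprMn lerD//.
  by apply: (@sqr_le_norm R); exact: ab.
by apply: (@sqr_le_norm R); exact: bb.
Qed.

(** [energy S d] only sees the eigenvalues in [S]. On the spectral space of [S] the terms with
    [j = 0] add up to the coordinates of [x], so that there it controls the norm. *)
Lemma le_energy S d : exists2 K : R, 0 < K & forall x, x \in spectral_space L S ->
  `|x : nvect E| ^+ 2 <= K * energy S d x.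
Proof.
pose m : R := (size sp)%:R.
exists (m ^+ 2 + 1); first by rewrite ltr_wpDl// sqr_ge0.
move=> x /spectral_spaceP xS.
have e0 := energy_ge0 S d x.
suff H : `|x : nvect E| <= m * Num.sqrt (energy S d x).
  rewrite (@le_trans _ _ (m ^+ 2 * energy S d x))//; last by rewrite mulrDl mul1r lerDl.
  rewrite -[X in _ <= _ * X](sqr_sqrtr e0) -exprMn.
  by apply: sqr_le_norm; rewrite normr_id.
apply: norm_coord; first by rewrite mulr_ge0// ?sqrtr_ge0// ler0n.
move=> i.
have -> : coord_of i x = \sum_(l <- sp | S l) cre l 0 i x.
  have -> : coord_of i x = complex.Re (cvec x 0 i) by rewrite /cvec mxE.
  rewrite -[cvec x]mulmx1 -projector_sum mulmx_sumr.
  have ReD : {morph (@complex.Re R) : a b / a + b} by case=> ? ? [].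
  rewrite summxE (big_morph _ ReD (erefl _)) (bigID S)/= [X in _ + X]big_seq_cond.
  rewrite [X in _ + X]big1 ?addr0; last first.
    by move=> l /andP[ls Sl]; rewrite xS// mxE.
  by apply: eq_bigr => l _; rewrite /cre expr0 mulmx1.
rewrite (le_trans (ler_norm_sum _ _ _))// /m mulr_natl.
have -> : Num.sqrt (energy S d x) *+ size sp = \sum_(l <- sp) Num.sqrt (energy S d x).
  by rewrite big_const_seq count_predT iter_addr_0.
rewrite big_mkcond/= big_seq [leRHS]big_seq; apply: ler_sum => l ls.
case: ifP => Sl; last exact: sqrtr_ge0.
rewrite -sqrtr_sqr ler_sqrt//.
have n0 : (0 < n)%N by case: (n) i => // -[].
have t0 j : 0 <= (d^-1 ^+ 2) ^+ j * (cre l j i x ^+ 2 + cim l j i x ^+ 2).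
  by rewrite mulr_ge0 ?addr_ge0 ?sqr_ge0// exprn_ge0// sqr_ge0.
have h1 := @term_le_sum _ _ (index_enum 'I_n) predT
  (fun j : 'I_n => (d^-1 ^+ 2) ^+ j * (cre l j i x ^+ 2 + cim l j i x ^+ 2)) (Ordinal n0)
  (mem_index_enum _) isT (fun j => t0 j).
have h2 := @term_le_sum _ _ (index_enum 'I_n) predT
  (fun i : 'I_n => \sum_(j < n) (d^-1 ^+ 2) ^+ j * (cre l j i x ^+ 2 + cim l j i x ^+ 2)) i
  (mem_index_enum _) isT (fun i => energy_term_ge0 l i d x).
have h3 := @term_le_sum _ _ sp S
  (fun l => \sum_(i < n) \sum_(j < n) (d^-1 ^+ 2) ^+ j * (cre l j i x ^+ 2 + cim l j i x ^+ 2)) l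
  ls Sl (fun l => sumr_ge0 _ (fun i _ => energy_term_ge0 l i d x)).
apply: (le_trans _ h3); apply: (le_trans _ h2); apply: (le_trans _ h1).
by rewrite expr0 mul1r lerDl sqr_ge0.
Qed.

Lemma seq_gap (T : eqType) (s : seq T) (f : T -> R) (P : pred T) :
  (forall l, l \in s -> P l -> 0 < f l) ->
  exists2 d : R, 0 < d & forall l, l \in s -> P l -> d <= f l.
Proof.
elim: s => [|a s IH] H; first by exists 1.
have [|d d0 dl] := IH; first by move=> l ls; apply: H; rewrite in_cons ls orbT.
have [Pa|Pa] := boolP (P a); last first.
  by exists d => // l; rewrite in_cons => /predU1P[->|/dl//]; rewrite (negbTE Pa).
exists (Num.min d (f a)); first by rewrite lt_min d0 H ?in_cons ?eqxx.
move=> l; rewrite in_cons => /predU1P[->|ls] Pl; first by rewrite ge_min lexx orbT.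
by rewrite ge_min dl.
Qed.

(** Passes from exponential bounds on the energy to bounds on the norm. It matters that [K] does not
    depend on the exponent [c], which will contain the time. *)
Lemma growth_sqr (S : pred C) (d : R) : exists2 K : R, 0 < K &
  forall (c : R) (x y : nvect E), x \in spectral_space L S ->
  energy S d x <= expR (c * 2) * energy S d y -> `|x| <= K * expR c * `|y|.
Proof.
have [K1 K10 H1] := energy_le S d; have [K2 K20 H2] := le_energy S d.
exists (K1 * K2 + 1); first by rewrite ltr_wpDl// mulr_ge0// ltW.
move=> c x y xS xy.
have K0 : 0 <= K1 * K2 by rewrite mulr_ge0// ltW.
rewrite -(@ler_pXn2r _ 2)// ?nnegrE ?mulr_ge0 ?expR_ge0 ?addr_ge0//.
rewrite (le_trans (H2 x xS))// !exprMn.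
rewrite (@le_trans _ _ (K2 * (expR (c * 2) * (K1 * `|y| ^+ 2))))//.
  apply: ler_wpM2l; first exact: ltW.
  by rewrite (le_trans xy)// ler_wpM2l ?expR_ge0.
have -> : expR (c * 2) = expR c ^+ 2 by rewrite -expRM_natr.
rewrite (_ : K2 * _ = K1 * K2 * (expR c ^+ 2 * `|y| ^+ 2)); last by ring.
rewrite -[leRHS]mulrA ler_wpM2r ?mulr_ge0 ?sqr_ge0//; nra.
Qed.

(** The distance between [b] and the finitely many real parts is used as the parameter [d] of the
    energy. It absorbs the nilpotent part, so that the rate is [b] without polynomial factors. *)
Lemma growth_upper (S : pred C) (b : R) :
  (forall l : C, l \in sp -> S l -> complex.Re l < b) ->
  exists2 K : R, 0 < K & forall v : R -> nvect E,
    (forall t, is_derive t (1 : R) v (L (v t))) ->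
    (forall t, v t \in spectral_space L S) ->
    forall s t, s <= t -> `|v t| <= K * expR (b * (t - s)) * `|v s|.
Proof.
move=> H.
have [d d0 dl] := @seq_gap C sp (fun l => b - complex.Re l) S
  (fun l ls Sl => etrans (subr_gt0 _ _) (H l ls Sl)).
have [K K0 HK] := growth_sqr S d; exists K => // v vd vS s t st.
apply: HK; first exact: vS.
have G : forall r, denergy S d (v r) <= 2 * b * energy S d (v r).
  move=> r; apply: denergy_up => // l ls Sl.
  by have := dl l ls Sl; lra.
have := gronwall_up (fun r => energy_derive S d (vd r)) G st.
have -> : expR (b * (t - s) * 2) = expR (- (2 * b) * s) / expR (- (2 * b) * t) by rewrite -expRN -expRD; congr expR; ring.
by move=> H'; rewrite mulrAC ler_pdivlMr ?expR_gt0// [leRHS]mulrC.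
Qed.

Lemma growth_lower (S : pred C) (b : R) :
  (forall l : C, l \in sp -> S l -> b < complex.Re l) ->
  exists2 K : R, 0 < K & forall v : R -> nvect E,
    (forall t, is_derive t (1 : R) v (L (v t))) ->
    (forall t, v t \in spectral_space L S) ->
    forall s t, s <= t -> `|v s| <= K * expR (- (b * (t - s))) * `|v t|.
Proof.
move=> H.
have [d d0 dl] := @seq_gap C sp (fun l => complex.Re l - b) S
  (fun l ls Sl => etrans (subr_gt0 _ _) (H l ls Sl)).
have [K K0 HK] := growth_sqr S d; exists K => // v vd vS s t st.
apply: HK; first exact: vS.
have G : forall r, 2 * b * energy S d (v r) <= denergy S d (v r).
  move=> r; apply: denergy_down => // l ls Sl.
  by have := dl l ls Sl; lra.
have := gronwall_down (fun r => energy_derive S d (vd r)) G st.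
have -> : expR (- (b * (t - s)) * 2) = expR (- (2 * b) * t) / expR (- (2 * b) * s) by rewrite -expRN -expRD; congr expR; ring.
by move=> H'; rewrite mulrAC ler_pdivlMr ?expR_gt0// [leRHS]mulrC.
Qed.

End SpectralSpaces.

Section Intertwining.
Variables (R : realType) (E E' : vectType R) (L : 'End(E)) (L' : 'End(E')).
Variable T : 'Hom(E, E').
Hypothesis TL : forall x, T (L x) = L' (T x).

(** [T] carries generalized eigenvectors for [l] to generalized eigenvectors for the same [l], so
    the products of projectors for different eigenvalues vanish. It is applied with [L] itself, with
    the action of a cell and with the inclusion of a synchrony space in the role of [T]. *)
Lemma daddv_intertwine (S S' : pred R[i]) x : conj_closed S ->
  (forall l, S' l = ~~ S l) ->
  T (daddv_pi (spectral_space L S) (spectral_space L S') x) =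
  daddv_pi (spectral_space L' S) (spectral_space L' S') (T x).
Proof.
move=> Scl SS'.
pose M : 'M[R[i]]_(_, _) := map_mx (real_complex R) (mxof (vbasis {: E}) (vbasis {: E'}) T).
have cT y : cvec (T y) = cvec y *m M.
  rewrite /cvec /M -map_mxM/=; congr map_mx; apply: rVof_app; exact: vbasisP.
have AM : complexified L *m M = M *m complexified L'.
  rewrite /M /complexified -!map_mxM -!mxof_comp ?vbasisP//; congr (map_mx _ (mxof _ _ _)).
  by apply/lfunP => y; rewrite !comp_lfunE TL.
have AMl l k : M *m (complexified L' - l%:M) ^+ k = (complexified L - l%:M) ^+ k *m M.
  elim: k => [|k IH]; first by rewrite !expr0 mulmx1 mul1mx.
  rewrite exprS -[_ * _ ^+ k]/(_ *m _) mulmxA mulmxBr -AM scalar_mxC -mulmxBl -mulmxA IH.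
  by rewrite mulmxA exprS.
apply: cvec_inj; rewrite cT !cvec_daddv// cT mulmx_suml.
set y := LHS.
have wk (l l' : R[i]) : l \in spectrum L -> l' \in spectrum L' -> l' != l ->
    cvec x *m projector L l *m M *m projector L' l' = 0.
  move=> ls ls' ll'; apply: (@killed_projector _ _ _ _ _ l (\dim {: E})) => //.
  by rewrite -mulmxA AMl mulmxA -(mulmxA (cvec x)) projector_ker// mulmx0 mul0mx.
rewrite -[y]mulmx1 -(projector_sum L') mulmx_sumr (bigID S)/= [X in _ + X]big_seq_cond.
rewrite [X in _ + X]big1 ?addr0; last first.
  move=> l' /andP[ls' Sl']; rewrite /y mulmx_suml big_seq_cond big1// => l /andP[ls Sl].
  by apply: wk => //; apply: contraNneq Sl' => ->.
rewrite big_seq_cond [RHS]big_seq_cond; apply: eq_bigr => l' /andP[ls' Sl'].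
have -> : cvec x *m M = \sum_(l <- spectrum L) cvec x *m projector L l *m M.
  by rewrite -mulmx_suml -mulmx_sumr projector_sum mulmx1.
rewrite (bigID S)/= mulmxDl -/y [X in _ = _ + X]mulmx_suml [X in _ = _ + X]big_seq_cond.
rewrite [X in _ = _ + X]big1 ?addr0// => l /andP[ls Sl].
by apply: wk => //; apply: contraNneq Sl => <-.
Qed.

End Intertwining.

(** * The linear equation in weighted spaces *)

Section RealEstimates.
Variable R : realType.
Implicit Types (t m c : R).

Lemma expR_small (a b e : R) : 0 < b -> 0 < e ->
  exists2 r0 : R, 0 <= r0 & forall r, r0 <= r -> a * expR (- (b * r)) <= e.
Proof.
move=> b0 e0; have [a0|a0] := leP a 0.
  by exists 0 => // r _; rewrite (le_trans _ (ltW e0))// mulr_le0_ge0// expR_ge0.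
exists (a / e / b); first by rewrite !divr_ge0// ltW.
move=> r r0; rewrite expRN ler_pdivrMr ?expR_gt0// mulrC.
have H : a / e <= b * r by rewrite [leRHS]mulrC -ler_pdivrMr.
rewrite -ler_pdivrMr//; apply: (le_trans H); apply: le_trans (expR_ge1Dx _).
by rewrite lerDr.
Qed.

Variable E : vectType R.

(** Stands for the integral from [t] to infinity in the variation of constants formula. On a finite
    interval up to a time where [phi] is small, [phi] is compared with a primitive [h] of the
    majorant given by [weight_shift]. *)
Lemma forward_estimate (phi dphi : R -> nvect E) (t a c m : R) : 0 <= m -> m < a ->
  (forall s, is_derive s (1 : R) phi (dphi s)) ->
  (forall s, t <= s -> `|dphi s| <= c * expR (- (a * (s - t))) * weight m s) ->
  (forall e : R, 0 < e -> exists2 s, t <= s & `|phi s| <= e) ->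
  `|phi t| <= c / (a - m) * weight m t.
Proof.
move=> m0 ma pd dc small; apply/ler_addgt0Pl => e /small[s ts se].
have am : 0 < a - m by rewrite subr_gt0.
have c0 : 0 <= c.
  have := dc t (lexx _); rewrite subrr mulr0 oppr0 expR0 mulr1.
  by move=> H; rewrite -(pmulr_lge0 _ (weight_gt0 m t)); exact: le_trans H.
pose A := c / (a - m) * weight m t.
have A0 : 0 <= A by rewrite mulr_ge0 ?weight_ge0// divr_ge0// ltW.
pose h r := - (A * expR (a * t - m * t)) * expR (- (a - m) * r).
have hd r : is_derive r (1 : R) h (c * weight m t * expR (- (a - m) * (r - t))).
  have := is_deriveZ (- (A * expR (a * t - m * t))) (is_derive_expRM (- (a - m)) r).
  move/is_derive_eqfun; apply => //.
  have -> : expR (- (a - m) * (r - t)) = expR (a * t - m * t) * expR (- (a - m) * r).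
    by rewrite -expRD; congr expR; ring.
  by rewrite /GRing.scale/= /A; field; rewrite gt_eqF.
have := mean_value_ineq ts (fun r _ => pd r) (fun r _ => hd r) _.
have ht : h t = - A.
  by rewrite /h mulNr -mulrA -expRD (_ : _ + _ = 0) ?expR0 ?mulr1//; ring.
have hs : h s <= 0 by rewrite /h mulNr oppr_le0 mulr_ge0 ?expR_ge0// mulr_ge0// expR_ge0.
rewrite ht => H; rewrite -[phi t](subrK (phi s)) (le_trans (ler_normD _ _))// addrC lerD//.
rewrite distrC; apply: (le_trans (H _)); last by rewrite opprK gerDr.
move=> r /andP[tr _]; apply: (le_trans (dc r tr)); rewrite -!mulrA ler_wpM2l//.
rewrite mulrC (le_trans (ler_wpM2r (expR_ge0 _) (weight_shift r t m0)))//.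
rewrite -mulrA ler_wpM2l ?weight_ge0// /weight ger0_norm ?subr_ge0// -expRD ler_expR.
by rewrite le_eqVlt; apply/orP; left; apply/eqP; ring.
Qed.

(** The counterpart on the finite interval from 0 to [t]: the forcing grows at a rate [m] above the
    rate [e] of the center flow, so the constant [c / (m - e)] is uniform in [t]. *)
Lemma central_estimate (phi dphi : R -> nvect E) (t e c m : R) : 0 <= t -> 0 <= e -> e < m ->
  (forall s, is_derive s (1 : R) phi (dphi s)) ->
  (forall s, 0 <= s <= t -> `|dphi s| <= c * expR (e * (t - s)) * weight m s) ->
  `|phi t| <= `|phi 0| + c / (m - e) * weight m t.
Proof.
move=> t0 e0 em pd dc.
have me : 0 < m - e by rewrite subr_gt0.
have c0 : 0 <= c.
  have := dc t; rewrite t0 lexx => /(_ isT); rewrite subrr mulr0 expR0 mulr1.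
  by move=> H; rewrite -(pmulr_lge0 _ (weight_gt0 m t)); exact: le_trans H.
pose A := c / (m - e).
have A0 : 0 <= A by rewrite divr_ge0// ltW.
pose h r := A * expR (e * t) * expR ((m - e) * r).
have hd r : is_derive r (1 : R) h (c * expR (e * t) * expR ((m - e) * r)).
  have := is_deriveZ (A * expR (e * t)) (is_derive_expRM (m - e) r).
  move/is_derive_eqfun; apply => //.
  by rewrite /GRing.scale/= /A; field; rewrite gt_eqF.
have := mean_value_ineq t0 (fun r _ => pd r) (fun r _ => hd r) _.
have ht : h t = A * weight m t.
  by rewrite /h -mulrA -expRD /weight ger0_norm//; congr (_ * expR _); ring.
have h0 : 0 <= h 0 by rewrite /h mulr_ge0 ?expR_ge0// mulr_ge0// expR_ge0.
rewrite ht => H; rewrite -[phi t](subrK (phi 0)) (le_trans (ler_normD _ _))// addrC lerD//.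
apply: (le_trans (H _)); last by rewrite gerBl.
move=> r /andP[r0 rt]; apply: (le_trans (dc r _)); first by rewrite r0.
rewrite -!mulrA ler_wpM2l// /weight ger0_norm// -!expRD ler_expR.
by rewrite le_eqVlt; apply/orP; left; apply/eqP; ring.
Qed.

Lemma is_derive_affine (y : R -> nvect E) (v : nvect E) (a b t : R) :
  is_derive (a + b * t) (1 : R) y v ->
  is_derive t (1 : R) (fun s => y (a + b * s)) (b *: v).
Proof.
move=> yv; apply: is_derive_coordP => i.
have d1 : is_derive t (1 : R) (fun s : R => a + b * s) b.
  have := is_deriveD (is_derive_cst a t (1 : R)) (is_deriveZ b (is_derive_id t (1 : R))).
  move/is_derive_eqfun; apply => //.
  by rewrite add0r /GRing.scale/= mulr1.
have := @is_derive1_comp R (fun u => coord_of i (y u)) (fun s : R => a + b * s) t _ _ (is_derive_coord i yv) d1; move/is_derive_eqfun; apply => //.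
by rewrite linearZ/= mulrC.
Qed.

Lemma sum_curve_continuous (I : Type) (r : seq I) (f : I -> R -> nvect E) :
  (forall i, continuous (f i)) -> continuous (fun s => \sum_(i <- r) f i s).
Proof.
move=> fc s; elim: r => [|i r IH].
  by under eq_fun do rewrite big_nil; exact: cvg_cst.
under eq_fun do rewrite big_cons.
by apply: continuousD; [exact: fc|exact: IH].
Qed.

End RealEstimates.

(** * Dichotomy estimates for an abstract linear flow and a projection that decays in backward
    time *)

Section AbstractDichotomy.
Variables (R : realType) (E : vectType R).
Variables (G : {linear nvect E -> nvect E}) (S : R -> {linear nvect E -> nvect E}).
Variable (p : {linear nvect E -> nvect E}).
Hypothesis S0 : forall x, S 0 x = x.
Hypothesis SD : forall s t x, S (s + t) x = S s (S t x).
Hypothesis Sd : forall x t, is_derive t (1 : R) (fun t => S t x) (G (S t x)).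
Hypothesis SG : forall t x, S t (G x) = G (S t x).
Hypothesis Sp : forall t x, S t (p x) = p (S t x).
Hypothesis pG : forall x, p (G x) = G (p x).

Lemma flow_coordE t x : S t x = \sum_i coord_of i x *: S t (base i).
Proof. by rewrite {1}(coord_baseE x) linear_sum; apply: eq_bigr => i _; rewrite linearZ. Qed.

(** A product rule. Only [S t x] with fixed [x] is known to be differentiable in [t], so the curve
    is expanded over a basis first. *)
Lemma is_derive_flow_affine (y : R -> nvect E) (v : nvect E) (a b s : R) :
  is_derive s (1 : R) y v ->
  is_derive s (1 : R) (fun s => S (a + b * s) (y s)) (S (a + b * s) (v + b *: G (y s))).
Proof.
move=> yv.
have yE : (\sum_i (fun s => coord_of i (y s) *: S (a + b * s) (base i))) =
    (fun s => S (a + b * s) (y s)).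
  by apply/funext => r; rewrite fct_sumE -flow_coordE.
have := @is_derive_sum R R (nvect E) _ (fun i s => coord_of i (y s) *: S (a + b * s) (base i)) s 1
  (fun i => coord_of i v *: S (a + b * s) (base i) +
    coord_of i (y s) *: (b *: G (S (a + b * s) (base i)))).
rewrite yE big_split/= -flow_coordE => H.
rewrite linearD linearZ/= SG [S _ (y s)]flow_coordE linear_sum scaler_sumr.
under [X in _ + X]eq_bigr do rewrite linearZ/= scalerA mulrC -scalerA.
apply: H => i; apply: is_deriveZ_curve; first exact: is_derive_coord.
by apply: is_derive_affine; exact: Sd.
Qed.

Lemma flow_continuous (y : R -> nvect E) (b : R) : continuous y ->
  continuous (fun s => S (b * s) (y s)).
Proof.
move=> yc s.
under eq_fun do rewrite flow_coordE.
apply: sum_curve_continuous => i r; apply: cvgZ.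
  by apply: (@continuous_comp _ _ _ y (coord_of i)); [exact: yc|exact: coord_of_continuous].
have := @is_derive_affine _ _ (fun t => S t (base i)) _ 0 b r (Sd _ _).
by under eq_fun do rewrite add0r; exact: is_derive_continuous.
Qed.

Variables (a K : R).
Hypothesis a0 : 0 < a.
Hypothesis K0 : 0 <= K.
Hypothesis decay : forall r x, 0 <= r -> `|S (- r) (p x)| <= K * expR (- (a * r)) * `|x|.

(* The curve s |-> S (t - s) (p (v s)) has derivative S (t - s) (p (g s)) and tends
   to 0 at +oo, because v grows more slowly than S decays. *)
Lemma dichotomy_estimate (g v : R -> nvect E) (m1 m c C : R) : m1 < a -> 0 <= m -> m <= m1 ->
  (forall t, is_derive t (1 : R) v (G (v t) + g t)) ->
  (forall t, `|g t| <= c * weight m t) -> (forall t, `|v t| <= C * weight m1 t) ->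
  forall t, `|p (v t)| <= K * c / (a - m) * weight m t.
Proof.
move=> m1a m0 mm1 vd gc vC t.
have pd s : is_derive s (1 : R) (fun s => p (v s)) (p (G (v s) + g s)).
  exact: is_derive_lin (@lin_continuous _ _ _ p) (vd s).
pose phi s := S (t + -1 * s) (p (v s)).
have phid s : is_derive s (1 : R) phi (S (t + -1 * s) (p (g s))).
  have := is_derive_flow_affine t (-1) (pd s); move/is_derive_eqfun; apply => //.
  by congr (S _ _); rewrite linearD/= pG scaleN1r addrC addKr.
have tsE s : t + -1 * s = - (s - t) by rewrite mulN1r opprB.
have := @forward_estimate _ _ phi _ t a (K * c) m m0 (le_lt_trans mm1 m1a) phid.
rewrite /phi tsE subrr oppr0 S0; apply.
- move=> s ts; rewrite tsE (le_trans (decay _ _))// ?subr_ge0//.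
  rewrite -!mulrA ler_wpM2l// mulrCA ler_wpM2l ?expR_ge0//.
- move=> e e0.
  have C0 : 0 <= C by have := vC 0; rewrite weight0 mulr1; exact: le_trans.
  have am : 0 < a - m1 by rewrite subr_gt0.
  have [r r0 H] := expR_small (K * C * weight m1 t) am e0.
  exists (t + r); first by rewrite lerDl.
  rewrite tsE addrAC subrr add0r (le_trans (decay _ _))//.
  apply: le_trans (H r (lexx _)).
  have h2 := vC (t + r); have h1 := weight_shift (t + r) t (le_trans m0 mm1).
  have wE : weight m1 r = expR (m1 * r) by rewrite /weight ger0_norm.
  have trt : t + r - t = r by rewrite addrAC subrr add0r.
  rewrite trt wE in h1.
  have -> : expR (- ((a - m1) * r)) = expR (- (a * r)) * expR (m1 * r).
    by rewrite -expRD; congr expR; ring.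
  have h3 : `|v (t + r)| <= C * (weight m1 t * expR (m1 * r)).
    by rewrite (le_trans h2)// ler_wpM2l.
  rewrite (_ : K * C * _ * _ = K * expR (- (a * r)) * (C * (weight m1 t * expR (m1 * r)))).
    by rewrite ler_wpM2l// mulr_ge0// expR_ge0.
  ring.
Qed.

(** As [P] is a primitive of S_(-s) g(s), each [S t (P t + x)] solves the forced equation. The right
    [x] is minus the limit of [p (P s)] as s -> +oo, which turns [P t + x] on the range of [p] into
    minus the integral from [t] to infinity. *)
Lemma dichotomy_existence (g P : R -> nvect E) (m c : R) : 0 <= m -> m < a ->
  (forall x, p (p x) = p x) ->
  (forall t, is_derive t (1 : R) P (S (- t) (g t))) ->
  (forall t, `|g t| <= c * weight m t) ->
  exists x, p x = x /\
    forall t, `|p (S t (P t + x))| <= K * c / (a - m) * weight m t.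
Proof.
move=> m0 ma pp Pd gc.
have am : 0 < a - m by rewrite subr_gt0.
have c0 : 0 <= c by have := gc 0; rewrite weight0 mulr1; exact: le_trans.
have pPd s : is_derive s (1 : R) (fun s => p (P s)) (S (- s) (p (g s))).
  rewrite Sp; exact: is_derive_lin (@lin_continuous _ _ _ p) (Pd s).
pose A := K * c / (a - m).
have A0 : 0 <= A by rewrite divr_ge0 ?mulr_ge0// ltW.
pose h r := - A * expR (- (a - m) * r).
have hd r : is_derive r (1 : R) h (K * c * expR (- (a - m) * r)).
  have := is_deriveZ (- A) (is_derive_expRM (- (a - m)) r).
  move/is_derive_eqfun; apply => //.
  by rewrite /GRing.scale/= /A; field; rewrite gt_eqF.
have dP s t : 0 <= s -> s <= t -> `|p (P t) - p (P s)| <= A * expR (- (a - m) * s).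
  move=> s0 st; have := mean_value_ineq st (fun r _ => pPd r) (fun r _ => hd r) _.
  rewrite /h !mulNr opprK => H; apply: (le_trans (H _)).
    move=> r /andP[sr _]; have r0 : 0 <= r := le_trans s0 sr.
    rewrite (le_trans (decay _ r0))// -!mulrA ler_wpM2l//.
    rewrite (le_trans (ler_wpM2l (expR_ge0 _) (gc r)))// mulrCA ler_wpM2l//.
    rewrite /weight ger0_norm// -expRD ler_expR.
    by rewrite le_eqVlt; apply/orP; left; apply/eqP; ring.
  by rewrite gerDr oppr_le0 mulr_ge0// expR_ge0.
(* The Cauchy estimate [dP] holds at nonnegative times. Writing them as absolute values lets the
   balls be indexed by all of [R]. *)
have [l lP] : exists l : nvect E, forall t : R, `|p (P `|t|) - l| <= A * expR (- (a - m) * `|t|).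
  apply: (@ball_helly R E R 0 (fun t => p (P `|t|)) (fun t => A * expR (- (a - m) * `|t|))) => s t.
  wlog st : s t / `|s| <= `|t|.
    by move=> H; case: (leP `|s| `|t|) => [/H//|/ltW/H]; rewrite distrC [leRHS]addrC.
  rewrite distrC (le_trans (dP _ _ _ st))// lerDl mulr_ge0// expR_ge0//.
have [b b0 pb] := lin_bounded p.
exists (- p l); split; first by rewrite linearN/= pp.
move=> t.
pose phi s := S t (p (P s) - p l).
have phid s : is_derive s (1 : R) phi (S (- (s - t)) (p (g s))).
  have := is_derive_lin (@lin_continuous _ _ _ (S t)) (is_deriveB (pPd s) (is_derive_cst (p l) s (1 : R))).
  move/is_derive_eqfun; apply => //.
  by rewrite subr0 -SD opprB.
have := @forward_estimate _ _ phi _ t a (K * c) m m0 ma phid.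
rewrite -Sp linearD linearN/= pp; apply.
- move=> s ts; rewrite (le_trans (decay _ _))// ?subr_ge0//.
  by rewrite -!mulrA ler_wpM2l// mulrCA ler_wpM2l ?expR_ge0.
- move=> e e0; have [d d0 Sb] := lin_bounded (S t).
  have [r r0 H] := expR_small (d * b * A) am e0.
  exists (Num.max t r); first by rewrite le_max lexx.
  have rm : r <= Num.max t r by rewrite le_max lexx orbT.
  rewrite /phi (le_trans (Sb _))// -[p (P _)]pp -linearB/=.
  apply: (le_trans _ (H (Num.max t r) rm)).
  rewrite -!mulrA; apply: ler_wpM2l; first exact: ltW.
  rewrite (le_trans (pb _))//; apply: ler_wpM2l; first exact: ltW.
  have := lP (Num.max t r); rewrite ger0_norm ?(le_trans r0)//.
  by rewrite mulNr /A -!mulrA.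
Qed.

End AbstractDichotomy.

(** * The flow of a linear map and the growth of its spectral parts *)

Section LinearFlow.
Variables (R : realType).

(** The same map between the normed copies of the spaces, where continuity and differentiability
    make sense. *)
Definition nlin (E E' : vectType R) (f : 'Hom(E, E')) : {linear nvect E -> nvect E'} :=
  (f : {linear E -> E'}).

Lemma nlinE (E E' : vectType R) (f : 'Hom(E, E')) x : nlin f x = f x.
Proof. by []. Qed.

Lemma lin_lipschitz (E E' : vectType R) (f : {linear nvect E -> nvect E'}) :
  exists2 l : R, 0 <= l & forall x y, `|f x - f y| <= l * `|x - y|.
Proof.
have [c c0 fc] := lin_bounded f; exists c; first exact: ltW.
by move=> x y; rewrite -linearB.
Qed.

Variables (E : vectType R) (L : 'End(E)).

Lemma linear_flow (x : nvect E) : exists2 y : R -> nvect E, y 0 = x &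
  forall t, is_derive t (1 : R) y (nlin L (y t)).
Proof. by have [l l0 Ll] := lin_lipschitz (nlin L); exact: lipschitz_ode l0 Ll. Qed.

Definition lflow (t : R) (x : nvect E) : nvect E := sval (cid2 (linear_flow x)) t.

Lemma lflow0 x : lflow 0 x = x.
Proof. by rewrite /lflow; case: cid2. Qed.

Lemma lflow_derive x t : is_derive t (1 : R) (lflow^~ x) (nlin L (lflow t x)).
Proof. by rewrite /lflow; case: cid2. Qed.

Lemma lflow_unique (y : R -> nvect E) :
  (forall t, is_derive t (1 : R) y (nlin L (y t))) -> forall t, y t = lflow t (y 0).
Proof.
move=> yd t; have [l l0 Ll] := lin_lipschitz (nlin L).
have := @ode_unique _ _ (nlin L) l y (lflow^~ (y 0)) l0 Ll yd (lflow_derive _).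
by rewrite lflow0 => /(_ erefl) {1}->.
Qed.

Lemma lflow_linear t : linear (lflow t).
Proof.
move=> a x y; apply/esym.
have := @lflow_unique (fun t => a *: lflow t x + lflow t y); rewrite !lflow0; apply.
move=> s; rewrite linearP; apply: is_deriveD; last exact: lflow_derive.
by apply: is_deriveZ; exact: lflow_derive.
Qed.

HB.instance Definition _ t := GRing.isLinear.Build R (nvect E) (nvect E) _ (lflow t)
  (lflow_linear t).

Lemma lflowD s t x : lflow (s + t) x = lflow s (lflow t x).
Proof.
have D r : is_derive r (1 : R) (fun s => lflow (t + 1 * s) x) (nlin L (lflow (t + 1 * r) x)).
  have := @is_derive_affine _ _ (lflow^~ x) _ t 1 r (lflow_derive _ _).
  by rewrite scale1r.
by have := lflow_unique D s; rewrite mulr0 addr0 mul1r addrC.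
Qed.

Lemma lflow_comm (T : 'End(E)) : (forall x, T (L x) = L (T x)) ->
  forall t x, lflow t (nlin T x) = nlin T (lflow t x).
Proof.
move=> TL t x; apply/esym.
have := @lflow_unique (fun t => nlin T (lflow t x)); rewrite lflow0; apply => s.
have := is_derive_lin (@lin_continuous _ _ _ (nlin T)) (lflow_derive x s).
by move/is_derive_eqfun; apply => //; exact: TL.
Qed.

Local Notation C := R[i].
Definition sppi (S : pred C) : 'End(E) :=
  daddv_pi (spectral_space L S) (spectral_space L (fun l => ~~ S l)).

Definition center_pred : pred C := fun l => complex.Re l == 0.
Definition unstable_pred : pred C := fun l => 0 < complex.Re l.
Definition stable_pred : pred C := fun l => complex.Re l < 0.

Lemma center_closed : conj_closed center_pred. Proof. by case. Qed.
Lemma unstable_closed : conj_closed unstable_pred. Proof. by case. Qed.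
Lemma stable_closed : conj_closed stable_pred. Proof. by case. Qed.

Lemma sppi_mem S x : sppi S x \in spectral_space L S.
Proof. exact: memv_pi. Qed.

Lemma sppi_comm S x : conj_closed S -> sppi S (L x) = L (sppi S x).
Proof. by move=> Sc; apply/esym/daddv_intertwine. Qed.

Lemma sppi_sub (S T : pred C) x : conj_closed T -> (forall l, S l -> T l) ->
  x \in spectral_space L S -> sppi T x = x.
Proof.
move=> Tc ST /spectral_spaceP xS; apply: (@cvec_inj _ E); rewrite cvec_daddv//.
rewrite -[RHS]mulmx1 -(projector_sum L) mulmx_sumr [RHS](bigID T)/=.
rewrite [X in _ = _ + X]big_seq_cond [X in _ = _ + X]big1 ?addr0// => l /andP[ls Tl].
by apply: xS => //; apply: contra Tl => /ST.
Qed.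

Lemma sppi_disj (S T : pred C) x : conj_closed T -> (forall l, T l -> ~~ S l) ->
  x \in spectral_space L S -> sppi T x = 0.
Proof.
move=> Tc ST /spectral_spaceP xS; apply: (@cvec_inj _ E); rewrite cvec_daddv//.
by rewrite cvec0 big_seq_cond big1// => l /andP[ls /ST Sl]; exact: xS.
Qed.

Lemma cvec_sppi (S : pred C) x : conj_closed S ->
  cvec (sppi S x) = \sum_(l <- spectrum L | S l) cvec x *m projector L l.
Proof. by move=> Sc; exact: (@cvec_daddv _ _ L S (fun l => ~~ S l) x Sc (fun=> erefl)). Qed.

Lemma cvec_pi_h x :
  cvec (pi_h L x) = \sum_(l <- spectrum L | ~~ center_pred l) cvec x *m projector L l.
Proof.
apply: (@cvec_daddv _ _ L (fun l => complex.Re l != 0) (fun l => complex.Re l == 0) x).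
  by case.
by move=> l; rewrite negbK.
Qed.

Lemma pi_hE x : pi_h L x = sppi unstable_pred x + sppi stable_pred x.
Proof.
have H (a b c : E) :
    cvec a = \sum_(l <- spectrum L | ~~ center_pred l) cvec x *m projector L l ->
    cvec b = \sum_(l <- spectrum L | unstable_pred l) cvec x *m projector L l ->
    cvec c = \sum_(l <- spectrum L | stable_pred l) cvec x *m projector L l -> a = b + c.
  move=> ha hb hc; apply: (@cvec_inj _ E); rewrite cvecD ha hb hc.
  rewrite (bigID unstable_pred)/=; congr (_ + _); apply: eq_bigl => l.
    rewrite /unstable_pred /center_pred; case: (ltP 0 (complex.Re l)) => h; rewrite ?andbF// andbT.
    by rewrite gt_eqF.
  rewrite /unstable_pred /stable_pred /center_pred.
  by case: (ltrgt0P (complex.Re l)).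
exact: H (cvec_pi_h x) (cvec_sppi x unstable_closed) (cvec_sppi x stable_closed).
Qed.

Lemma pi_ch x : x = pi_c L x + pi_h L x.
Proof.
have H (a b : E) :
    cvec a = \sum_(l <- spectrum L | center_pred l) cvec x *m projector L l ->
    cvec b = \sum_(l <- spectrum L | ~~ center_pred l) cvec x *m projector L l -> x = a + b.
  move=> ha hb; apply: (@cvec_inj _ E); rewrite cvecD ha hb.
  by rewrite -[LHS]mulmx1 -(projector_sum L) mulmx_sumr (bigID center_pred).
exact: H (cvec_sppi x center_closed) (cvec_pi_h x).
Qed.

Lemma sppi_idem S x : conj_closed S -> sppi S (sppi S x) = sppi S x.
Proof. by move=> Sc; apply: (@sppi_sub S) => //; exact: sppi_mem. Qed.

Lemma sppi_orth (S T : pred C) x : conj_closed T -> (forall l, T l -> ~~ S l) ->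
  sppi S x = x -> sppi T x = 0.
Proof.
move=> Tc TS xS; apply: (@sppi_disj S T x Tc TS).
by have := sppi_mem S x; rewrite xS.
Qed.

Lemma center_unstable l : center_pred l -> ~~ unstable_pred l.
Proof. by rewrite /center_pred /unstable_pred => /eqP ->; rewrite ltxx. Qed.
Lemma center_stable l : center_pred l -> ~~ stable_pred l.
Proof. by rewrite /center_pred /stable_pred => /eqP ->; rewrite ltxx. Qed.
Lemma unstable_stable l : unstable_pred l -> ~~ stable_pred l.
Proof. by rewrite /unstable_pred /stable_pred -leNgt => /ltW. Qed.

(** The real parts are 0, so [growth_upper] with rate [e] covers positive times and [growth_lower]
    with rate [- e] negative ones. *)
Lemma sppi_decay_center (e : R) : 0 < e -> exists2 K : R, 0 < K &
  forall r x, `|lflow r (nlin (pi_c L) x)| <= K * expR (e * `|r|) * `|x|.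
Proof.
move=> e0.
have [K1 K10 H1] := @growth_upper _ _ L center_pred e (fun l _ h => eq_ind_r (fun z => z < e) e0 (eqP h)).
have eN : - e < 0 by rewrite oppr_lt0.
have [K2 K20 H2] := @growth_lower _ _ L center_pred (- e) (fun l _ h => eq_ind_r (fun z => - e < z) eN (eqP h)).
have [b b0 pb] := lin_bounded (nlin (pi_c L)).
exists ((K1 + K2) * b); first by rewrite mulr_gt0// addr_gt0.
move=> r x; pose v t := lflow t (nlin (pi_c L) x).
have vS t : v t \in spectral_space L center_pred.
  rewrite /v lflow_comm; last by move=> y; exact: sppi_comm center_closed.
  exact: sppi_mem.
have vd t : is_derive t (1 : R) v (L (v t)) by exact: lflow_derive.
have v0 : `|v 0| <= b * `|x| by rewrite /v lflow0.
suff H : `|v r| <= (K1 + K2) * expR (e * `|r|) * `|v 0|.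
  apply: (le_trans H); rewrite -!mulrA ler_wpM2l//; first by rewrite addr_ge0// ltW.
  by rewrite mulrCA ler_wpM2l ?expR_ge0.
have [r0|/ltW r0] := leP 0 r.
  have := H1 v vd vS 0 r r0; rewrite subr0 ger0_norm// => /le_trans; apply.
  by rewrite -!mulrA ler_wpM2r ?mulr_ge0 ?expR_ge0// lerDl ltW.
have := H2 v vd vS r 0 r0; rewrite sub0r ler0_norm// mulNr opprK => /le_trans; apply.
by rewrite -!mulrA ler_wpM2r ?mulr_ge0 ?expR_ge0// lerDr ltW.
Qed.

Lemma sppi_decay_unstable (a : R) :
  (forall l : C, l \in spectrum L -> unstable_pred l -> a < complex.Re l) ->
  exists2 K : R, 0 < K & forall r x, 0 <= r ->
    `|lflow (- r) (nlin (sppi unstable_pred) x)| <= K * expR (- (a * r)) * `|x|.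
Proof.
move=> H; have [K K0 HK] := growth_lower H.
have [b b0 pb] := lin_bounded (nlin (sppi unstable_pred)).
exists (K * b); first by rewrite mulr_gt0.
move=> r x r0; pose v t := lflow t (nlin (sppi unstable_pred) x).
have vS t : v t \in spectral_space L unstable_pred.
  rewrite /v lflow_comm; last by move=> y; exact: sppi_comm unstable_closed.
  exact: sppi_mem.
have vd t : is_derive t (1 : R) v (L (v t)) by exact: lflow_derive.
have := HK v vd vS (- r) 0; rewrite oppr_le0 sub0r opprK => /(_ r0)/le_trans; apply.
rewrite -!mulrA ler_wpM2l ?(ltW K0)// mulrCA ler_wpM2l ?expR_ge0//.
by rewrite /v lflow0.
Qed.

Lemma sppi_decay_stable (a : R) :
  (forall l : C, l \in spectrum L -> stable_pred l -> complex.Re l < - a) ->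
  exists2 K : R, 0 < K & forall r x, 0 <= r ->
    `|lflow r (nlin (sppi stable_pred) x)| <= K * expR (- (a * r)) * `|x|.
Proof.
move=> H; have [K K0 HK] := growth_upper H.
have [b b0 pb] := lin_bounded (nlin (sppi stable_pred)).
exists (K * b); first by rewrite mulr_gt0.
move=> r x r0; pose v t := lflow t (nlin (sppi stable_pred) x).
have vS t : v t \in spectral_space L stable_pred.
  rewrite /v lflow_comm; last by move=> y; exact: sppi_comm stable_closed.
  exact: sppi_mem.
have vd t : is_derive t (1 : R) v (L (v t)) by exact: lflow_derive.
have := HK v vd vS 0 r r0; rewrite subr0 mulNr => /le_trans; apply.
rewrite -!mulrA ler_wpM2l ?(ltW K0)// mulrCA ler_wpM2l ?expR_ge0//.
by rewrite /v lflow0.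
Qed.

End LinearFlow.

(** * Slowly growing solutions of the forced linear equation *)

Section LinearEstimates.
Variables (R : realType) (E : vectType R) (L : 'End(E)).
Local Notation pc := (nlin (pi_c L)).
Local Notation ph := (nlin (pi_h L)).
Local Notation pu := (nlin (sppi L (@unstable_pred R))).
Local Notation ps := (nlin (sppi L (@stable_pred R))).
Implicit Types (g v : R -> nvect E).

Lemma pcL x : pc (nlin L x) = nlin L (pc x).
Proof. exact: (@sppi_comm R E L (@center_pred R) x (@center_closed R)). Qed.

Lemma pcc x : pc (pc x) = pc x.
Proof. exact: (@sppi_idem R E L (@center_pred R) x (@center_closed R)). Qed.

Lemma lflowL r x : lflow L r (nlin L x) = nlin L (lflow L r x).
Proof. exact: lflow_comm. Qed.

Lemma lflow_continuous (y : R -> nvect E) (b : R) : continuous y ->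
  continuous (fun s => lflow L (b * s) (y s)).
Proof.
exact: (@flow_continuous R E (nlin L) (lflow L) (@lflow_derive _ _ L)).
Qed.

Lemma is_derive_lflow_affine (y : R -> nvect E) (v : nvect E) (a b s : R) :
  is_derive s (1 : R) y v ->
  is_derive s (1 : R) (fun s => lflow L (a + b * s) (y s))
    (lflow L (a + b * s) (v + b *: nlin L (y s))).
Proof.
exact: (@is_derive_flow_affine R E (nlin L) (lflow L) (@lflow_derive _ _ L) lflowL).
Qed.

Lemma is_derive_reverse (y : R -> nvect E) (v : nvect E) (t : R) :
  is_derive (- t) (1 : R) y v -> is_derive t (1 : R) (fun s => y (- s)) (- v).
Proof.
move=> yv; have E0 : 0 + -1 * t = - t by rewrite add0r mulN1r.
rewrite -E0 in yv; have := is_derive_affine yv; move/is_derive_eqfun; apply.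
  by move=> s; rewrite add0r mulN1r.
by rewrite scaleN1r.
Qed.

Lemma central_bound (e : R) : 0 < e -> exists2 K : R, 0 < K &
  forall g v c m t, e < m ->
  (forall t, is_derive t (1 : R) v (nlin L (v t) + g t)) ->
  (forall t, `|g t| <= c * weight m t) ->
  `|pc (v t)| <= K * (`|pc (v 0)| + c / (m - e)) * weight m t.
Proof.
move=> e0; have [K K0 HK] := sppi_decay_center L e0; exists K => // g v c m t em vd gc.
have m0 : 0 <= m by rewrite ltW// (lt_trans e0).
have pd s : is_derive s (1 : R) (fun s => pc (v s)) (nlin L (pc (v s)) + pc (g s)).
  have := is_derive_lin (@lin_continuous _ _ _ pc) (vd s); move/is_derive_eqfun; apply => //.
  by rewrite -pcL -linearD.
(* Both signs of [t] are reduced to a curve on the interval from 0 to |t|. It transports the center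
   part to time [t] by the flow, and time is reversed when [t] is negative. *)
suff [phi [dphi [h1 h2 h3 h4]]] : exists phi dphi : R -> nvect E,
    [/\ phi `|t| = pc (v t), phi 0 = lflow L t (pc (v 0)),
      forall s, is_derive s (1 : R) phi (dphi s) &
      forall s, 0 <= s <= `|t| -> `|dphi s| <= K * c * expR (e * (`|t| - s)) * weight m s].
  have := central_estimate (normr_ge0 t) (ltW e0) em h3 h4.
  rewrite h1 h2 => H; apply: (le_trans H).
  rewrite mulrDr [leRHS]mulrDl mulrA; apply: lerD.
    have -> : lflow L t (pc (v 0)) = lflow L t (pc (pc (v 0))) by rewrite pcc.
    rewrite (le_trans (HK _ _))// mulrAC ler_wpM2l//.
      by rewrite mulr_ge0// ltW.
    by rewrite ler_expR ler_wpM2r// ltW.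
  by rewrite /weight normr_id.
have bnd r s : `|lflow L r (pc (g s))| <= K * c * expR (e * `|r|) * weight m s.
  rewrite (le_trans (HK _ _))// (_ : K * c * _ * _ = K * expR (e * `|r|) * (c * weight m s)).
    by rewrite ler_wpM2l// mulr_ge0 ?expR_ge0// ltW.
  by ring.
have [t0|/ltW t0] := leP 0 t.
  exists (fun s => lflow L (t + -1 * s) (pc (v s))), (fun s => lflow L (t + -1 * s) (pc (g s))).
  rewrite ger0_norm//; split.
  - by rewrite mulN1r subrr lflow0.
  - by rewrite mulr0 addr0.
  - move=> s; have := is_derive_lflow_affine t (-1) (pd s).
    move/is_derive_eqfun; apply => //.
    by congr (lflow L _ _); rewrite scaleN1r addrC addKr.
  - move=> s /andP[s0 st]; apply: (le_trans (bnd _ _)).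
    by rewrite mulN1r (@ger0_norm _ (t - s)) ?subr_ge0.
exists (fun s => lflow L (t + 1 * s) (pc (v (- s)))),
  (fun s => - lflow L (t + 1 * s) (pc (g (- s)))).
rewrite ler0_norm//; split.
- by rewrite mul1r subrr lflow0 opprK.
- by rewrite mulr0 addr0 oppr0.
- move=> s; have := is_derive_lflow_affine t 1 (is_derive_reverse (pd (- s))).
  move/is_derive_eqfun; apply => //.
  by rewrite -linearN; congr (lflow L _ _); rewrite scale1r opprD addrAC addNr add0r.
- move=> s /andP[s0 st]; rewrite normrN; apply: (le_trans (bnd _ _)).
  rewrite mul1r weightN ler0_norm ?opprD//.
  by rewrite addrC -[t]opprK subr_le0.
Qed.

(** The growth condition only selects a solution. Its constant [C] never enters an estimate, and the
    quantitative bounds are recovered from those on [g]. *)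
Definition bounded_solution (m : R) g v :=
  (forall t, is_derive t (1 : R) v (nlin L (v t) + g t)) /\
  exists C, forall t, `|v t| <= C * weight m t.

Lemma spectral_gap : exists2 a : R, 0 < a &
  (forall l, l \in spectrum L -> unstable_pred l -> a < complex.Re l) /\
  (forall l, l \in spectrum L -> stable_pred l -> complex.Re l < - a).
Proof.
have [d d0 dl] := @seq_gap R _ (spectrum L) (fun l => complex.Re l) (@unstable_pred R)
  (fun l _ h => h).
have [d' d'0 dl'] := @seq_gap R _ (spectrum L) (fun l => - complex.Re l) (@stable_pred R)
  (fun l _ h => etrans (oppr_gt0 _) h).
(* [seq_gap] gives weak inequalities; halving makes them strict. *)
exists (Num.min d d' / 2); first by rewrite divr_gt0// lt_min d0.
have h : Num.min d d' / 2 < Num.min d d'.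
  by rewrite ltr_pdivrMr// ltr_pMr ?ltr1n// lt_min d0.
split=> l ls Sl.
  by rewrite (lt_le_trans h)// (le_trans _ (dl l ls Sl))// ge_min lexx.
by rewrite ltrNr (lt_le_trans h)// (le_trans _ (dl' l ls Sl))// ge_min lexx orbT.
Qed.

(* The stable part is the unstable part of the reversed equation. *)
Lemma hyperbolic_bounds : exists2 a : R, 0 < a & exists2 K : R, 0 < K &
  (forall g v m1 m c, m1 < a -> 0 <= m -> m <= m1 -> bounded_solution m1 g v ->
     (forall t, `|g t| <= c * weight m t) ->
     forall t, `|pu (v t)| <= K * c / (a - m) * weight m t /\
               `|ps (v t)| <= K * c / (a - m) * weight m t) /\
  (forall g P m c, 0 <= m -> m < a ->
     (forall t, is_derive t (1 : R) P (lflow L (- t) (g t))) ->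
     (forall t, `|g t| <= c * weight m t) ->
     exists x y, [/\ pu x = x, ps y = y,
       forall t, `|pu (lflow L t (P t + x))| <= K * c / (a - m) * weight m t &
       forall t, `|ps (lflow L t (P t + y))| <= K * c / (a - m) * weight m t]).
Proof.
have [a a0 [Hu Hs]] := spectral_gap; exists a => //.
have [Ku Ku0 decu] := sppi_decay_unstable Hu.
have [Ks Ks0 decs] := sppi_decay_stable Hs.
pose K := Ku + Ks; have K0 : 0 <= K by rewrite addr_ge0// ltW.
have decu' r x : 0 <= r -> `|lflow L (- r) (pu x)| <= K * expR (- (a * r)) * `|x|.
  move=> r0; apply: (le_trans (decu r x r0)).
  by rewrite -!mulrA ler_wpM2r ?mulr_ge0 ?expR_ge0// lerDl ltW.
pose S' t : {linear nvect E -> nvect E} := lflow L (- t).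
have decs' r x : 0 <= r -> `|S' (- r) (ps x)| <= K * expR (- (a * r)) * `|x|.
  move=> r0; rewrite /S' opprK; apply: (le_trans (decs r x r0)).
  by rewrite -!mulrA ler_wpM2r ?mulr_ge0 ?expR_ge0// lerDr ltW.
exists K; first by rewrite addr_gt0.
have Spu t x : lflow L t (pu x) = pu (lflow L t x).
  by apply: lflow_comm => y; exact: (sppi_comm L y (@unstable_closed R)).
have Sps t x : S' t (ps x) = ps (S' t x).
  by apply: lflow_comm => y; exact: (sppi_comm L y (@stable_closed R)).
have puL x : pu (nlin L x) = nlin L (pu x) by exact: (sppi_comm L x (@unstable_closed R)).
have psL x : ps (nlin (- L) x) = nlin (- L) (ps x).
  rewrite !nlinE !opp_lfunE linearN/=; congr (- _).
  exact: (sppi_comm L x (@stable_closed R)).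
have puu x : pu (pu x) = pu x by exact: (sppi_idem L x (@unstable_closed R)).
have pss x : ps (ps x) = ps x by exact: (sppi_idem L x (@stable_closed R)).
have S'0 x : S' 0 x = x by rewrite /S' oppr0; exact: lflow0.
have S'D s t x : S' (s + t) x = S' s (S' t x) by rewrite /S' opprD; exact: lflowD.
have S'd x t : is_derive t (1 : R) (fun t => S' t x) (nlin (- L) (S' t x)).
  have := is_derive_reverse (lflow_derive L x (- t)); move/is_derive_eqfun; apply => //.
  by rewrite (nlinE (- L)) opp_lfunE.
have S'L t x : S' t (nlin (- L) x) = nlin (- L) (S' t x).
  by rewrite !nlinE !opp_lfunE linearN/=; congr (- _); exact: lflowL.
split.
  move=> g v m1 m c m1a m0 mm1 [vd [C vC]] gc t; split.
    exact: (@dichotomy_estimate R E (nlin L) (lflow L) pu (@lflow0 _ _ L) (@lflow_derive _ _ L)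
      lflowL puL a K K0 decu' g v m1 m c C m1a m0 mm1 vd gc vC).
  have vd' s : is_derive s (1 : R) (fun s => v (- s)) (nlin (- L) (v (- s)) + - g (- s)).
    have := is_derive_reverse (vd (- s)); move/is_derive_eqfun; apply => //.
    by rewrite (nlinE (- L)) opp_lfunE opprD.
  have gc' s : `|- g (- s)| <= c * weight m s by rewrite normrN -weightN.
  have vC' s : `|v (- s)| <= C * weight m1 s by rewrite -weightN.
  have := @dichotomy_estimate R E (nlin (- L)) S' ps S'0 S'd
      S'L psL a K K0 decs' _ _ m1 m c C m1a m0 mm1 vd' gc' vC' (- t).
  by rewrite opprK weightN.
move=> g P m c m0 ma Pd gc.
have [x [xu xb]] := @dichotomy_existence R E (lflow L) pu (@lflowD _ _ L) Spu a K K0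
  decu' g P m c m0 ma puu Pd gc.
have gc' s : `|- g (- s)| <= c * weight m s by rewrite normrN -weightN.
have Pd' s : is_derive s (1 : R) (fun s => P (- s)) (S' (- s) (- g (- s))).
  by rewrite linearN/= /S'; exact: is_derive_reverse (Pd (- s)).
have [y [yu yb]] := @dichotomy_existence R E S' ps S'D Sps a K K0
  decs' _ _ m c m0 ma pss Pd' gc'.
exists x, y; split; [exact: xu|exact: yu|exact: xb|move=> t].
by have := yb (- t); rewrite /S' !opprK weightN.
Qed.

(** All that the nonlinear argument uses about [L]. One constant [K] serves every exponent between
    [m0] and [m1], and a solution that grows at most at rate [m1] satisfies the sharper bound
    allowed by its forcing term. *)
Lemma linear_estimates : exists2 a : R, 0 < a & forall m0 m1 : R, 0 < m0 -> m0 <= m1 -> m1 < a ->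
  exists2 K : R, 0 < K &
  [/\ forall g v m c, m0 <= m -> m <= m1 -> bounded_solution m1 g v ->
        (forall t, `|g t| <= c * weight m t) ->
        forall t, `|v t| <= K * (c + `|pc (v 0)|) * weight m t,
      forall g v c, bounded_solution m1 g v -> (forall t, `|g t| <= c) ->
        forall t, `|ph (v t)| <= K * c &
      forall s g m c, m0 <= m -> m <= m1 -> continuous g ->
        (forall t, `|g t| <= c * weight m t) -> pc s = s ->
        exists2 v, bounded_solution m1 g v & pc (v 0) = s].
Proof.
have [a a0 [Kh Kh0 [Hb Hex]]] := hyperbolic_bounds; exists a => // m0 m1 m00 m01 m1a.
have e0 : 0 < m0 / 2 by rewrite divr_gt0.
have m0h m : m0 <= m -> m0 / 2 < m by move: m00; clear; lra.
have [Kc Kc0 Hc] := central_bound e0.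
have am1 : 0 < a - m1 by rewrite subr_gt0.
have chE x : x = pc x + (pu x + ps x).
  exact: (etrans (pi_ch L x) (congr1 (fun z => pi_c L x + z) (pi_hE L x))).
have phE x : ph x = pu x + ps x by exact: (pi_hE L x).
have inv_le m : m <= m1 -> (a - m)^-1 <= (a - m1)^-1.
  by move=> mm; rewrite lef_pV2 ?posrE// ?subr_gt0 ?(le_lt_trans mm)// lerD2l lerN2.
have inv_le' m : m0 <= m -> (m - m0 / 2)^-1 <= (m0 / 2)^-1.
  by move=> mm; rewrite lef_pV2 ?posrE//; lra.
have c_ge0 g c m : (forall t, `|g t : nvect E| <= c * weight m t) -> 0 <= c.
  by move=> /(_ 0); rewrite weight0 mulr1; exact: le_trans.
pose K := Kc + Kc / (m0 / 2) + 2 * (Kh / (a - m1)).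
have K1 : 0 <= Kc / (m0 / 2) by rewrite divr_ge0// ltW.
have K2 : 0 <= Kh / (a - m1) by rewrite divr_ge0// ltW.
have K0 : 0 < K by rewrite /K; lra.
have H1 g v m c : m0 <= m -> m <= m1 -> bounded_solution m1 g v ->
    (forall t, `|g t| <= c * weight m t) ->
    forall t, `|v t| <= K * (c + `|pc (v 0)|) * weight m t.
  move=> mm0 mm1 vs gc t; have [vd _] := vs; have c0 := c_ge0 g c m gc.
  have m00' : 0 <= m := le_trans (ltW m00) mm0.
  have [hu hs] := Hb g v m1 m c m1a m00' mm1 vs gc t.
  have hc := Hc g v c m t _ vd gc.
  have {}hc : `|pc (v t)| <= Kc * (`|pc (v 0)| + c / (m0 / 2)) * weight m t.
    apply: (le_trans (hc (m0h m mm0))).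
    by rewrite ler_wpM2r ?weight_ge0// ler_wpM2l ?(ltW Kc0)// lerD2l ler_wpM2l// inv_le'.
  have hh : Kh * c / (a - m) <= Kh / (a - m1) * c.
    by rewrite [leRHS]mulrAC ler_wpM2l ?inv_le// mulr_ge0// ltW.
  rewrite {1}(chE (v t)) (le_trans (ler_normD _ _))//.
  apply: (le_trans (lerD hc (le_trans (ler_normD _ _) (lerD hu hs)))).
  rewrite -mulrDl -mulrDl ler_wpM2r ?weight_ge0//.
  have n0 := normr_ge0 (pc (v 0)).
  rewrite /K; set N := `|pc (v 0)| in n0 *.
  rewrite (_ : Kc * (N + _) = Kc * N + Kc / (m0 / 2) * c); last by ring.
  apply: (@le_trans _ _ (Kc * N + Kc / (m0 / 2) * c + (Kh / (a - m1) * c + Kh / (a - m1) * c))).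
    by rewrite lerD2l lerD.
  have q1 : 0 <= Kc * c by rewrite mulr_ge0// ltW.
  have q2 : 0 <= Kc / (m0 / 2) * N by rewrite mulr_ge0.
  have q3 : 0 <= Kh / (a - m1) * N by rewrite mulr_ge0.
  rewrite -subr_ge0 (_ : _ - _ = Kc * c + Kc / (m0 / 2) * N + (Kh / (a - m1) * N + Kh / (a - m1) * N)).
    by rewrite !addr_ge0.
  by ring.
exists K => //; split => //.
- move=> g v c vs gc t.
  have gc' s : `|g s| <= c * weight 0 s by rewrite /weight mul0r expR0 mulr1.
  have c0 := c_ge0 g c 0 gc'.
  have [hu hs] := Hb g v m1 0 c m1a (lexx _) (le_trans (ltW m00) m01) vs gc' t.
  have hh : Kh * c / (a - 0) <= Kh / (a - m1) * c.
    by rewrite [leRHS]mulrAC ler_wpM2l ?inv_le ?mulr_ge0 ?(ltW Kh0)// (le_trans (ltW m00)).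
  rewrite phE (le_trans (ler_normD _ _))// (le_trans (lerD hu hs))//.
  rewrite /weight mul0r expR0 mulr1 (le_trans (lerD hh hh))// -mulrDl ler_wpM2r//.
  by rewrite /K mulr_natl mulr2n lerDr addr_ge0// ltW.
- move=> s g m c mm0 mm1 gcont gc ss.
  have m00' : 0 <= m := le_trans (ltW m00) mm0.
  have [|P [P0 Pd]] := @primitive R E (fun t => lflow L (-1 * t) (g t)).
    exact: lflow_continuous.
  have Pd' t : is_derive t (1 : R) P (lflow L (- t) (g t)) by rewrite -mulN1r.
  have [x [y [xu ys hx hy]]] := Hex g P m c m00' (le_lt_trans mm1 m1a) Pd' gc.
  (* [s] prescribes the center part, while [x] and [y] correct the unstable and the stable part.
     Each of the three is annihilated by the other two projections, so that the corrections do not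
     interfere. *)
  pose v t := lflow L t (P t + (s + (x + y))).
  have vd t : is_derive t (1 : R) v (nlin L (v t) + g t).
    have := @is_derive_lflow_affine (fun t => P t + (s + (x + y))) _ 0 1 t
      (is_deriveD (Pd' t) (is_derive_cst _ t (1 : R))).
    move/is_derive_eqfun; apply; first by move=> r; rewrite add0r mul1r.
    have SE (z w : nvect E) : lflow L t (lflow L (- t) w + nlin L z) = nlin L (lflow L t z) + w.
      rewrite (linearD (lflow L t) (lflow L (- t) w) (nlin L z))/= -lflowD subrr lflow0 lflowL.
      exact: addrC.
    by rewrite add0r mul1r addr0 scale1r SE.
  have pcx : pc x = 0.
    exact: (@sppi_orth R E L (@unstable_pred R) (@center_pred R) x (@center_closed R) (@center_unstable R) xu).
  have pcy : pc y = 0.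
    exact: (@sppi_orth R E L (@stable_pred R) (@center_pred R) y (@center_closed R) (@center_stable R) ys).
  have pux : pu y = 0.
    exact: (@sppi_orth R E L (@stable_pred R) (@unstable_pred R) y (@unstable_closed R) (@unstable_stable R) ys).
  have psx : ps x = 0.
    exact: (@sppi_orth R E L (@unstable_pred R) (@stable_pred R) x (@stable_closed R) (fun l h => contraL (@unstable_stable R l) h) xu).
  have pus : pu s = 0.
    exact: (@sppi_orth R E L (@center_pred R) (@unstable_pred R) s (@unstable_closed R) (fun l h => contraL (@center_unstable R l) h) ss).
  have pss : ps s = 0.
    exact: (@sppi_orth R E L (@center_pred R) (@stable_pred R) s (@stable_closed R) (fun l h => contraL (@center_stable R l) h) ss).
  have v0 : pc (v 0) = s by rewrite /v lflow0 P0 add0r !linearD/= pcx pcy ss !addr0.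
  have cm t : `|pc (v t)| <= Kc * (`|s| + c / (m - m0 / 2)) * weight m t.
    by rewrite -{1}v0; apply: Hc => //; exact: m0h.
  have Spu t z : pu (lflow L t z) = lflow L t (pu z).
    by apply/esym; apply: lflow_comm => w; exact: (sppi_comm L w (@unstable_closed R)).
  have Sps t z : ps (lflow L t z) = lflow L t (ps z).
    by apply/esym; apply: lflow_comm => w; exact: (sppi_comm L w (@stable_closed R)).
  have puv t : pu (v t) = pu (lflow L t (P t + x)).
    by rewrite !Spu; congr (lflow L _ _); rewrite !linearD/= pus pux addr0 add0r.
  have psv t : ps (v t) = ps (lflow L t (P t + y)).
    by rewrite !Sps; congr (lflow L _ _); rewrite !linearD/= pss psx !add0r.
  exists v => //; split => //.
  exists (Kc * (`|s| + c / (m - m0 / 2)) + (Kh * c / (a - m) + Kh * c / (a - m))) => t.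
  have c0 := c_ge0 g c m gc.
  apply: (@le_trans _ _ ((Kc * (`|s| + c / (m - m0 / 2)) + (Kh * c / (a - m) + Kh * c / (a - m))) * weight m t)).
    have hu := hx t; rewrite -puv in hu; have hs := hy t; rewrite -psv in hs.
    rewrite {1}(chE (v t)) mulrDl mulrDl.
    exact: (le_trans (ler_normD _ _) (lerD (cm t) (le_trans (ler_normD _ _) (lerD hu hs)))).
  apply: ler_wpM2l; last exact: weight_le.
  have am : 0 < a - m by rewrite subr_gt0 (le_lt_trans mm1).
  have mm : 0 < m - m0 / 2 by rewrite subr_gt0 m0h.
  have q1 : 0 <= Kh * c / (a - m) by rewrite divr_ge0 ?(ltW am)// mulr_ge0// ltW.
  rewrite addr_ge0 ?(addr_ge0 q1 q1)// mulr_ge0 ?(ltW Kc0)// addr_ge0// divr_ge0// ltW//.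
Qed.

End LinearEstimates.

(** * Families of curves depending smoothly on a parameter *)

(* Additive identities between vectors, checked on coordinates. *)
Ltac vring := apply: coord_inj => ?;
  rewrite ?(linearD, linearB, linearN, linearZ, linear0) /= /GRing.scale /=; ring.

Section Calculus.
Variable R : realType.
Implicit Types E F : vectType R.

Lemma product_increment E (a0 a1 a' : R) (v0 v1 v' : nvect E) :
  a1 *: v1 - a0 *: v0 - (a' *: v0 + a0 *: v') =
  (a1 - a0 - a') *: v1 + (a' *: (v1 - v0) + a0 *: (v1 - v0 - v')).
Proof. by vring. Qed.

Lemma product_linear E (b a1 a2 c : R) (u v1 v2 : nvect E) :
  (b * a1 + a2) *: u + c *: (b *: v1 + v2) =
  b *: (a1 *: u + c *: v1) + (a2 *: u + c *: v2).
Proof. by vring. Qed.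

Lemma combine_cancel E (b : R) (p q r k l : nvect E) :
  p + (b *: k + l) - (b *: (q + k) + (r + l)) = p - (b *: q + r).
Proof. by vring. Qed.

Lemma bilinear_increment E (p11 p10 p01 p00 p' q h1 h0 h' : nvect E) :
  p11 + h1 - (p00 + h0) - (p' + (q + h')) =
  p01 - p00 - p' + (p11 - p10 + (- p01 - - p00) + (p10 - p00 - q + (h1 - h0 - h'))).
Proof. by vring. Qed.

Lemma taylor_shift E (f2 f1 f0 ax ah bh : nvect E) :
  f2 - f0 - (ax + ah) - (f1 - f0 - ax) - (bh - ah) = f2 - f1 - bh.
Proof. by vring. Qed.

Lemma diff_criterion_gen (V W : normedModType R) (f : V -> W) (df : {linear V -> W}) x :
  continuous df ->
  (forall e : R, 0 < e -> exists2 d : R, 0 < d &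
     forall h, `|h| <= d -> `|f (x + h) - f x - df h| <= e * `|h|) ->
  differentiable f x /\ forall h, 'd f x h = df h.
Proof.
move=> dfc H.
have S : f \o shift x = cst (f x) + df +o_ (0 : V) id.
  apply/eqaddoP => e e0; have [d d0 hd] := H e e0.
  apply/nbhs_ballP; exists d => //= h; rewrite -ball_normE /= sub0r normrN => /ltW/hd.
  rewrite -[X in _ -> `|X| <= _]/(f (h + x) - (f x + df h)).
  by rewrite [h + x]addrC opprD addrA.
have D := diff_unique dfc S.
split; last by move=> h; rewrite D.
by apply/diff_locallyP; rewrite D.
Qed.

Lemma diff_criterion E F (f : nvect E -> nvect F) (df : {linear nvect E -> nvect F}) x :
  (forall e : R, 0 < e -> exists2 d : R, 0 < d &
     forall h, `|h| <= d -> `|f (x + h) - f x - df h| <= e * `|h|) ->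
  differentiable f x /\ forall h, 'd f x h = df h.
Proof. by apply: diff_criterion_gen; exact: lin_continuous. Qed.

Lemma diff_estimate E F (f : nvect E -> nvect F) x : differentiable f x ->
  forall e : R, 0 < e -> exists2 d : R, 0 < d &
     forall h, `|h| <= d -> `|f (x + h) - f x - 'd f x h| <= e * `|h|.
Proof.
move=> /diff_locally/eqaddoP H e e0.
have /nbhs_ballP[d /= d0 hd] := H e e0; exists (d / 2); first by rewrite divr_gt0.
move=> h hh; suff : `|f (h + x) - (f x + 'd f x h)| <= e * `|h|.
  by rewrite [h + x]addrC opprD addrA.
apply: (hd h); rewrite -ball_normE /= sub0r normrN.
by rewrite (le_lt_trans hh)// ltr_pdivrMr// ltr_pMr// ltr1n.
Qed.

Lemma is_derive_line E F (g : nvect E -> nvect F) (a h : nvect E) (t : R) :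
  differentiable g (a + t *: h) ->
  is_derive t (1 : R) (fun s => g (a + s *: h)) ('d g (a + t *: h) h).
Proof.
move=> dg.
have dl : is_derive t (1 : R) (fun s : R => a + s *: h) h.
  rewrite -[X in is_derive _ _ _ X]add0r; apply: is_deriveD.
  apply: is_derive_coordP => i.
  have := is_deriveZ (coord_of i h) (is_derive_id t (1 : R)); move/is_derive_eqfun; apply.
    by move=> s; rewrite linearZ/= /GRing.scale/= mulrC.
  by rewrite /GRing.scale/= mulr1.
have dl' : differentiable (fun s : R => a + s *: h) t by apply/derivable1_diffP.
have dc : differentiable (g \o (fun s : R => a + s *: h)) t by exact: differentiable_comp.
apply: DeriveDef; first by apply/derivable1_diffP.
rewrite deriveE//= diff_comp//=; congr ('d g _ _).
by rewrite -deriveE// derive_val.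
Qed.

(** With the differential of [g] at [a] for [A] this bounds a Taylor remainder; with the zero map it
    bounds the Lipschitz constant. *)
Lemma mean_value_diff E F (g : nvect E -> nvect F) (A : {linear nvect E -> nvect F})
    (a h : nvect E) (b : R) : (forall x, differentiable g x) ->
  (forall s : R, 0 <= s <= 1 -> `|'d g (a + s *: h) h - A h| <= b) ->
  `|g (a + h) - g a - A h| <= b.
Proof.
move=> dg H.
have pd s : is_derive s (1 : R) (fun s => g (a + s *: h) - s *: A h)
    ('d g (a + s *: h) h - A h).
  apply: is_deriveB; first exact: is_derive_line.
  apply: is_derive_coordP => i.
  have := is_deriveZ (coord_of i (A h)) (is_derive_id s (1 : R)); move/is_derive_eqfun; apply.
    by move=> r; rewrite linearZ/= /GRing.scale/= mulrC.
  by rewrite /GRing.scale/= mulr1.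
have bd s : is_derive s (1 : R) (fun s : R => b * s) b.
  have := is_deriveZ b (is_derive_id s (1 : R)); move/is_derive_eqfun; apply => //.
  by rewrite /GRing.scale/= mulr1.
have := mean_value_ineq ler01 (fun s _ => pd s) (fun s _ => bd s) H.
by rewrite !scale1r !scale0r !addr0 subr0 mulr1 mulr0 subr0 addrAC.
Qed.

Lemma coord_sum_le E F (z : nvect E) (a : 'I_(\dim {: E}) -> nvect F) (b : R) :
  (forall i, `|a i| <= b) ->
  `|\sum_i coord_of i z *: a i| <= (\dim {: E})%:R * `|z| * b.
Proof.
move=> ab; rewrite (le_trans (ler_norm_sum _ _ _))//.
rewrite -mulrA mulr_natl -[X in _ *+ X]card_ord -sumr_const; apply: ler_sum => i _.
by rewrite normrZ ler_pM// coord_norm.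
Qed.

Lemma diff_coordE E F (g : nvect E -> nvect F) x v :
  'd g x v = \sum_i coord_of i v *: 'd g x (base i).
Proof. by rewrite {1}(coord_baseE v) linear_sum; apply: eq_bigr => i _; rewrite linearZ. Qed.

(* The second condition is a form of uniform continuity for bounded maps which
   needs no modulus of continuity. *)
Definition ucb E F (g : nvect E -> nvect F) : Prop :=
  (exists M : R, forall x, `|g x| <= M) /\
  (forall e : R, 0 < e -> exists2 M : R, 0 <= M & forall a b, `|g a - g b| <= e + M * `|a - b|).

(** The recursion of [Ck] with boundedness and uniform continuity at each order. Composition with
    [g] along curves that are unbounded in time requires this uniformity. *)
Fixpoint Ub E F (j : nat) (g : nvect E -> nvect F) : Prop :=
  ucb g /\ if j is j'.+1 then
    (forall x, differentiable g x) /\ forall v, Ub j' (fun x => 'd g x v) else True.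

Lemma ucb_continuous E F (g : nvect E -> nvect F) : ucb g -> continuous g.
Proof.
move=> [_ H] x; apply/eps_continuous => e e0.
have [|M M0 HM] := H (e / 2); first by rewrite divr_gt0.
exists (e / 2 / (M + 1)); first by rewrite !divr_gt0// ltr_wpDl.
move=> y; rewrite ler_pdivlMr ?ltr_wpDl// => xy; rewrite (le_trans (HM x y))//.
rewrite [leRHS]splitr lerD2l (le_trans _ xy)// mulrC ler_wpM2l// lerDl//.
Qed.

Lemma Ub_ucb E F j (g : nvect E -> nvect F) : Ub j g -> ucb g.
Proof. by case: j => [|j] []. Qed.

Lemma UbW E F j i (g : nvect E -> nvect F) : (i <= j)%N -> Ub j g -> Ub i g.
Proof.
elim: i j g => [|i IH] [|j] g // ij; first by case.
by move=> [ug [dg Hg]]; split => //; split => // v; apply: IH (Hg v).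
Qed.

Lemma Ub_Ck E F j (g : nvect E -> nvect F) : Ub j g -> Ck j g.
Proof.
elim: j g => [|j IH] g /=; first by case=> /ucb_continuous.
by move=> [_ [dg Hg]]; split => // v; exact: IH.
Qed.

(** A bound uniform in [a] and without smallness of [h]: the increments between two curves grow with
    time and leave every ball. *)
Lemma Ub_taylor E F j (g : nvect E -> nvect F) : Ub j.+1 g ->
  forall e : R, 0 < e -> exists2 M : R, 0 <= M &
    forall a h, `|g (a + h) - g a - 'd g a h| <= (e + M * `|h|) * `|h|.
Proof.
move=> [_ [dg Hg]] e e0; pose d : R := (\dim {: E})%:R + 1.
have d0 : 0 < d by rewrite ltr_wpDl.
have ed0 : 0 < e / d by rewrite divr_gt0.
have Hi i : exists M : R, 0 <= M /\
    forall a b, `|'d g a (base i) - 'd g b (base i)| <= e / d + M * `|a - b|.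
  by have [_ /(_ _ ed0)[M M0 HM]] := Ub_ucb (Hg (base i)); exists M.
have [M HM] := choice Hi.
have sM : 0 <= \sum_i M i by apply: sumr_ge0 => i _; case: (HM i).
exists (d * \sum_i M i); first by rewrite mulr_ge0// ltW.
move=> a h; apply: mean_value_diff => // s /andP[s0 s1].
rewrite !(diff_coordE g _ h) -sumrB; under eq_bigr do rewrite -scalerBr.
have B0 : 0 <= e / d + (\sum_i M i) * `|h|.
  by apply: addr_ge0; [exact: ltW|exact: mulr_ge0].
apply: (le_trans (coord_sum_le (b := e / d + (\sum_i M i) * `|h|) _ _)).
  move=> i; have [Mi0 HMi] := HM i; rewrite (le_trans (HMi _ _))// lerD2l.
  rewrite addrAC subrr add0r normrZ ger0_norm// ler_pM//; first by rewrite mulr_ge0.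
    by rewrite (bigD1 i)//= lerDl; apply: sumr_ge0 => l _; case: (HM l).
  by rewrite ler_piMl.
rewrite mulrAC [leRHS]mulrC [leLHS]mulrC ler_wpM2l//.
apply: (@le_trans _ _ (d * (e / d + (\sum_i M i) * `|h|))).
  by rewrite ler_wpM2r// lerDl.
by rewrite mulrDr mulrCA divff ?gt_eqF// mulr1 mulrA.
Qed.

Lemma Ub_diff_bounded E F j (g : nvect E -> nvect F) : Ub j.+1 g ->
  exists2 M : R, 0 <= M & forall a h, `|'d g a h| <= M * `|h|.
Proof.
move=> [_ [dg Hg]].
have Hi i : exists M : R, forall a, `|'d g a (base i)| <= M.
  by have [] := Ub_ucb (Hg (base i)).
have [M HM] := choice Hi.
have M0 i : 0 <= M i by exact: le_trans (HM i 0).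
exists ((\dim {: E})%:R * \sum_i M i); first by rewrite mulr_ge0// sumr_ge0.
move=> a h; rewrite diff_coordE mulrAC; apply: coord_sum_le => i.
by rewrite (le_trans (HM i a))// (bigD1 i)//= lerDl sumr_ge0.
Qed.

End Calculus.

Section Families.
Variables (R : realType) (E : vectType R).
Implicit Types F : vectType R.

(* Continuity and differentiability of x |-> u x as a map into the space of curves
   with the norm sup |v t| / weight m t. *)
Definition wcont F (m : R) (u : nvect E -> R -> nvect F) : Prop :=
  [/\ forall x, continuous (u x),
      forall x, exists2 C : R, 0 <= C & forall t, `|u x t| <= C * weight m t &
      forall x (e : R), 0 < e -> exists2 d : R, 0 < d & forall h, `|h| <= d ->
        forall t, `|u (x + h) t - u x t| <= e * weight m t].

Definition wdiff F (m : R) (u : nvect E -> R -> nvect F)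
    (u' : nvect E -> nvect E -> R -> nvect F) : Prop :=
  (forall x t (a : R) h k, u' (a *: h + k) x t = a *: u' h x t + u' k x t) /\
  (forall x (e : R), 0 < e -> exists2 d : R, 0 < d & forall h, `|h| <= d ->
     forall t, `|u (x + h) t - u x t - u' h x t| <= e * `|h| * weight m t).

(* The exponent grows because composition with a nonlinear map is not
   differentiable from a weighted space to itself. *)
Fixpoint wC F (j : nat) (m : R) (u : nvect E -> R -> nvect F) : Prop :=
  wcont m u /\ if j is j'.+1 then exists2 u', wdiff (4 * m) u u' &
    forall h, wC j' (4 * m) (u' h) else True.

Lemma wC_wcont F j m (u : nvect E -> R -> nvect F) : wC j m u -> wcont m u.
Proof. by case: j => [|j] []. Qed.

Lemma wcont_le F m n (u : nvect E -> R -> nvect F) : m <= n -> wcont m u -> wcont n u.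
Proof.
move=> mn [uc ub ud]; split=> // x.
  by have [C C0 HC] := ub x; exists C => // t; rewrite (le_trans (HC t))// ler_wpM2l// weight_le.
move=> e e0; have [d d0 hd] := ud x e e0; exists d => // h hh t.
by rewrite (le_trans (hd h hh t))// ler_wpM2l ?(ltW e0)// weight_le.
Qed.

Lemma wdiff_le F m n (u : nvect E -> R -> nvect F) u' : m <= n -> wdiff m u u' -> wdiff n u u'.
Proof.
move=> mn [ul ud]; split=> // x e e0; have [d d0 hd] := ud x e e0; exists d => // h hh t.
by rewrite (le_trans (hd h hh t))// ler_wpM2l ?mulr_ge0 ?(ltW e0)// weight_le.
Qed.

Lemma wC_le F j i m n (u : nvect E -> R -> nvect F) : (i <= j)%N -> m <= n ->
  wC j m u -> wC i n u.
Proof.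
elim: i j m n u => [|i IH] [|j] m n u // ij mn.
- by case=> + _; split => //; exact: wcont_le mn _.
- by case=> + _; split => //; exact: wcont_le mn _.
move=> [uc [u' ud Hu]]; split; first exact: wcont_le mn uc.
have mn4 : 4 * m <= 4 * n by rewrite ler_wpM2l.
exists u'; first exact: wdiff_le mn4 ud.
by move=> h; apply: IH (Hu h).
Qed.

Lemma wdiff_linear F m (u : nvect E -> R -> nvect F) u' x t h : wdiff m u u' ->
  u' h x t = \sum_i coord_of i h *: u' (base i) x t.
Proof.
move=> [ul _].
have u0 : u' 0 x t = 0.
  have := ul x t 1 0 0; by rewrite !scale1r addr0 -[LHS]addr0 => /addrI/esym.
have uD (I : Type) (r : seq I) (c : I -> R) (b : I -> nvect E) :
    u' (\sum_(i <- r) c i *: b i) x t = \sum_(i <- r) c i *: u' (b i) x t.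
  elim: r => [|i r IH]; first by rewrite !big_nil.
  by rewrite !big_cons ul IH.
by rewrite {1}(coord_baseE h) uD.
Qed.

Lemma wdiff_bound F m (u : nvect E -> R -> nvect F) u' x : wdiff m u u' ->
  (forall h, wcont m (u' h)) ->
  exists2 C : R, 0 <= C & forall h t, `|u' h x t| <= C * `|h| * weight m t.
Proof.
move=> ud uc.
have Hi (i : 'I_(\dim {: E})) : exists C, 0 <= C /\ forall t, `|u' (base i) x t| <= C * weight m t.
  by have [_ /(_ x)[C C0 HC] _] := uc (base i); exists C.
have [C HC] := choice Hi.
have sC : 0 <= \sum_i C i by apply: sumr_ge0 => i _; case: (HC i).
exists ((\dim {: E})%:R * \sum_i C i); first by rewrite mulr_ge0.
move=> h t; rewrite (wdiff_linear x t h ud).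
apply: (le_trans (coord_sum_le (b := (\sum_i C i) * weight m t) _ _)).
  move=> i; have [Ci HCi] := HC i; rewrite (le_trans (HCi t))// ler_wpM2r ?weight_ge0//.
  by rewrite (bigD1 i)//= lerDl; apply: sumr_ge0 => l _; case: (HC l).
by rewrite le_eqVlt; apply/orP; left; apply/eqP; ring.
Qed.

Lemma wdiff_lipschitz F m (u : nvect E -> R -> nvect F) u' x : wdiff m u u' ->
  (forall h, wcont m (u' h)) ->
  exists2 C : R, 0 <= C & exists2 d : R, 0 < d &
    forall h, `|h| <= d -> forall t, `|u (x + h) t - u x t| <= C * `|h| * weight m t.
Proof.
move=> ud uc; have [C C0 HC] := wdiff_bound x ud uc.
have [d d0 hd] := ud.2 x 1 ltr01.
exists (1 + C); first by rewrite addr_ge0.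
exists d => // h hh t; rewrite -(subrK (u' h x t) (u (x + h) t - u x t)).
by rewrite (le_trans (ler_normD _ _))// !mulrDl lerD// hd.
Qed.

Lemma wcontD F m (u v : nvect E -> R -> nvect F) :
  wcont m u -> wcont m v -> wcont m (fun x t => u x t + v x t).
Proof.
move=> [uc ub ud] [vc vb vd]; split=> x.
- by move=> t; apply: continuousD; [exact: uc|exact: vc].
- have [C C0 HC] := ub x; have [D D0 HD] := vb x; exists (C + D); first exact: addr_ge0.
  by move=> t; rewrite (le_trans (ler_normD _ _))// mulrDl lerD.
- move=> e e0; have e2 : 0 < e / 2 by rewrite divr_gt0.
  have [d d0 hd] := ud x _ e2; have [d' d'0 hd'] := vd x _ e2.
  exists (Num.min d d'); first by rewrite lt_min d0.
  move=> h; rewrite le_min => /andP[hh hh'] t.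
  rewrite opprD addrACA (le_trans (ler_normD _ _))// [e]splitr mulrDl lerD//.
    exact: hd.
  exact: hd'.
Qed.

Lemma wdiffD F m (u v : nvect E -> R -> nvect F) u' v' :
  wdiff m u u' -> wdiff m v v' ->
  wdiff m (fun x t => u x t + v x t) (fun h x t => u' h x t + v' h x t).
Proof.
move=> [ul ud] [vl vd]; split.
  by move=> x t a h k; rewrite ul vl scalerDr addrACA.
move=> x e e0; have e2 : 0 < e / 2 by rewrite divr_gt0.
have [d d0 hd] := ud x _ e2; have [d' d'0 hd'] := vd x _ e2.
exists (Num.min d d'); first by rewrite lt_min d0.
move=> h; rewrite le_min => /andP[hh hh'] t.
rewrite (_ : _ - _ = (u (x + h) t - u x t - u' h x t) + (v (x + h) t - v x t - v' h x t)).
  rewrite (le_trans (ler_normD _ _))// [e]splitr !mulrDl lerD//.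
    exact: hd.
  exact: hd'.
by vring.
Qed.

Lemma wCD F j m (u v : nvect E -> R -> nvect F) :
  wC j m u -> wC j m v -> wC j m (fun x t => u x t + v x t).
Proof.
elim: j m u v => [|j IH] m u v.
  by case=> uc _ [vc _]; split => //; exact: wcontD.
move=> [uc [u' ud Hu]] [vc [v' vd Hv]]; split; first exact: wcontD.
exists (fun h x t => u' h x t + v' h x t); first exact: wdiffD.
by move=> h; exact: (IH _ _ _ (Hu h) (Hv h)).
Qed.

Lemma wC0 F j m : wC j m (fun (_ : nvect E) (_ : R) => 0 : nvect F).
Proof.
have w0 n : wcont n (fun (_ : nvect E) (_ : R) => 0 : nvect F).
  split=> x.
  - by move=> t; exact: cvg_cst.
  - by exists 0 => // t; rewrite normr0 mul0r.
  - move=> e e0; exists 1 => // h _ t.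
    by rewrite subrr normr0 mulr_ge0 ?weight_ge0// ltW.
elim: j m => [|j IH] m; first by split.
split; first exact: w0; exists (fun _ _ _ => 0); last by [].
split; first by move=> *; rewrite scaler0 addr0.
move=> x e e0; exists 1 => // h _ t.
by rewrite !subrr normr0 mulr_ge0 ?weight_ge0// mulr_ge0// ltW.
Qed.

Lemma wC_sum F (I : Type) (r : seq I) j m (u : I -> nvect E -> R -> nvect F) :
  (forall i, wC j m (u i)) -> wC j m (fun x t => \sum_(i <- r) u i x t).
Proof.
move=> H; elim: r => [|i r IH].
  have -> : (fun x t => \sum_(i <- [::]) u i x t) = (fun _ _ => 0).
    by apply/funext => x; apply/funext => t; rewrite big_nil.
  exact: wC0.
have -> : (fun x t => \sum_(l <- i :: r) u l x t) =
          (fun x t => u i x t + \sum_(l <- r) u l x t).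
  by apply/funext => x; apply/funext => t; rewrite big_cons.
exact: wCD.
Qed.

Lemma prod_diff_le F F' (i : 'I_(\dim {: F})) (a a' : nvect F) (b b' : nvect F') :
  `|coord_of i a' *: b' - coord_of i a *: b| <= `|a' - a| * `|b'| + `|a| * `|b' - b|.
Proof.
have -> : coord_of i a' *: b' - coord_of i a *: b =
    coord_of i (a' - a) *: b' + coord_of i a *: (b' - b).
  by rewrite linearB/= scalerBl scalerBr addrA subrK.
rewrite (le_trans (ler_normD _ _))// !normrZ lerD// ler_wpM2r// coord_norm//.
Qed.

Lemma wcontZ F F' (i : 'I_(\dim {: F})) m n
    (u : nvect E -> R -> nvect F) (v : nvect E -> R -> nvect F') :
  wcont m u -> wcont n v -> wcont (m + n) (fun x t => coord_of i (u x t) *: v x t).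
Proof.
move=> [uc ub ud] [vc vb vd]; split=> x.
- move=> t; apply: cvgZ; last exact: vc.
  by apply: (@continuous_comp _ _ _ (u x) (coord_of i)); [exact: uc|exact: coord_of_continuous].
- have [C C0 HC] := ub x; have [D D0 HD] := vb x; exists (C * D); first exact: mulr_ge0.
  move=> t; rewrite normrZ -weightD mulrACA ler_pM//.
  by rewrite (le_trans (coord_norm _ _)).
- have [C C0 HC] := ub x; have [D D0 HD] := vb x.
  move=> e e0; have q0 : 0 < C + (D + 1) by rewrite ltr_wpDl// ltr_wpDl.
  pose e1 := e / (C + (D + 1)); have e10 : 0 < e1 by rewrite divr_gt0.
  have [d d0 hd] := ud x _ e10; have [d' d'0 hd'] := vd x _ e10.
  have [d'' d''0 hd''] := vd x _ ltr01.
  exists (Num.min d (Num.min d' d'')); first by rewrite !lt_min d0 d'0.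
  move=> h; rewrite !le_min => /and3P[h1 h2 h3] t.
  have vD : `|v (x + h) t| <= (D + 1) * weight n t.
    rewrite -(subrK (v x t) (v (x + h) t)) addrC (le_trans (ler_normD _ _))// mulrDl lerD//.
    exact: hd''.
  rewrite (le_trans (prod_diff_le _ _ _ _ _))//.
  have -> : e * weight (m + n) t = e1 * weight m t * ((D + 1) * weight n t) +
      C * weight m t * (e1 * weight n t).
    by rewrite -weightD /e1; field; rewrite gt_eqF.
  by rewrite lerD// ler_pM// ?hd// hd'.
Qed.

(** Exponents add under products. Both terms of the Leibniz rule fit into the next order, because
    [4 * m + n] and [m + 4 * n] are at most [4 * (m + n)]. *)
Lemma wCZ F F' (i : 'I_(\dim {: F})) j m n
    (u : nvect E -> R -> nvect F) (v : nvect E -> R -> nvect F') : 0 <= m -> 0 <= n ->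
  wC j m u -> wC j n v -> wC j (m + n) (fun x t => coord_of i (u x t) *: v x t).
Proof.
elim: j m n u v => [|j IH] m n u v m0 n0.
  by case=> uc _ [vc _]; split => //; exact: wcontZ.
move=> uC vC; have uC' := wC_le (leqnSn j) (lexx m) uC; have vC' := wC_le (leqnSn j) (lexx n) vC.
move: uC vC => [uc [u' ud Hu]] [vc [v' vd Hv]]; split; first exact: wcontZ.
have m40 : 0 <= 4 * m by rewrite mulr_ge0.
have n40 : 0 <= 4 * n by rewrite mulr_ge0.
have mn1 : 4 * m + n <= 4 * (m + n) by lra.
have mn2 : m + 4 * n <= 4 * (m + n) by lra.
exists (fun h x t => coord_of i (u' h x t) *: v x t + coord_of i (u x t) *: v' h x t); last first.
  move=> h; apply: wCD.
    by apply: (wC_le (leqnn _) mn1); apply: IH => //; exact: Hu.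
  by apply: (wC_le (leqnn _) mn2); apply: IH => //; exact: Hv.
have u'c h : wcont (4 * m) (u' h) by apply: wC_wcont (Hu h).
split.
  move=> x t a h k; rewrite ud.1 vd.1 (linearP (coord_of i)) /=.
  exact: product_linear.
move=> x e e0.
have [_ /(_ x)[C C0 HC] _] := uc; have [_ /(_ x)[D D0 HD] vcd] := vc.
have [C' C'0 HC'] := wdiff_bound x ud u'c.
have q0 : 0 < C + (D + 1) + C' by rewrite ltr_wpDr// ltr_wpDl// ltr_wpDl.
pose e1 := e / (C + (D + 1) + C'); have e10 : 0 < e1 by rewrite divr_gt0.
have [d d0 hd] := ud.2 x _ e10; have [d' d'0 hd'] := vd.2 x _ e10.
have [d1 d10 hd1] := vcd x _ ltr01; have [d2 d20 hd2] := vcd x _ e10.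
exists (Num.min (Num.min d d') (Num.min d1 d2)); first by rewrite !lt_min d0 d'0 d10.
move=> h; rewrite !le_min => /andP[/andP[h1 h2] /andP[h3 h4]] t.
have vD : `|v (x + h) t| <= (D + 1) * weight n t.
  rewrite -(subrK (v x t) (v (x + h) t)) addrC (le_trans (ler_normD _ _))// mulrDl lerD//.
  exact: hd1.
have -> : coord_of i (u (x + h) t) *: v (x + h) t - coord_of i (u x t) *: v x t -
    (coord_of i (u' h x t) *: v x t + coord_of i (u x t) *: v' h x t) =
    coord_of i (u (x + h) t - u x t - u' h x t) *: v (x + h) t +
    (coord_of i (u' h x t) *: (v (x + h) t - v x t) +
     coord_of i (u x t) *: (v (x + h) t - v x t - v' h x t)).
  rewrite (linearB (coord_of i) _ (u' h x t)) (linearB (coord_of i) (u (x + h) t)).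
  exact: product_increment.
have W1 : weight (4 * m) t * weight n t <= weight (4 * (m + n)) t by rewrite weightD weight_le.
have W2 : weight m t * weight (4 * n) t <= weight (4 * (m + n)) t by rewrite weightD weight_le.
have b1 : `|coord_of i (u (x + h) t - u x t - u' h x t) *: v (x + h) t| <=
    e1 * `|h| * (D + 1) * weight (4 * (m + n)) t.
  rewrite normrZ (@le_trans _ _ ((e1 * `|h| * weight (4 * m) t) * ((D + 1) * weight n t)))//.
    by rewrite ler_pM// (le_trans (coord_norm _ _))// hd.
  rewrite mulrACA ler_wpM2l// mulr_ge0 ?(mulr_ge0 (ltW e10))// addr_ge0//.
have b2 : `|coord_of i (u' h x t) *: (v (x + h) t - v x t)| <=
    e1 * `|h| * C' * weight (4 * (m + n)) t.
  rewrite normrZ (@le_trans _ _ ((C' * `|h| * weight (4 * m) t) * (e1 * weight n t)))//.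
    by rewrite ler_pM// ?hd2// (le_trans (coord_norm _ _)).
  rewrite mulrACA (_ : C' * `|h| * e1 = e1 * `|h| * C'); last by ring.
  by rewrite ler_wpM2l// mulr_ge0 ?(mulr_ge0 (ltW e10)).
have b3 : `|coord_of i (u x t) *: (v (x + h) t - v x t - v' h x t)| <=
    e1 * `|h| * C * weight (4 * (m + n)) t.
  rewrite normrZ (@le_trans _ _ ((C * weight m t) * (e1 * `|h| * weight (4 * n) t)))//.
    by rewrite ler_pM// ?hd'// (le_trans (coord_norm _ _)).
  rewrite mulrACA (_ : C * (e1 * `|h|) = e1 * `|h| * C); last by ring.
  by rewrite ler_wpM2l// mulr_ge0 ?(mulr_ge0 (ltW e10)).
rewrite (le_trans (ler_normD _ _))// (le_trans (lerD b1 (le_trans (ler_normD _ _) (lerD b2 b3))))//.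
rewrite -!mulrDl -!mulrDr ler_wpM2r ?weight_ge0//.
by rewrite le_eqVlt; apply/orP; left; apply/eqP; rewrite /e1; field; rewrite gt_eqF.
Qed.

(** The additive constant in [ucb] is absorbed because weights are at least 1, and the linear term
    by the continuity of [y]. *)
Lemma wcont_chain F F' m (g : nvect F -> nvect F') (y : nvect E -> R -> nvect F) : 0 <= m ->
  ucb g -> wcont m y -> wcont (2 * m) (fun x t => g (y x t)).
Proof.
move=> m0 gU [yc yb yd]; have m2 : m <= 2 * m by lra.
have [[M HM] Hu] := gU; split=> x.
- by move=> t; apply: (@continuous_comp _ _ _ (y x) g);
    [exact: yc|exact: ucb_continuous gU _].
- have M0 : 0 <= M by exact: le_trans (HM 0).
  exists M => // t; rewrite (le_trans (HM _))// ler_peMr// weight_ge1//; lra.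
move=> e e0; have [|N N0 HN] := Hu (e / 2); first by rewrite divr_gt0.
have N1 : 0 < N + 1 by rewrite ltr_wpDl.
have [|d d0 hd] := yd x (e / 2 / (N + 1)); first by rewrite !divr_gt0.
exists d => // h hh t; rewrite (le_trans (HN _ _))// [X in _ <= X * _]splitr mulrDl lerD//.
  by rewrite ler_peMr ?weight_ge1 ?divr_ge0 ?(ltW e0)//; lra.
rewrite (@le_trans _ _ ((N + 1) * (e / 2 / (N + 1) * weight m t)))//.
  by rewrite ler_pM// ?hd// lerDl.
rewrite (_ : (N + 1) * _ = e / 2 * weight m t); last by field; rewrite gt_eqF.
by rewrite ler_wpM2l ?weight_le// divr_ge0// ltW.
Qed.

(** Inserts an increment of size C a w into [Ub_taylor]. The quadratic term carries the squared
    weight [W], which is the loss of exponent under composition. *)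
Lemma taylor_weight (e M C a w W : R) : 0 <= e -> 0 <= C -> 0 <= a -> w * w = W -> w <= W ->
  (e + M * (C * a * w)) * (C * a * w) <= (e * C + M * C * C * a) * a * W.
Proof.
move=> e0 C0 a0 wW wW'; rewrite -subr_ge0.
rewrite (_ : _ - _ = e * C * a * (W - w)); last by rewrite -wW; ring.
by rewrite mulr_ge0 ?mulr_ge0// subr_ge0.
Qed.

Lemma weight_sq (m t : R) : weight (4 * m) t * weight (4 * m) t = weight (4 * (2 * m)) t.
Proof. by rewrite weightD (_ : 4 * m + 4 * m = 4 * (2 * m)); last by ring. Qed.

(** The derivative is expanded over the basis into products of a coordinate of [y'] with a partial
    derivative of [g] along [y]. The induction hypothesis applies to the latter, and [4 * m + 2 * m]
    stays below [4 * (2 * m)]. *)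
Lemma wC_chain F F' j m (g : nvect F -> nvect F') (y : nvect E -> R -> nvect F) : 0 <= m ->
  Ub j g -> wC j m y -> wC j (2 * m) (fun x t => g (y x t)).
Proof.
elim: j m g y => [|j IH] m g y m0 gU yC.
  by split => //; exact: wcont_chain m0 (Ub_ucb gU) (wC_wcont yC).
have gc := wcont_chain m0 (Ub_ucb gU) (wC_wcont yC).
have yC' := wC_le (leqnSn j) (lexx m) yC.
have [yc [y' yd Hy]] := yC.
have y'c h : wcont (4 * m) (y' h) by apply: wC_wcont (Hy h).
have [ucg [dg Hg]] := gU.
split => //; exists (fun h x t => 'd g (y x t) (y' h x t)); last first.
  move=> h.
  have -> : (fun x t => 'd g (y x t) (y' h x t)) =
    (fun x t => \sum_i coord_of i (y' h x t) *: 'd g (y x t) (base i)).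
    by apply/funext => x; apply/funext => t; exact: diff_coordE.
  apply: wC_sum => i.
  have mm : 4 * m + 2 * m <= 4 * (2 * m) by lra.
  apply: (wC_le (leqnn _) mm); apply: wCZ; [lra|lra|exact: Hy|].
  exact: IH _ _ _ m0 (Hg (base i)) yC'.
split.
  by move=> x t a h k; rewrite yd.1 linearP.
move=> x e e0.
have [B B0 HB] := Ub_diff_bounded gU.
have [C C0 [d d0 hd]] := wdiff_lipschitz x yd y'c.
pose e1 := e / (2 * (C + 1)); have C1 : 0 < 2 * (C + 1) by rewrite mulr_gt0// ltr_wpDl.
have e10 : 0 < e1 by rewrite divr_gt0.
have [M M0 HM] := Ub_taylor gU e10.
pose e2 := e / (4 * (B + 1)); have B1 : 0 < 4 * (B + 1) by rewrite mulr_gt0// ltr_wpDl.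
have e20 : 0 < e2 by rewrite divr_gt0.
have [d2 d20 hd2] := yd.2 x _ e20.
pose q := M * C * C; have q0 : 0 <= q by rewrite !mulr_ge0.
pose d3 := e / (4 * (q + 1)); have Q1 : 0 < 4 * (q + 1) by rewrite mulr_gt0// ltr_wpDl.
have d30 : 0 < d3 by rewrite divr_gt0.
exists (Num.min d (Num.min d2 d3)); first by rewrite !lt_min d0 d20.
move=> h; rewrite !le_min => /and3P[h1 h2 h3] t.
pose D := y (x + h) t - y x t.
have yE : y (x + h) t = y x t + D by rewrite /D [RHS]addrCA subrr addr0.
have -> : g (y (x + h) t) - g (y x t) - 'd g (y x t) (y' h x t) =
    (g (y x t + D) - g (y x t) - 'd g (y x t) D) + 'd g (y x t) (D - y' h x t).
  rewrite yE; move: D {yE} => D; rewrite (linearB ('d g (y x t)) D (y' h x t))/=.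
  by rewrite [RHS]addrA subrK.
have DC : `|D| <= C * `|h| * weight (4 * m) t by exact: hd.
have w41 : 1 <= weight (4 * m) t by rewrite weight_ge1// mulr_ge0.
have W : weight (4 * m) t * weight (4 * m) t = weight (4 * (2 * m)) t.
  exact: weight_sq.
have W' : weight (4 * m) t <= weight (4 * (2 * m)) t by rewrite weight_le//; lra.
have h0 := normr_ge0 h.
have t1 : `|g (y x t + D) - g (y x t) - 'd g (y x t) D| <=
    (e1 * C + q * `|h|) * `|h| * weight (4 * (2 * m)) t.
  rewrite (le_trans (HM _ _))//.
  apply: (@le_trans _ _ ((e1 + M * (C * `|h| * weight (4 * m) t)) * (C * `|h| * weight (4 * m) t))).
    have s0 : 0 <= e1 + M * `|D| by apply: addr_ge0; [exact: ltW|exact: mulr_ge0].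
    by apply: (ler_pM s0 (normr_ge0 D) _ DC); rewrite lerD2l; exact: ler_wpM2l.
  exact: (taylor_weight _ (ltW e10) C0 h0 W W').
have t2 : `|'d g (y x t) (D - y' h x t)| <= B * (e2 * `|h|) * weight (4 * (2 * m)) t.
  rewrite (le_trans (HB _ _))// -mulrA ler_wpM2l// (le_trans (hd2 h h2 t))//.
  by rewrite ler_wpM2l// mulr_ge0// ltW.
rewrite (le_trans (ler_normD _ _))// (le_trans (lerD t1 t2))// -mulrDl.
rewrite ler_wpM2r ?weight_ge0// mulrA -mulrDl ler_wpM2r//.
have k1 : e1 * C <= e / 2.
  rewrite /e1 mulrAC ler_pdivrMr//; nra.
have k2 : B * e2 <= e / 4.
  rewrite /e2 mulrA ler_pdivrMr//; nra.
have k3 : q * `|h| <= e / 4.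
  rewrite (@le_trans _ _ (q * d3))// ?ler_wpM2l// /d3 mulrA ler_pdivrMr//; nra.
by lra.
Qed.

(** At a fixed time a weight is only a constant factor, so the growth of the exponents has no effect
    on the final regularity. *)
Lemma wC_eval F j m (u : nvect E -> R -> nvect F) t : wC j m u -> Ck j (fun x => u x t).
Proof.
elim: j m u => [|j IH] m u.
  move=> [[uc ub ud] _] x; apply/eps_continuous => e e0.
  have e1 : 0 < e / weight m t by rewrite divr_gt0// weight_gt0.
  have [d d0 hd] := ud x _ e1; exists d => // y xy.
  have := hd (y - x) _ t; rewrite [x + _]addrC subrK distrC => /(_ xy).
  by rewrite divfK ?gt_eqF ?weight_gt0// distrC.
move=> [uc [u' ud Hu]].
have lin x : linear (fun h => u' h x t) by move=> a h k; exact: ud.1.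
have D x : differentiable (fun x => u x t) x /\ forall h, 'd (fun x => u x t) x h = u' h x t.
  pose A := GRing.isLinear.Build R (nvect E) (nvect F) _ _ (lin x).
  pose A' : {linear nvect E -> nvect F} := HB.pack (fun h => u' h x t) A.
  apply: (@diff_criterion _ _ _ _ A') => e e0.
  have e1 : 0 < e / weight (4 * m) t by rewrite divr_gt0// weight_gt0.
  have [d d0 hd] := ud.2 x _ e1; exists d => // h hh.
  rewrite (le_trans (hd h hh t))// mulrAC divfK// gt_eqF// weight_gt0//.
split; first by move=> x; case: (D x).
move=> v; have -> : (fun x => 'd (fun x => u x t) x v) = (fun x => u' v x t).
  by apply/funext => x; case: (D x).
exact: IH (Hu v).
Qed.

End Families.

(** * Fixed points and their derivatives *)

Section LinearForms.
Variables (R : realType) (E F : vectType R).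

(** The linear map with values [A i] on the basis. A linear map that varies with time and parameter
    thus becomes a finite list of curves, to which [wC] applies. *)
Definition lform (A : 'I_(\dim {: E}) -> nvect F) (z : nvect E) : nvect F :=
  \sum_i coord_of i z *: A i.

Lemma lform_linear A : linear (lform A).
Proof.
move=> a x y; rewrite /lform scaler_sumr -big_split/=; apply: eq_bigr => i _.
by rewrite linearP/= scalerDl scalerA.
Qed.

HB.instance Definition _ A := GRing.isLinear.Build R (nvect E) (nvect F) _ (lform A)
  (lform_linear A).

Lemma lformB A B z : lform A z - lform B z = lform (fun i => A i - B i) z.
Proof. by rewrite /lform -sumrB; apply: eq_bigr => i _; rewrite scalerBr. Qed.

Lemma lform_le A z (b : R) : (forall i, `|A i| <= b) ->
  `|lform A z| <= (\dim {: E})%:R * `|z| * b.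
Proof. exact: coord_sum_le. Qed.

Lemma lform_continuous (A : 'I_(\dim {: E}) -> R -> nvect F) (z : R -> nvect E) :
  (forall i, continuous (A i)) -> continuous z ->
  continuous (fun t => lform (fun i => A i t) (z t)).
Proof.
move=> Ac zc; apply: sum_curve_continuous => i t; apply: cvgZ; last exact: Ac.
by apply: (@continuous_comp _ _ _ z (coord_of i)); [exact: zc|exact: coord_of_continuous].
Qed.

Lemma common_radius (I : finType) (P : I -> nvect E -> Prop) :
  (forall i, exists2 d : R, 0 < d & forall h, `|h| <= d -> P i h) ->
  exists2 d : R, 0 < d & forall h, `|h| <= d -> forall i, P i h.
Proof.
move=> H; have H' i : exists d : R, 0 < d /\ forall h, `|h| <= d -> P i h.
  by have [d] := H i; exists d.
have [d Hd] := choice H'.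
have [e e0 ed] := @seq_gap R I (index_enum I) d predT (fun i _ _ => proj1 (Hd i)).
exists e => // h he i; apply: (Hd i).2; apply: (le_trans he).
by apply: ed => //; exact: mem_index_enum.
Qed.

End LinearForms.

Section FixedPoints.
Variables (R : realType) (E : vectType R) (L : 'End(E)) (m0 m1 K d : R).
Local Notation pc := (nlin (pi_c L)).
Local Notation bs := (bounded_solution L m1).
Hypothesis m00 : 0 < m0.
Hypothesis K0 : 0 < K.
Hypothesis d0 : 0 <= d.
Hypothesis Kd : K * d <= 2^-1.
Hypothesis est : forall g v m c, m0 <= m -> m <= m1 -> bs g v ->
  (forall t, `|g t| <= c * weight m t) ->
  forall t, `|v t| <= K * (c + `|pc (v 0)|) * weight m t.
Hypothesis exist : forall s g m c, m0 <= m -> m <= m1 -> continuous g ->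
  (forall t, `|g t| <= c * weight m t) -> pc s = s ->
  exists2 v, bs g v & pc (v 0) = s.

Lemma bs_comb (a : R) g h v w : bs g v -> bs h w ->
  bs (fun t => a *: g t + h t) (fun t => a *: v t + w t).
Proof.
move=> [vd [C vC]] [wd [D wD]]; split.
  move=> t; rewrite linearP (_ : _ + _ + _ = a *: (nlin L (v t) + g t) + (nlin L (w t) + h t)).
    by apply: is_deriveD.
  by rewrite scalerDr addrACA.
exists (`|a| * C + D) => t; rewrite (le_trans (ler_normD _ _))// mulrDl lerD//.
by rewrite normrZ -mulrA ler_wpM2l.
Qed.

Lemma bs_sub g h v w : bs g v -> bs h w ->
  bs (fun t => g t - h t) (fun t => v t - w t).
Proof.
move=> gv hw; have := bs_comb (-1) hw gv.
have -> : (fun t => -1 *: h t + g t) = (fun t => g t - h t).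
  by apply/funext => t; rewrite scaleN1r addrC.
have -> // : (fun t => -1 *: w t + v t) = (fun t => v t - w t).
by apply/funext => t; rewrite scaleN1r addrC.
Qed.

Lemma bs_continuous g v : bs g v -> continuous v.
Proof. by move=> [vd _] t; exact: is_derive_continuous (vd t). Qed.

Lemma bs_eq g h v : (forall t, g t = h t) -> bs g v -> bs h v.
Proof. by move=> /funext ->. Qed.

(* Inserting the bound (B + M / 2 ^ n) * weight m in [est] halves the excess over B. *)
Lemma fixpoint_estimate g v m c C : m0 <= m -> m <= m1 -> bs g v ->
  (forall t, `|g t| <= d * `|v t| + c * weight m t) ->
  (forall t, `|v t| <= C * weight m t) ->
  forall t, `|v t| <= 2 * K * (c + `|pc (v 0)|) * weight m t.
Proof.
move=> mm0 mm1 gv gc vC t.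
set B := 2 * K * _; pose M := `|C - B|.
have H n : forall t, `|v t| <= (B + M / 2 ^+ n) * weight m t.
  elim: n => [|n IH] s.
    rewrite expr0 divr1 (le_trans (vC s))// ler_wpM2r ?weight_ge0//.
    by rewrite addrC -lerBlDr ler_norm.
  set D := B + M / 2 ^+ n in IH.
  have D0 : 0 <= D by have := IH 0; rewrite weight0 mulr1; exact: le_trans.
  have gD r : `|g r| <= (d * D + c) * weight m r.
    by rewrite (le_trans (gc r))// mulrDl lerD2r -mulrA ler_wpM2l.
  rewrite (le_trans (est mm0 mm1 gv gD s))// ler_wpM2r ?weight_ge0//.
  have -> : B + M / 2 ^+ n.+1 = D / 2 + B / 2.
    have n2 : (2 ^+ n : R) != 0 by rewrite expf_neq0.
    by rewrite /D exprS; field.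
  rewrite (_ : K * _ = K * d * D + B / 2); last by rewrite /B; field.
  by rewrite lerD2r mulrC ler_wpM2l.
apply/ler_addgt0Pl => e e0.
have W0 := weight_gt0 m t.
have /(upper_nthrootP (x := M * weight m t / e)) h := leqnn (Num.Def.archi_bound (M * weight m t / e)).
apply: (le_trans (H (Num.Def.archi_bound (M * weight m t / e)) t)).
rewrite mulrDl addrC lerD2r mulrAC ler_pdivrMr ?exprn_gt0//.
by move: h; rewrite ltr_pdivrMr// [_ * e]mulrC => /ltW.
Qed.

(** Since [K * d <= 2^-1], solving the linear equation with forcing [H t (y t)] contracts by 1 / 2
    in each weight between [m0] and [m1]. [H] may depend on time in order to cover the variational
    equations. *)
Lemma fixpoint_exists (H : R -> nvect E -> nvect E) (s : nvect E) n c :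
  m0 <= n -> n <= m1 -> pc s = s ->
  (forall z : R -> nvect E, continuous z -> continuous (fun t => H t (z t))) ->
  (forall t z z', `|H t z - H t z'| <= d * `|z - z'|) ->
  (forall t, `|H t 0| <= c * weight n t) ->
  exists v : R -> nvect E, [/\ continuous v, exists C, forall t, `|v t| <= C * weight n t,
    bs (fun t => H t (v t)) v & pc (v 0) = s].
Proof.
move=> n0 n1 ps Hc Hd H0.
pose P (y : R -> nvect E) := continuous y /\ exists C, forall t, `|y t| <= C * weight n t.
pose T (y z : R -> nvect E) := bs (fun t => H t (y t)) z /\ pc (z 0) = s.
have [||||||v [vc vC] [vb vs]] := @contraction_fixpoint R E (weight n) P T (cst 0).
- by move=> t; exact: weight_ge0.
- split; first by move=> t; exact: cvg_cst.
  by exists 0 => t; rewrite mul0r normr0.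
- move=> y [yc [C yC]].
  have gb t : `|H t (y t)| <= (c + d * C) * weight n t.
    rewrite -(subrK (H t 0) (H t (y t))) addrC mulrDl (le_trans (ler_normD _ _))// lerD//.
    by rewrite (le_trans (Hd _ _ _))// subr0 -mulrA ler_wpM2l.
  have [z zb zs] := exist n0 n1 (Hc y yc) gb ps.
  exists z => //; split; first exact: bs_continuous zb.
  by exists (K * (c + d * C + `|pc (z 0)|)) => t; exact: (est n0 n1 zb gb).
- move=> y z [_ [C yC]] [_ [D zD]]; exists (C + D) => t.
  by rewrite mulrDl (le_trans (ler_normB _ _))// lerD.
- move=> y z y' z' C Py Pz [yb ys] [zb zs] yz t.
  have C0 : 0 <= C by have := yz 0; rewrite weight0 mulr1; exact: le_trans.
  have gb r : `|H r (y r) - H r (z r)| <= d * C * weight n r.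
    by rewrite (le_trans (Hd _ _ _))// -mulrA ler_wpM2l.
  have := est n0 n1 (bs_sub yb zb) gb t.
  rewrite linearB ys zs subrr normr0 addr0 => /le_trans; apply.
  by rewrite ler_wpM2r ?weight_ge0// mulrA mulrC ler_wpM2l.
- move=> y yP; split.
    apply: (@near_uniform_continuous _ _ _ (weight n)); first exact: weight_continuous.
    by move=> e /yP[z [zc _] yz]; exists z.
  have [z [_ [C zC]] yz] := yP 1 ltr01; exists (1 + C) => t.
  by rewrite mulrDl -[y t](subrK (z t)) (le_trans (ler_normD _ _))// lerD.
by exists v.
Qed.

Local Notation dim := (\dim {: E}).
Local Notation fam := (nvect E -> R -> nvect E).

Section LinearFamily.
Variables (a : 'I_dim -> fam) (h w : fam) (s : nvect E) (n : R).
Hypothesis n0 : m0 <= n.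
Hypothesis ad : forall x t z, `|lform (fun i => a i x t) z| <= d * `|z|.
Hypothesis wC_ : forall x, exists C, forall t, `|w x t| <= C * weight n t.
Hypothesis wb : forall x, bs (fun t => lform (fun i => a i x t) (w x t) + h x t) (w x).
Hypothesis ws : forall x, pc (w x 0) = s.

(** The difference of two solutions solves the same equation, forced by the increments of [a] and
    [h]. The increment of [a] multiplies [w], whence the exponent [2 * n]; [fixpoint_estimate]
    concludes. *)
Lemma linear_family_wcont : 2 * n <= m1 ->
  (forall i, wcont n (a i)) -> wcont n h -> wcont (2 * n) w.
Proof.
move=> n1 ac hc; have nn0 : 0 <= n := le_trans (ltW m00) n0.
have n2 : n <= 2 * n by lra.
split=> x; first exact: bs_continuous (wb x).
  have [C HC] := wC_ x; exists C.
    by have := HC 0; rewrite weight0 mulr1; exact: le_trans.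
  move=> t; rewrite (le_trans (HC t))// ler_wpM2l ?weight_le//.
  by have := HC 0; rewrite weight0 mulr1; exact: le_trans.
move=> e e0; have [C HC] := wC_ x.
have C0 : 0 <= C by have := HC 0; rewrite weight0 mulr1; exact: le_trans.
pose q := dim%:R * C + 1; have q0 : 0 < q by rewrite ltr_wpDl// mulr_ge0.
pose e1 := e / (2 * K * q).
have e10 : 0 < e1 by rewrite divr_gt0// !mulr_gt0.
have [d1 d10 hd1] : exists2 r : R, 0 < r & forall k, `|k| <= r -> forall i t,
    `|a i (x + k) t - a i x t| <= e1 * weight n t.
  by apply: common_radius => i; have [_ _ /(_ x e1 e10)[r r0 hr]] := ac i; exists r.
have [d2 d20 hd2] : exists2 r : R, 0 < r & forall k, `|k| <= r -> forall t,
    `|h (x + k) t - h x t| <= e1 * weight n t by have [_ _ ] := hc; exact.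
exists (Num.min d1 d2); first by rewrite lt_min d10.
move=> k; rewrite le_min => /andP[k1 k2].
have [C' HC'] := wC_ (x + k).
have DC t : `|w (x + k) t - w x t| <= (C' + C) * weight (2 * n) t.
  rewrite (le_trans (ler_normB _ _))// (le_trans (lerD (HC' t) (HC t)))// -mulrDl.
  rewrite ler_wpM2l ?weight_le// addr_ge0//.
  by have := HC' 0; rewrite weight0 mulr1; exact: le_trans.
have gb t : `|lform (fun i => a i (x + k) t) (w (x + k) t) + h (x + k) t -
    (lform (fun i => a i x t) (w x t) + h x t)| <=
    d * `|w (x + k) t - w x t| + (q * e1) * weight (2 * n) t.
  rewrite (_ : _ - _ = lform (fun i => a i (x + k) t) (w (x + k) t - w x t) +
     (lform (fun i => a i (x + k) t - a i x t) (w x t) + (h (x + k) t - h x t))).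
    rewrite (le_trans (ler_normD _ _))// lerD// (le_trans (ler_normD _ _))//.
    rewrite /q mulrDl mulrDl mul1r lerD//.
      apply: (le_trans (lform_le _ (hd1 k k1 ^~ t))).
      rewrite (_ : 2 * n = n + n) -?weightD; last by ring.
      rewrite [leRHS](_ : _ = dim%:R * (C * weight n t) * (e1 * weight n t)); last by ring.
      apply: ler_wpM2r; first by apply: mulr_ge0; [exact: ltW|exact: weight_ge0].
      exact: (ler_wpM2l (ler0n _ _) (HC t)).
    by rewrite (le_trans (hd2 k k2 t))// ler_wpM2l ?weight_le// ltW.
  by rewrite linearB/= -lformB opprD addrACA !addrA; congr (_ - _); congr (_ + _); rewrite subrK.
move=> t.
have := fixpoint_estimate (le_trans n0 n2) n1 (bs_sub (wb (x + k)) (wb x)) gb DC t.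
rewrite linearB !ws subrr normr0 addr0 => /le_trans; apply.
rewrite ler_wpM2r ?weight_ge0// le_eqVlt; apply/orP; left; apply/eqP.
by rewrite /e1; field; rewrite !gt_eqF.
Qed.

End LinearFamily.

(* Factors by which the exponent grows when the linear, resp. the nonlinear (see
   [mst]), equation is differentiated j times. *)
Fixpoint wlin (j : nat) : R := if j is j'.+1 then wlin j' * (wlin j' + 4) else 2.

Lemma wlin_ge2 j : 2 <= wlin j.
Proof. by elim: j => //= j IH; nra. Qed.

(** The parameter derivative solves an equation of the same kind with another forcing term. It is
    constructed as a fixed point of that equation, shown to be the derivative, and the induction
    hypothesis then gives its regularity. *)
Lemma linear_family_wC j (a : 'I_dim -> fam) (h w : fam) (s : nvect E) (n : R) :
  m0 <= n -> wlin j * n <= m1 ->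
  (forall x t z, `|lform (fun i => a i x t) z| <= d * `|z|) ->
  (forall x, exists C, forall t, `|w x t| <= C * weight n t) ->
  (forall x, bs (fun t => lform (fun i => a i x t) (w x t) + h x t) (w x)) ->
  (forall x, pc (w x 0) = s) ->
  (forall i, wC j n (a i)) -> wC j n h -> wC j (wlin j * n) w.
Proof.
elim: j a h w s n => [|j IH] a h w s n n0 n1 ad wB wb ws aC hC.
  split => //; apply: (linear_family_wcont n0 ad wB wb ws n1) => //.
    by move=> i; exact: wC_wcont (aC i).
  exact: wC_wcont hC.
have nn0 : 0 < n := lt_le_trans m00 n0.
have wl2 := wlin_ge2 j.
pose c := wlin j; pose n' := (c + 4) * n.
have nn' : n <= n' by rewrite /n' /c; nra.
have n'1 : wlin j * n' <= m1 by rewrite /n' mulrA.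
have n'm : n' <= m1 by apply: le_trans n'1; rewrite ler_peMl//; lra.
have cn1 : wlin j * n <= m1 by apply: le_trans n'1; rewrite ler_wpM2l//; lra.
have wCj : wC j (wlin j * n) w.
  apply: (IH a h w s n) => //.
    by move=> i; exact: wC_le (aC i).
  exact: wC_le hC.
have aD i : exists a' : nvect E -> fam, wdiff (4 * n) (a i) a' /\ forall k, wC j (4 * n) (a' k).
  by have [_ [a' h1 h2]] := aC i; exists a'.
have [a' Ha'] := choice aD.
have [_ [h' hd Hh']] := hC.
(* The forcing term of the equation differentiated in direction [k]. *)
pose hh (k : nvect E) : fam := fun x t => lform (fun i => a' i k x t) (w x t) + h' k x t.
have q1 : wlin j * n + 4 * n <= n' by rewrite -mulrDl; exact: lexx.
have q3 : n + 4 * n <= n'.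
  by apply: le_trans q1; rewrite lerD2r ler_peMl ?(ltW nn0)//; lra.
have q2 : 4 * n <= n' by lra.
have hhC k : wC j n' (hh k).
  apply: wCD; last exact: (wC_le (leqnn _) q2 (Hh' k)).
  apply: wC_sum => i; apply: (wC_le (leqnn _) q1); apply: wCZ => //.
  - by rewrite mulr_ge0//; lra.
  - by lra.
  - exact: (Ha' i).2.
have ex (p : nvect E * nvect E) : exists v : R -> nvect E,
    [/\ exists C, forall t, `|v t| <= C * weight n' t,
      bs (fun t => lform (fun i => a i p.2 t) (v t) + hh p.1 p.2 t) v & pc (v 0) = 0].
  case: p => k x /=.
  have [hhc /(_ x)[C C0 HC] _] := wC_wcont (hhC k).
  have [||||v [_ vC vb vs]] := @fixpoint_exists
     (fun t z => lform (fun i => a i x t) z + hh k x t) 0 n' C (le_trans n0 nn') n'm.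
  - by rewrite linear0.
  - move=> z zc t; apply: cvgD; last exact: hhc.
    by apply: (lform_continuous (A := fun i => a i x)) => // i; have [/(_ x)] := wC_wcont (aC i).
  - by move=> t z z'; rewrite opprD addrACA subrr addr0 -(linearB (lform (fun i => a i x t)) z z'); exact: ad.
  - by move=> t; rewrite linear0 add0r.
  by exists v.
have [u Hu] := choice ex.
pose w' (k : nvect E) : fam := fun x => u (k, x).
have w'B k x : exists C, forall t, `|w' k x t| <= C * weight n' t by have [] := Hu (k, x).
have w'b k x : bs (fun t => lform (fun i => a i x t) (w' k x t) + hh k x t) (w' k x).
  by have [] := Hu (k, x).
have w's k x : pc (w' k x 0) = 0 by have [] := Hu (k, x).
have cE : wlin j.+1 * n = wlin j * n' by rewrite /n' /= mulrA.
have wle : wlin j * n <= wlin j.+1 * n by rewrite cE ler_wpM2l//; lra.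
have w4 : wlin j.+1 * n <= 4 * (wlin j.+1 * n).
  have : 0 <= wlin j.+1 * n by rewrite mulr_ge0 ?(ltW nn0)//; have := wlin_ge2 j.+1; lra.
  lra.
have n'w : n' <= 4 * (wlin j.+1 * n).
  by apply: le_trans w4; rewrite cE ler_peMl//; lra.
split; first by apply: wcont_le (wC_wcont wCj).
exists w'; last first.
  move=> k; apply: (wC_le (leqnn _) w4); rewrite cE.
  apply: (IH a (hh k) (w' k) 0 n') => //; first exact: le_trans n0 nn'.
  by move=> i; exact: wC_le (aC i).
split.
  move=> x t b k l; apply/eqP; rewrite -subr_eq0 -normr_le0.
  (* Linearity in the direction follows from uniqueness: the defect solves the homogeneous equation
     with zero center part. *)
  pose D t := w' (b *: k + l) x t - (b *: w' k x t + w' l x t).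
  have Db : bs (fun t => lform (fun i => a i x t) (D t)) D.
    apply: bs_eq (bs_sub (w'b (b *: k + l) x) (bs_comb b (w'b k x) (w'b l x))) => r.
    have hhl : hh (b *: k + l) x r = b *: hh k x r + hh l x r.
      rewrite /hh hd.1 scalerDr addrACA; congr (_ + _).
      rewrite /lform scaler_sumr -big_split/=; apply: eq_bigr => i _.
      by rewrite (Ha' i).1.1 scalerDr !scalerA mulrC.
    rewrite hhl combine_cancel.
    by rewrite /D (linearB (lform (fun i => a i x r))) (linearP (lform (fun i => a i x r))).
  have [C HC] := w'B (b *: k + l) x; have [C1 HC1] := w'B k x; have [C2 HC2] := w'B l x.
  have DC r : `|D r| <= (C + (`|b| * C1 + C2)) * weight n' r.
    rewrite mulrDl (le_trans (ler_normB _ _))// lerD// mulrDl (le_trans (ler_normD _ _))// lerD//.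
    by rewrite normrZ -mulrA ler_wpM2l.
  have gb r : `|lform (fun i => a i x r) (D r)| <= d * `|D r| + 0 * weight n' r.
    by rewrite mul0r addr0.
  have := fixpoint_estimate (le_trans n0 nn') n'm Db gb DC t.
  rewrite (_ : pc (D 0) = 0); first by rewrite normr0 addr0 mulr0 mul0r.
  by rewrite /D linearB linearP/= !w's scaler0 addr0 subrr.
move=> x e e0.
have [C HC] := wB x.
have C0 : 0 <= C by have := HC 0; rewrite weight0 mulr1; exact: le_trans.
have a'c i k : wcont (4 * n) (a' i k) by apply: wC_wcont; exact: (Ha' i).2.
have [C4 C40 [d4 d40 hd4]] : exists2 C4 : R, 0 <= C4 & exists2 r : R, 0 < r &
    forall k, `|k| <= r -> forall i t, `|a i (x + k) t - a i x t| <= C4 * `|k| * weight (4 * n) t.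
  have H i : exists C4 : R, 0 <= C4 /\ exists2 r : R, 0 < r &
     forall k, `|k| <= r -> forall t, `|a i (x + k) t - a i x t| <= C4 * `|k| * weight (4 * n) t.
    by have [C4] := wdiff_lipschitz x (Ha' i).1 (a'c i); exists C4.
  have [C4 HC4] := choice H.
  exists (\sum_i C4 i); first by apply: sumr_ge0 => i _; have [] := HC4 i.
  have [r r0 hr] := @common_radius R E 'I_dim (fun i k => forall t,
    `|a i (x + k) t - a i x t| <= C4 i * `|k| * weight (4 * n) t) (fun i => proj2 (HC4 i)).
  exists r => // k kr i t; rewrite (le_trans (hr k kr i t))// -!mulrA ler_wpM2r ?mulr_ge0 ?weight_ge0//.
  by rewrite (bigD1 i)//= lerDl; apply: sumr_ge0 => l _; have [] := HC4 l.
pose q := dim%:R * C4 + dim%:R * C + 1.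
have qq1 : 0 <= dim%:R * C4 by rewrite mulr_ge0.
have qq2 : 0 <= dim%:R * C by rewrite mulr_ge0.
have q0 : 0 < q by rewrite /q; lra.
pose e1 := e / (2 * K * q).
have e10 : 0 < e1 by rewrite divr_gt0// !mulr_gt0.
have [d1 d10 hd1] : exists2 r : R, 0 < r & forall k, `|k| <= r -> forall i t,
    `|a i (x + k) t - a i x t - a' i k x t| <= e1 * `|k| * weight (4 * n) t.
  by apply: common_radius => i; have [r r0 hr] := (Ha' i).1.2 x e1 e10; exists r.
have [d2 d20 hd2] := hd.2 x e1 e10.
have [d3 d30 hd3] : exists2 r : R, 0 < r & forall k, `|k| <= r -> forall t,
    `|w (x + k) t - w x t| <= e1 * weight (wlin j * n) t.
  by have [_ _ H] := wC_wcont wCj; exact: H.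
exists (Num.min (Num.min d1 d2) (Num.min d3 d4)); first by rewrite !lt_min d10 d20 d30.
move=> k; rewrite !le_min => /andP[/andP[k1 k2] /andP[k3 k4]] t.
pose D t := w (x + k) t - w x t - w' k x t.
(* The remainder [D] solves the equation at [x] with forcing [f], which is o(|k|). In its first term
   the factor with [a] is O(|k|), so that mere continuity of [w] is enough for the other. *)
pose f t := lform (fun i => a i (x + k) t - a i x t) (w (x + k) t - w x t) +
  (lform (fun i => a i (x + k) t - a i x t - a' i k x t) (w x t) +
   (h (x + k) t - h x t - h' k x t)).
have Db : bs (fun t => lform (fun i => a i x t) (D t) + f t) D.
  apply: bs_eq (bs_sub (bs_sub (wb (x + k)) (wb x)) (w'b k x)) => r.
  rewrite /D /f /hh -!lformB !linearB/=.
  exact: bilinear_increment.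
have k0 := normr_ge0 k.
have fb r : `|f r| <= (q * e1 * `|k|) * weight n' r.
  have W1 : weight (wlin j * n) r * weight (4 * n) r <= weight n' r by rewrite weightD weight_le.
  have W2 : weight n r * weight (4 * n) r <= weight n' r.
    by rewrite weightD weight_le.
  have W3 : weight (4 * n) r <= weight n' r by rewrite weight_le.
  have f1 : `|lform (fun i => a i (x + k) r - a i x r) (w (x + k) r - w x r)| <=
      dim%:R * C4 * e1 * `|k| * weight n' r.
    apply: (le_trans (lform_le _ (hd4 k k4 ^~ r))).
    apply: (@le_trans _ _ (dim%:R * (e1 * weight (wlin j * n) r) * (C4 * `|k| * weight (4 * n) r))).
      by rewrite ler_wpM2r ?mulr_ge0 ?weight_ge0// ler_wpM2l// hd3.
    rewrite (_ : dim%:R * _ * _ = dim%:R * C4 * e1 * `|k| * (weight (wlin j * n) r * weight (4 * n) r)).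
      apply: ler_wpM2l => //; apply: mulr_ge0 => //.
      by apply: mulr_ge0 => //; exact: ltW.
    by ring.
  have f2 : `|lform (fun i => a i (x + k) r - a i x r - a' i k x r) (w x r)| <=
      dim%:R * C * e1 * `|k| * weight n' r.
    apply: (le_trans (lform_le _ (hd1 k k1 ^~ r))).
    apply: (@le_trans _ _ (dim%:R * (C * weight n r) * (e1 * `|k| * weight (4 * n) r))).
      apply: ler_wpM2r; first exact: (mulr_ge0 (mulr_ge0 (ltW e10) k0) (weight_ge0 _ _)).
      exact: (ler_wpM2l (ler0n _ _) (HC r)).
    rewrite (_ : dim%:R * _ * _ = dim%:R * C * e1 * `|k| * (weight n r * weight (4 * n) r)).
      apply: ler_wpM2l => //; apply: mulr_ge0 => //.
      by apply: mulr_ge0 => //; exact: ltW.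
    by ring.
  have f3 : `|h (x + k) r - h x r - h' k x r| <= e1 * `|k| * weight n' r.
    by rewrite (le_trans (hd2 k k2 r))// ler_wpM2l// mulr_ge0// ltW.
  rewrite /f (le_trans (ler_normD _ _))//.
  rewrite (le_trans (lerD f1 (le_trans (ler_normD _ _) (lerD f2 f3))))//.
  by rewrite le_eqVlt; apply/orP; left; apply/eqP; rewrite /q; ring.
have gb r : `|lform (fun i => a i x r) (D r) + f r| <= d * `|D r| + (q * e1 * `|k|) * weight n' r.
  by rewrite (le_trans (ler_normD _ _))// lerD.
have [C' HC'] := wB (x + k); have [C'' HC''] := w'B k x.
have DC r : `|D r| <= (C' + C + C'') * weight n' r.
  rewrite mulrDl (le_trans (ler_normB _ _))// lerD//.
  rewrite (le_trans (ler_normB _ _))// (le_trans (lerD (HC' r) (HC r)))// -mulrDl.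
  rewrite ler_wpM2l ?weight_le// addr_ge0//.
  by have := HC' 0; rewrite weight0 mulr1; exact: le_trans.
have := fixpoint_estimate (le_trans n0 nn') n'm Db gb DC t.
rewrite /D !linearB/= !ws w's subrr sub0r oppr0 normr0 addr0 => /le_trans; apply.
rewrite (_ : 2 * K * _ = e * `|k|); last by rewrite /e1; field; rewrite !gt_eqF.
by rewrite ler_wpM2l ?weight_le// mulr_ge0// ltW.
Qed.

End FixedPoints.

Lemma diff_lipschitz (R : realType) (E F : vectType R) (G : nvect E -> nvect F) (d : R) (x v : nvect E) :
  (forall a b, `|G a - G b| <= d * `|a - b|) -> differentiable G x ->
  `|'d G x v| <= d * `|v|.
Proof.
move=> GL Gd; have [->|v0] := eqVneq v 0; first by rewrite linear0 !normr0 mulr0.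
have nv0 : 0 < `|v| by rewrite normr_gt0.
apply/ler_addgt0Pr => e e0.
have [r r0 hr] := diff_estimate Gd (divr_gt0 e0 nv0).
pose s := r / `|v|; have s0 : 0 < s by rewrite divr_gt0.
have sv : `|s *: v| = r by rewrite normrZ gtr0_norm// divfK// gt_eqF.
have := hr (s *: v); rewrite sv lexx => /(_ isT) H.
have dE : 'd G x (s *: v) = (G (x + s *: v) - G x) - (G (x + s *: v) - G x - 'd G x (s *: v)).
  by rewrite opprB addrC subrK.
have : `|'d G x (s *: v)| <= (d + e / `|v|) * r.
  rewrite dE mulrDl (le_trans (ler_normB _ _))// lerD//.
  by rewrite (le_trans (GL _ _))// addrC addKr sv.
rewrite linearZ/= normrZ gtr0_norm// -sv normrZ gtr0_norm// mulrCA ler_pM2l//.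
by rewrite mulrDl divfK// gt_eqF.
Qed.

Section CenterFamily.
Variables (R : realType) (E : vectType R) (L : 'End(E)) (m0 m1 K d : R).
Local Notation pc := (nlin (pi_c L)).
Local Notation bs := (bounded_solution L m1).
Hypothesis m00 : 0 < m0.
Hypothesis K0 : 0 < K.
Hypothesis d0 : 0 <= d.
Hypothesis Kd : K * d <= 2^-1.
Hypothesis est : forall g v m c, m0 <= m -> m <= m1 -> bs g v ->
  (forall t, `|g t| <= c * weight m t) ->
  forall t, `|v t| <= K * (c + `|pc (v 0)|) * weight m t.
Hypothesis exist : forall s g m c, m0 <= m -> m <= m1 -> continuous g ->
  (forall t, `|g t| <= c * weight m t) -> pc s = s ->
  exists2 v, bs g v & pc (v 0) = s.

Variables (G : nvect E -> nvect E) (y : nvect E -> R -> nvect E).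
Hypothesis GL : forall a b, `|G a - G b| <= d * `|a - b|.
Hypothesis yC : forall x, exists C, forall t, `|y x t| <= C * weight m0 t.
Hypothesis yb : forall x, bs (fun t => G (y x t)) (y x).
Hypothesis ys : forall x, pc (y x 0) = pc x.

Lemma solution_unique v w : m0 <= m1 ->
  (exists C, forall t, `|v t| <= C * weight m0 t) -> (exists C, forall t, `|w t| <= C * weight m0 t) ->
  bs (fun t => G (v t)) v -> bs (fun t => G (w t)) w -> 
  forall t, `|v t - w t| <= 2 * K * `|pc (v 0) - pc (w 0)| * weight m0 t.
Proof.
move=> m01 [C vC] [D wD] vb wb t.
have DC r : `|v r - w r| <= (C + D) * weight m0 r.
  by rewrite mulrDl (le_trans (ler_normB _ _))// lerD.
have gb r : `|G (v r) - G (w r)| <= d * `|v r - w r| + 0 * weight m0 r.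
  by rewrite mul0r addr0.
have := fixpoint_estimate d0 Kd est (lexx m0) m01 (bs_sub vb wb) gb DC t.
by rewrite add0r linearB.
Qed.

Lemma family_lipschitz : m0 <= m1 -> exists2 C, 0 <= C &
  forall x h t, `|y (x + h) t - y x t| <= C * `|h| * weight m0 t.
Proof.
move=> m01; have [c c0 hc] := lin_bounded pc.
exists (2 * K * c) => [|x h t]; first by rewrite !mulr_ge0// ltW.
rewrite (le_trans (solution_unique m01 (yC _) (yC _) (yb _) (yb _) t))//.
rewrite ler_wpM2r ?weight_ge0// -(mulrA _ c) ler_wpM2l ?mulr_ge0// ?(ltW K0)//.
by rewrite !ys linearD addrC addKr.
Qed.

Lemma family_wcont : m0 <= m1 -> wcont m0 y.
Proof.
move=> m01; have [C C0 HC] := family_lipschitz m01; split=> x.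
- exact: bs_continuous (yb x).
- have [D HD] := yC x; exists D => //.
  by have := HD 0; rewrite weight0 mulr1; exact: le_trans.
move=> e e0; have C1 : 0 < C + 1 by rewrite ltr_wpDl.
exists (e / (C + 1)) => [|h]; first by rewrite divr_gt0.
rewrite ler_pdivlMr// => he t; rewrite (le_trans (HC _ _ _))// ler_wpM2r ?weight_ge0//.
by rewrite (le_trans _ he)// mulrC ler_wpM2l// lerDl.
Qed.

Fixpoint mst (j : nat) : R := if j is j'.+1 then wlin R j' * (2 * mst j') else 1.

Lemma mst_ge1 j : 1 <= mst j.
Proof.
elim: j => //= j IH; have := wlin_ge2 R j => W.
rewrite (@le_trans _ _ (2 * (2 * mst j)))//; first lra.
by rewrite ler_wpM2r//; lra.
Qed.

Lemma mst_step j : 2 * mst j <= mst j.+1 /\ mst j <= mst j.+1.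
Proof.
have := mst_ge1 j; have := wlin_ge2 R j => W M.
suff : 2 * mst j <= mst j.+1 by move=> H; split=> //; lra.
by rewrite /= ler_peMl//; lra.
Qed.

Lemma mst_facts j : mst j.+1 * m0 <= m1 -> 
  [/\ m0 <= m1, 2 * m0 <= 2 * (mst j * m0), m0 <= 2 * (mst j * m0),
     mst j * m0 <= mst j.+1 * m0 & 2 * (mst j * m0) <= mst j.+1 * m0] /\ 0 < mst j.+1 * m0.
Proof.
have [s2 _] := mst_step j; have M1 := mst_ge1 j.
have : m0 <= mst j * m0 by rewrite ler_peMl// ltW.
have : 2 * (mst j * m0) <= mst j.+1 * m0 by rewrite mulrA ler_wpM2r// ltW.
by move: (mst j * m0) (mst j.+1 * m0) m00 => a b h0 h1 h2 h3; split; [split|]; lra.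
Qed.

(** The derivative is the solution of the variational equation along [y x]. By induction the
    coefficients of that equation have class [j], so [linear_family_wC] gives one more derivative of
    [y]. *)
Lemma family_wC j : Ub j G -> mst j * m0 <= m1 -> wC j (mst j * m0) y.
Proof.
elim: j => [|j IH] GU.
  by rewrite /= mul1r => m01; split => //; exact: family_wcont.
set n' := mst j.+1 * m0 => n1.
pose n := 2 * (mst j * m0).
have [[m01 m0n m0n' jn' nn'] n'0] := mst_facts n1.
rewrite -/n in m0n m0n' nn'; rewrite -/n' in jn' nn' n'0.
have nm1 : n <= m1 := le_trans nn' n1.
have j0 : 0 <= mst j * m0 by rewrite mulr_ge0 ?(ltW m00)// (le_trans ler01)// mst_ge1.
have n'4 : n' <= 4 * n' by rewrite ler_peMl ?(ltW n'0)//; lra.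
have yj := IH (UbW (leqnSn j) GU) (le_trans jn' n1).
have [_ [Gd HG]] := GU.
(* The coefficients of the variational equation. [wC_chain] doubles the exponent of [y], which
   explains [n]. *)
pose a i : nvect E -> R -> nvect E := fun x t => 'd G (y x t) (base i).
have aC i : wC j n (a i) by apply: wC_chain j0 (HG _) yj.
have aE x t z : lform (fun i => a i x t) z = 'd G (y x t) z by rewrite [RHS]diff_coordE.
have ad x t z : `|lform (fun i => a i x t) z| <= d * `|z|.
  by rewrite aE; exact: diff_lipschitz GL (Gd _).
have ex (p : nvect E * nvect E) : exists v : R -> nvect E,
    [/\ exists C, forall t, `|v t| <= C * weight n t,
      bs (fun t => lform (fun i => a i p.2 t) (v t)) v & pc (v 0) = pc p.1].
  case: p => h x /=.
  have [||||v [_ vC vb vs]] := @fixpoint_exists _ _ _ _ _ _ _ d0 Kd est exist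
     (fun t z => lform (fun i => a i x t) z) (pc h) n 0 m0n' nm1.
  - exact: pcc.
  - move=> z zc; apply: (lform_continuous (A := fun i => a i x)) => // i.
    by have [/(_ x)] := wC_wcont (aC i).
  - by move=> t z z'; rewrite -(linearB (lform (fun i => a i x t)) z z'); exact: ad.
  - by move=> t; rewrite linear0 normr0 mul0r.
  by exists v.
have [u Hu] := choice ex.
pose w (h : nvect E) : nvect E -> R -> nvect E := fun x => u (h, x).
have wC_ h x : exists C, forall t, `|w h x t| <= C * weight n t by have [] := Hu (h, x).
have wb h x : bs (fun t => lform (fun i => a i x t) (w h x t)) (w h x) by have [] := Hu (h, x).
have ws h x : pc (w h x 0) = pc h by have [] := Hu (h, x).
split; first exact: wcont_le jn' (wC_wcont yj).
exists w; last first.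
  move=> h; apply: (wC_le (leqnn _) n'4).
  have -> : n' = wlin R j * n by rewrite /n' /n /= !mulrA.
  apply: (linear_family_wC m00 K0 d0 Kd est exist (a := a) (h := fun _ _ => 0) (s := pc h)) => //.
  - by apply: le_trans n1; rewrite /n' /n /= !mulrA.
  - by move=> x; apply: bs_eq (wb h x) => t; rewrite addr0.
  - exact: wC0.
split.
  move=> x t b h k; apply/eqP; rewrite -subr_eq0 -normr_le0.
  pose D t := w (b *: h + k) x t - (b *: w h x t + w k x t).
  have Db : bs (fun t => lform (fun i => a i x t) (D t)) D.
    apply: bs_eq (bs_sub (wb (b *: h + k) x) (bs_comb b (wb h x) (wb k x))) => r.
    by rewrite /D (linearB (lform (fun i => a i x r))) (linearP (lform (fun i => a i x r))).
  have [C HC] := wC_ (b *: h + k) x; have [C1 HC1] := wC_ h x; have [C2 HC2] := wC_ k x.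
  have DC r : `|D r| <= (C + (`|b| * C1 + C2)) * weight n r.
    rewrite mulrDl (le_trans (ler_normB _ _))// lerD// mulrDl (le_trans (ler_normD _ _))// lerD//.
    by rewrite normrZ -mulrA ler_wpM2l.
  have gb r : `|lform (fun i => a i x r) (D r)| <= d * `|D r| + 0 * weight n r.
    by rewrite mul0r addr0.
  have := fixpoint_estimate d0 Kd est m0n' nm1 Db gb DC t.
  rewrite (_ : pc (D 0) = 0); first by rewrite normr0 addr0 mulr0 mul0r.
  by rewrite /D linearB linearP/= !ws linearP subrr.
move=> x e e0.
have [C C0 HC] := family_lipschitz m01.
pose e1 := e / (4 * K * (C + 1)); have C1 : 0 < 4 * K * (C + 1) by rewrite !mulr_gt0// ltr_wpDl.
have e10 : 0 < e1 by rewrite divr_gt0.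
have [M M0 HM] := Ub_taylor GU e10.
pose q := M * C * C; have q0 : 0 <= q by rewrite !mulr_ge0.
pose r := e / (4 * K * (q + 1)); have q1 : 0 < 4 * K * (q + 1) by rewrite !mulr_gt0// ltr_wpDl.
have r0 : 0 < r by rewrite divr_gt0.
exists r => // h hr t.
pose D t := y (x + h) t - y x t - w h x t.
(* The Taylor remainder of [G] between the two curves. Since [y] is Lipschitz in the weight [m0], it
   is o(|h|) in the weight [2 * m0], hence in the weight [n]. *)
pose f t := G (y (x + h) t) - G (y x t) - 'd G (y x t) (y (x + h) t - y x t).
have Db : bs (fun t => lform (fun i => a i x t) (D t) + f t) D.
  apply: bs_eq (bs_sub (bs_sub (yb (x + h)) (yb x)) (wb h x)) => s.
  rewrite /f -aE /D !linearB/=.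
  by vring.
have h0 := normr_ge0 h.
have fb s : `|f s| <= (e1 * C + q * `|h|) * `|h| * weight n s.
  have yE : y (x + h) s = y x s + (y (x + h) s - y x s) by rewrite [RHS]addrCA subrr addr0.
  rewrite /f {1}yE (le_trans (HM _ _))//.
  have D1 := HC x h s; set D1s := `|y (x + h) s - y x s| in D1 *.
  have s0 : 0 <= e1 + M * D1s by apply: addr_ge0; [exact: ltW|exact: (mulr_ge0 M0 (normr_ge0 _))].
  apply: (@le_trans _ _ ((e1 + M * (C * `|h| * weight m0 s)) * (C * `|h| * weight m0 s))).
    by apply: (ler_pM s0 (normr_ge0 _) _ D1); rewrite lerD2l; exact: ler_wpM2l.
  have w2 : weight m0 s * weight m0 s = weight (2 * m0) s.
    by rewrite weightD (_ : m0 + m0 = 2 * m0)//; ring.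
  have w3 : weight m0 s <= weight (2 * m0) s by rewrite weight_le// ler_peMl ?ler1n ?(ltW m00).
  apply: (le_trans (taylor_weight M (ltW e10) C0 h0 w2 w3)).
  apply: ler_wpM2l; last by rewrite weight_le.
  by rewrite mulr_ge0// addr_ge0// mulr_ge0// ltW.
have gb s : `|lform (fun i => a i x s) (D s) + f s| <=
    d * `|D s| + (e1 * C + q * `|h|) * `|h| * weight n s.
  by rewrite (le_trans (ler_normD _ _))// lerD.
have [D1 HD1] := yC (x + h); have [D2 HD2] := yC x; have [D3 HD3] := wC_ h x.
have DC s : `|D s| <= (D1 + D2 + D3) * weight n s.
  rewrite mulrDl (le_trans (ler_normB _ _))// lerD//.
  rewrite (le_trans (ler_normB _ _))// (le_trans (lerD (HD1 s) (HD2 s)))// -mulrDl.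
  rewrite ler_wpM2l ?weight_le// addr_ge0//.
    by have := HD1 0; rewrite weight0 mulr1; exact: le_trans.
  by have := HD2 0; rewrite weight0 mulr1; exact: le_trans.
have := fixpoint_estimate d0 Kd est m0n' nm1 Db gb DC t.
have -> : pc (D 0) = 0.
  rewrite /D linearB/= linearB/= !ys ws linearD.
  by rewrite [X in X - _](_ : _ = pc h) ?subrr// addrC addKr.
rewrite normr0 addr0 => /le_trans; apply.
have nn4 : n <= 4 * n' := le_trans nn' n'4.
apply: ler_pM => //.
  by rewrite !mulr_ge0 ?(ltW K0)// addr_ge0// mulr_ge0// ltW.
  exact: weight_ge0.
  rewrite mulrA; apply: ler_wpM2r => //; rewrite mulrDr.
  have k1 : 2 * K * (e1 * C) <= e / 2.
    rewrite (_ : 2 * K * (e1 * C) = e / 2 * (C / (C + 1))).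
      by rewrite ler_piMr ?divr_ge0 ?(ltW e0)// ler_pdivrMr ?mul1r ?ltr_wpDl// lerDl.
    by rewrite /e1; field; rewrite !gt_eqF// ltr_wpDl.
  have k2 : 2 * K * (q * `|h|) <= e / 2.
    rewrite (@le_trans _ _ (2 * K * (q * r)))//.
      by apply: ler_wpM2l; [rewrite mulr_ge0// ltW|exact: ler_wpM2l].
    rewrite (_ : 2 * K * (q * r) = e / 2 * (q / (q + 1))).
      by rewrite ler_piMr ?divr_ge0 ?(ltW e0)// ler_pdivrMr ?mul1r ?ltr_wpDl// lerDl.
    by rewrite /r; field; rewrite !gt_eqF// ltr_wpDl.
  by rewrite [leRHS]splitr lerD.
exact: weight_le.
Qed.

End CenterFamily.

(** * Maps of class C^k *)

Section Smooth.
Variable R : realType.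

Section Def.
Variables V W : normedModType R.

(* [Ck] for maps between arbitrary normed spaces. *)
Fixpoint Cn (k : nat) (f : V -> W) : Prop :=
  if k is k'.+1 then (forall x, differentiable f x) /\ (forall v, Cn k' (fun x => 'd f x v))
  else continuous f.
End Def.

Lemma CkE (E F : vectType R) k (f : nvect E -> nvect F) : Ck k f <-> Cn k f.
Proof. by elim: k f => //= k IH f; split=> -[fd fC]; split=> // v; apply/IH. Qed.

Implicit Types V W X : normedModType R.

Lemma Cn_continuous V W k (f : V -> W) : Cn k f -> continuous f.
Proof. by case: k => //= k [fd _] x; exact: differentiable_continuous. Qed.

Lemma CnW V W k (f : V -> W) : Cn k.+1 f -> Cn k f.
Proof.
elim: k f => [|k IH] f; first exact: Cn_continuous.
by move=> [fd fC]; split=> // v; exact: IH (fC v).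
Qed.

Lemma Cn_cst V W k (a : W) : Cn k (fun _ : V => a).
Proof.
elim: k a => [|k IH] a; first by move=> x; exact: cst_continuous.
split=> [x|v]; first exact: differentiable_cst.
have -> : (fun x => 'd (fun _ : V => a) x v) = (fun _ => 0); last exact: IH.
by apply/funext => x; rewrite -/(cst a) diff_cst.
Qed.

Lemma CnD V W k (f g : V -> W) : Cn k f -> Cn k g -> Cn k (fun x => f x + g x).
Proof.
elim: k f g => [|k IH] f g.
  by move=> fc gc x; apply: cvgD; [exact: fc|exact: gc].
move=> [fd fC] [gd gC]; split=> [x|v]; first exact: differentiableD.
have -> : (fun x => 'd (fun x => f x + g x) x v) = (fun x => 'd f x v + 'd g x v).
  by apply/funext => x; rewrite -[(fun x => f x + g x)]/(f + g) diffD.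
exact: (IH _ _ (fC v) (gC v)).
Qed.

Lemma Cn_sum V W k (I : Type) (r : seq I) (f : I -> V -> W) : (forall i, Cn k (f i)) ->
  Cn k (fun x => \sum_(i <- r) f i x).
Proof.
move=> fC; elim: r => [|i r IH].
  rewrite (_ : (fun _ => _) = (fun _ => 0)); first exact: Cn_cst.
  by apply/funext => x; rewrite big_nil.
rewrite (_ : (fun _ => _) = (fun x => f i x + \sum_(i <- r) f i x)); first exact: CnD.
by apply/funext => x; rewrite big_cons.
Qed.

Lemma diff_post V W X (A : {linear W -> X}) (f : V -> W) x : continuous A -> differentiable f x ->
  differentiable (fun x => A (f x)) x /\ forall v, 'd (fun x => A (f x)) x v = A ('d f x v).
Proof.
move=> Ac fd; have Ad : differentiable A (f x) by exact: linear_differentiable.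
split; first exact: (differentiable_comp fd Ad).
move=> v; have -> : (fun x => A (f x)) = A \o f by [].
by rewrite (diff_comp fd Ad)/= diff_lin.
Qed.

Lemma Cn_post V W X k (A : {linear W -> X}) (f : V -> W) : continuous A -> Cn k f ->
  Cn k (fun x => A (f x)).
Proof.
move=> Ac; elim: k f => [|k IH] f.
  by move=> fc x; apply: (continuous_comp (fc x)); exact: Ac.
move=> [fd fC]; split=> [x|v]; first exact: (diff_post Ac (fd x)).1.
rewrite (_ : (fun _ => _) = (fun x => A ('d f x v))); first exact: (IH _ (fC v)).
by apply/funext => x; exact: (diff_post Ac (fd x)).2.
Qed.

Lemma diff_pre V W X (A : {linear V -> W}) (c : W) (f : W -> X) x : continuous A ->
  differentiable f (A x + c) -> differentiable (fun x => f (A x + c)) x /\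
  forall v, 'd (fun x => f (A x + c)) x v = 'd f (A x + c) (A v).
Proof.
move=> Ac fd; have Ad : differentiable A x by exact: linear_differentiable.
have cd := differentiable_cst c x.
have sd : differentiable ((A : V -> W) + cst c) x by exact: differentiableD.
have -> : (fun x => f (A x + c)) = f \o ((A : V -> W) + cst c) by [].
split; first exact: (differentiable_comp sd).
by move=> v; rewrite (diff_comp sd)//= diffD// diff_cst diff_lin//= addr0.
Qed.

Lemma Cn_pre V W X k (A : {linear V -> W}) (c : W) (f : W -> X) : continuous A -> Cn k f ->
  Cn k (fun x => f (A x + c)).
Proof.
move=> Ac; elim: k f => [|k IH] f.
  move=> fc x; apply: (@continuous_comp _ _ _ (fun x => A x + c) f); last exact: fc.
  by apply: cvgD; [exact: Ac|exact: cvg_cst].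
move=> [fd fC]; split=> [x|v]; first exact: (diff_pre Ac (fd _)).1.
rewrite (_ : (fun _ => _) = (fun x => 'd f (A x + c) (A v))); first exact: (IH (fun y => 'd f y (A v)) (fC (A v))).
by apply/funext => x; exact: (diff_pre Ac (fd _)).2.
Qed.

Lemma Cn_lin V W k (A : {linear V -> W}) : continuous A -> Cn k A.
Proof.
move=> Ac; case: k => [//|k]; split=> [x|v]; first exact: linear_differentiable.
rewrite (_ : (fun _ => _) = (fun _ => A v)); first exact: Cn_cst.
by apply/funext => x; rewrite diff_lin.
Qed.

(** A name for scalar multiplication, to which a bilinear structure can be attached so that the
    differentiation rule for bilinear maps applies. *)
Definition scale_fun W (a : R) (w : W) : W := a *: w.

Lemma scale_fun_bilinear W :
  bilinear_for (GRing.Scale.Law.clone _ _ *:%R _) (GRing.Scale.Law.clone _ _ *:%R _)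
    (@scale_fun W).
Proof.
split=> [u'|u] a x y; rewrite /scale_fun/=.
- by rewrite scalerDl scalerA.
- by rewrite scalerDr !scalerA mulrC.
Qed.

HB.instance Definition _ W := bilinear_isBilinear.Build R R W W _ _ (@scale_fun W)
  (@scale_fun_bilinear W).

Lemma diff_scale V W (c : V -> R) (u : V -> W) x : differentiable c x -> differentiable u x ->
  differentiable (fun x => c x *: u x) x /\
  forall v, 'd (fun x => c x *: u x) x v = 'd c x v *: u x + c x *: 'd u x v.
Proof.
move=> cd ud.
have sc : continuous (fun p : R * W => scale_fun p.1 p.2) by move=> p; exact: scale_continuous.
have pd := differentiable_pair cd ud.
have bd : differentiable (fun p : R * W => scale_fun p.1 p.2) (c x, u x).
  exact: differentiable_bilin.
have -> : (fun x => c x *: u x) = (fun p : R * W => scale_fun p.1 p.2) \o (fun x => (c x, u x)) by [].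
split; first exact: (differentiable_comp pd bd).
by move=> v; rewrite (diff_comp pd bd)/= diff_bilin// diff_pair//= addrC.
Qed.

Lemma CnZ V W k (c : V -> R) (u : V -> W) : Cn k c -> Cn k u -> Cn k (fun x => c x *: u x).
Proof.
elim: k c u => [|k IH] c u.
  by move=> cc uc x; apply: cvgZ; [exact: cc|exact: uc].
move=> cC uC; have cC' := CnW cC; have uC' := CnW uC.
move: cC uC => [cd cC] [ud uC]; split=> [x|v]; first exact: (diff_scale (cd x) (ud x)).1.
rewrite (_ : (fun _ => _) = (fun x => 'd c x v *: u x + c x *: 'd u x v)).
  by apply: CnD; [exact: (IH _ _ (cC v) uC')|exact: (IH _ _ cC' (uC v))].
by apply/funext => x; exact: (diff_scale (cd x) (ud x)).2.
Qed.

(* W need only have a finite system of coordinates, so that this covers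
   both W = R and W = nvect F. *)
Lemma Cn_comp V W X (I : finType) (c : I -> {linear W -> R}) (b : I -> W) k (f : V -> W) (g : W -> X) :
  (forall i, continuous (c i)) -> (forall w, w = \sum_i c i w *: b i) ->
  Cn k f -> Cn k g -> Cn k (fun x => g (f x)).
Proof.
move=> cc wE; elim: k g => [|k IH] g.
  by move=> fc gc x; apply: (continuous_comp (fc x)); exact: gc.
move=> fC; have fC' := CnW fC; move: fC => [fd fC] [gd gC]; split=> [x|v].
  exact: (differentiable_comp (fd x)).
rewrite (_ : (fun _ => _) = (fun x => \sum_i c i ('d f x v) *: 'd g (f x) (b i))).
  apply: Cn_sum => i; apply: CnZ; first exact: (Cn_post (cc i) (fC v)).
  exact: (IH (fun y => 'd g y (b i)) fC' (gC _)).
apply/funext => x; rewrite -[(fun x => g (f x))]/(g \o f) (diff_comp (fd x))//=.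
by rewrite {1}(wE ('d f x v)) linear_sum; apply: eq_bigr => i _; rewrite linearZ.
Qed.

Lemma Cn_comp_vect V X (F : vectType R) k (f : V -> nvect F) (g : nvect F -> X) :
  Cn k f -> Cn k g -> Cn k (fun x => g (f x)).
Proof.
apply: (@Cn_comp V (nvect F) X _ (fun i => coord_of i) (fun i => base i)).
  by move=> i; exact: coord_of_continuous.
exact: coord_baseE.
Qed.

Lemma Cn_comp_real V X k (f : V -> R) (g : R -> X) :
  Cn k f -> Cn k g -> Cn k (fun x => g (f x)).
Proof.
apply: (@Cn_comp V R X unit (fun _ => idfun) (fun _ => 1)).
  by move=> _ x; exact: cvg_id.
by move=> w; rewrite (big_pred1 tt) => [|[]//]; exact: (esym (mulr1 w)).
Qed.

End Smooth.

(** * The global center manifold of a small perturbation of a linear field *)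

Lemma lipschitz_flow (R : realType) (E : vectType R) (F : nvect E -> nvect E) (l : R) : 0 <= l ->
  (forall a b, `|F a - F b| <= l * `|a - b|) -> exists phi, is_flow F phi.
Proof.
move=> l0 FL; have H x : exists u : R -> nvect E, u 0 = x /\
    forall t : R, is_derive t (1 : R) u (F (u t)).
  by have [u u0 ud] := lipschitz_ode x l0 FL; exists u.
have [u Hu] := choice H.
by exists (fun t x => u x t); split=> x; case: (Hu x).
Qed.

Lemma diff_lin_add (R : realType) (V W : normedModType R) (A : {linear V -> W}) (g : V -> W) x :
  continuous A -> differentiable g x ->
  differentiable (fun z => A z + g z) x /\ forall v, 'd (fun z => A z + g z) x v = A v + 'd g x v.
Proof.
move=> Ac gd; have Ad : differentiable A x by exact: linear_differentiable.
rewrite -[(fun z => A z + g z)]/((A : V -> W) + g); split; first exact: differentiableD.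
move=> v; rewrite (diffD Ad gd); congr (_ + _).
by have /(congr1 (fun h => h v)) := diff_lin x Ac.
Qed.

Lemma lin_sub0 (R : realType) (V W : lmodType R) (A : {linear V -> W}) a b :
  A b = 0 -> A a = A (a - b).
Proof. by move=> A0; rewrite linearB A0 subr0. Qed.

Lemma pi_c_id (R : realType) (E : vectType R) (L : 'End(E)) (x : E) :
  x \in center_space L -> pi_c L x = x.
Proof.
move=> xc; rewrite /pi_c daddv_pi_id//.
by apply: spectral_capv.
Qed.

Definition nval (R : realType) (E : vectType R) (U : {vspace E}) :
  {linear nvect (subvs_of U) -> nvect E} := (@vsval _ _ U : {linear subvs_of U -> E}).

Definition nproj (R : realType) (E : vectType R) (U : {vspace E}) :
  {linear nvect E -> nvect (subvs_of U)} := (vsproj U : {linear E -> subvs_of U}).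

Lemma nprojK (R : realType) (E : vectType R) (U : {vspace E}) (x : E) :
  x \in U -> nval U (nproj U x) = x.
Proof. by move=> xU; rewrite -[RHS](vsprojK xU). Qed.

Lemma nlin_ch (R : realType) (E : vectType R) (L : 'End(E)) (x : nvect E) :
  x = nlin (pi_c L) x + nlin (pi_h L) x.
Proof. exact (pi_ch L x). Qed.

Lemma little_o_diff0 (R : realType) (E : vectType R) (U U' : {vspace E}) (g : nvect E -> nvect E) :
  g 0 = 0 -> (forall e : R, 0 < e -> exists2 r : R, 0 < r & forall x, `|x| <= r -> `|g x| <= e * `|x|) ->
  forall v, 'd (fun v => nproj U' (g (nval U v))) 0 v = 0.
Proof.
move=> g0 Hg; set psi := fun v => _.
suff [_ H] : differentiable psi 0 /\ forall h, 'd psi 0 h = (\0 : {linear _ -> _}) h.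
  by move=> v; rewrite H.
apply: diff_criterion => e e0.
have [p p0 hp] := lin_bounded (nproj U').
have [q q0 hq] := lin_bounded (nval U).
have [r r0 hr] := Hg _ (divr_gt0 e0 (mulr_gt0 p0 q0)).
exists (r / q) => [|h]; first by rewrite divr_gt0.
rewrite ler_pdivlMr// mulrC => hh.
have -> : psi (0 + h) - psi 0 - \0 h = nproj U' (g (nval U h)).
  by rewrite /psi subr0 add0r linear0 g0 linear0 subr0.
rewrite (le_trans (hp _))// (le_trans (ler_wpM2l (ltW p0) (hr _ (le_trans (hq h) hh))))//.
have -> : e * `|h| = p * (e / (p * q) * (q * `|h|)) by field; rewrite !gt_eqF.
apply: ler_wpM2l; first exact: ltW.
by apply: ler_wpM2l => //; rewrite divr_ge0 ?(ltW e0)// mulr_ge0// ltW.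
Qed.

Section Perturbation.
Variables (R : realType) (E : vectType R) (L : 'End(E)) (x0 : nvect E) (G : nvect E -> nvect E).

Definition perturbation (x : nvect E) : nvect E := nlin L (x - x0) + G (x - x0).

Lemma perturbation_lipschitz d : (forall a b, `|G a - G b| <= d * `|a - b|) ->
  exists2 l, 0 < l & forall a b, `|perturbation a - perturbation b| <= (l + d) * `|a - b|.
Proof.
move=> GL; have [c c0 hc] := lin_bounded (nlin L); exists c => // a b.
rewrite /perturbation opprD addrACA mulrDl (le_trans (ler_normD _ _))//.
have abE : a - x0 - (b - x0) = a - b by rewrite opprB addrA subrK.
by rewrite lerD// -?linearB -?abE.
Qed.

Lemma perturbation_Ck k : Ck k G -> Ck k perturbation.
Proof.
move=> /CkE GC; apply/CkE; apply: (@Cn_pre _ _ _ _ _ idfun (- x0) (fun z => nlin L z + G z)).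
  by move=> x; exact: cvg_id.
by apply: CnD => //; apply: Cn_lin; exact: lin_continuous.
Qed.

Lemma perturbation_linearization : differentiable G 0 -> (forall v, 'd G 0 v = 0) ->
  linearization perturbation x0 = L.
Proof.
move=> Gd dG.
have [gd dg] := diff_lin_add (@lin_continuous _ _ _ (nlin L)) Gd.
have idc : continuous (idfun : nvect E -> nvect E) by move=> x; exact: cvg_id.
have gd' : differentiable (fun z => nlin L z + G z) (idfun x0 + - x0) by rewrite /= subrr.
have dE := (diff_pre idc gd').2.
apply/lfunP => v; rewrite /linearization.
have <- : 'd perturbation x0 v = L v.
  apply: etrans (dE v) _; have -> : (idfun x0 + - x0 : nvect E) = 0 by exact: subrr.
  by apply: etrans (dg v) _; rewrite dG addr0.
exact: (lfunE ('d perturbation x0 : {linear E -> E}) v).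
Qed.

End Perturbation.

Section Manifold.
Variables (R : realType) (E : vectType R) (L : 'End(E)) (m0 m1 K d : R).
Local Notation pc := (nlin (pi_c L)).
Local Notation ph := (nlin (pi_h L)).
Local Notation bs := (bounded_solution L m1).
Hypothesis m00 : 0 < m0.
Hypothesis m01 : m0 <= m1.
Hypothesis K0 : 0 < K.
Hypothesis d0 : 0 <= d.
Hypothesis Kd : K * d <= 2^-1.
Hypothesis est : forall g v m c, m0 <= m -> m <= m1 -> bs g v ->
  (forall t, `|g t| <= c * weight m t) ->
  forall t, `|v t| <= K * (c + `|pc (v 0)|) * weight m t.
Hypothesis hyp_est : forall g v c, bs g v -> (forall t, `|g t| <= c) ->
  forall t, `|ph (v t)| <= K * c.
Hypothesis exist : forall s g m c, m0 <= m -> m <= m1 -> continuous g ->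
  (forall t, `|g t| <= c * weight m t) -> pc s = s ->
  exists2 v, bs g v & pc (v 0) = s.

Variables (k : nat) (G : nvect E -> nvect E) (x0 : nvect E) (phi : R -> nvect E -> nvect E).
Local Notation F := (perturbation L x0 G).
Hypothesis k0 : (0 < k)%N.
Hypothesis mk : mst R k * m0 <= m1.
Hypothesis GU : Ub k G.
Hypothesis GL : forall a b, `|G a - G b| <= d * `|a - b|.
Hypothesis G0 : G 0 = 0.
Hypothesis dG0 : forall v, 'd G 0 v = 0.
Hypothesis phiF : is_flow F phi.

Lemma G_continuous : continuous G.
Proof. exact: lipschitz_continuous GL. Qed.

(** The parameter ranges over all of [E] although only its center part matters. This keeps the
    parameter space a vector space equal to the space of values. *)
Lemma center_family_exists : exists y : nvect E -> R -> nvect E,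
  [/\ forall x, exists C, forall t, `|y x t| <= C * weight m0 t,
      forall x, bs (fun t => G (y x t)) (y x) & forall x, pc (y x 0) = pc x].
Proof.
have ex x : exists v : R -> nvect E, [/\ exists C, forall t, `|v t| <= C * weight m0 t,
    bs (fun t => G (v t)) v & pc (v 0) = pc x].
  have [||||v [_ vC vb vs]] := @fixpoint_exists _ _ _ _ _ _ _ d0 Kd est exist
     (fun _ => G) (pc x) m0 0 (lexx _) m01.
  - exact: pcc.
  - by move=> z zc t; apply: (@continuous_comp _ _ _ z G); [exact: zc|exact: G_continuous].
  - by move=> t; exact: GL.
  - by move=> t; rewrite G0 normr0 mul0r.
  by exists v.
have [y Hy] := choice ex.
by exists y; split=> x; case: (Hy x).
Qed.

Variable y : nvect E -> R -> nvect E.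
Hypothesis yC : forall x, exists C, forall t, `|y x t| <= C * weight m0 t.
Hypothesis yb : forall x, bs (fun t => G (y x t)) (y x).
Hypothesis ys : forall x, pc (y x 0) = pc x.

Lemma shifted_flow x (t : R) :
  is_derive t (1 : R) (fun t => phi t x - x0 : nvect E) (nlin L (phi t x - x0) + G (phi t x - x0)).
Proof.
have [_ /(_ x t) H] := phiF.
have := is_deriveB H (is_derive_cst x0 t (1 : R)); rewrite subr0.
exact.
Qed.

Lemma flow_of_family x t : phi t (x0 + y x 0) - x0 = y x t.
Proof.
have [l l0 FL] := perturbation_lipschitz L x0 GL.
have ld : 0 <= l + d by rewrite addr_ge0// ltW.
have [phi0 phid] := phiF.
have zd (s : R) : is_derive s (1 : R) (fun s => x0 + y x s : nvect E) (F (x0 + y x s)).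
  have := is_deriveD (is_derive_cst x0 s (1 : R)) ((yb x).1 s); rewrite add0r.
  by rewrite /perturbation [x0 + _]addrC addrK.
have -> : phi t (x0 + y x 0) = x0 + y x t.
  by rewrite -[LHS]/((phi^~ (x0 + y x 0)) t) (ode_unique ld FL (phid _) zd)// phi0.
by rewrite addrC addKr.
Qed.

(** The curve may grow, but [G] is bounded along it, and a bounded forcing term gives a bounded
    hyperbolic part. *)
Lemma family_mem x : exists c, forall t, `|ph (phi t (x0 + y x 0) - x0)| <= c.
Proof.
have [[M HM] _] := Ub_ucb GU; exists (K * M) => t.
rewrite flow_of_family.
exact: (hyp_est (yb x) (fun t => HM (y x t))).
Qed.

(* The center part of u grows slowly: it is that of the slowly growing solution v
   of the linear equation with forcing term G (u t). *)
Lemma bounded_flow_family x : (exists c, forall t, `|ph (phi t x - x0)| <= c) ->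
  x = x0 + y (x - x0) 0.
Proof.
move=> [c hc]; pose u t : nvect E := phi t x - x0.
have ud := shifted_flow x.
have uc : continuous u by move=> t; exact: is_derive_continuous (ud t).
have [[M HM] _] := Ub_ucb GU.
have M0 : 0 <= M by exact: le_trans (HM 0).
pose g t := G (u t).
have gc : continuous g.
  by move=> t; apply: (@continuous_comp _ _ _ u G); [exact: uc|exact: G_continuous].
have gM t : `|g t| <= M * weight m0 t.
  by rewrite (le_trans (HM _))// ler_peMr// weight_ge1// ltW.
have [v vb vs] := exist (lexx m0) m01 gc gM (pcc L (u 0)).
have vM := est (lexx m0) m01 vb gM.
have [l l0 Ll] := lin_bounded (nlin L).
pose w t := pc (u t - v t).
have wd (t : R) : is_derive t (1 : R) w (nlin L (w t)).
  have H : is_derive t (1 : R) (fun t => u t - v t : nvect E) (nlin L (u t - v t)).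
    have := is_deriveB (ud t) (vb.1 t).
    move/is_derive_eqfun; apply => //.
    by rewrite -/(u t) /g (linearB (nlin L) (u t) (v t)) opprD addrACA subrr addr0.
  have := is_derive_lin (@lin_continuous _ _ _ pc) H.
  move/is_derive_eqfun; apply => //.
  exact: (pcL L (u t - v t)).
have zd (t : R) : is_derive t (1 : R) (fun _ : R => 0 : nvect E) (nlin L 0).
  by rewrite linear0; exact: is_derive_cst.
have LL a b : `|nlin L a - nlin L b| <= l * `|a - b| by rewrite -linearB.
have w0 : w = fun _ => 0.
  by apply: (ode_unique (ltW l0) LL wd zd); rewrite /w linearB vs subrr.
have [p p0 hp] := lin_bounded pc.
set B := K * (M + `|pc (v 0)|) in vM.
have uB t : `|u t| <= (p * B + c) * weight m0 t.
  have -> : u t = pc (v t) + ph (u t).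
    rewrite {1}(pi_ch L (u t)); congr (_ + _).
    have /(congr1 (@^~ t)) := w0; rewrite /w linearB => /eqP.
    by rewrite subr_eq0 => /eqP.
  rewrite mulrDl; apply: (le_trans (ler_normD _ _)); apply: lerD.
    by apply: (le_trans (hp (v t))); rewrite -mulrA; apply: ler_wpM2l; [exact: ltW|exact: vM].
  have c0 : 0 <= c by exact: le_trans (hc 0).
  by rewrite (le_trans (hc t))// ler_peMr// weight_ge1// ltW.
have B0 : 0 <= p * B + c by have := uB 0; rewrite weight0 mulr1; exact: le_trans.
have ub : bs (fun t => G (u t)) u.
  split; first exact: ud.
  by exists (p * B + c) => t; rewrite (le_trans (uB t))// ler_wpM2l// weight_le.
have u0 : u 0 = x - x0 by rewrite /u phiF.1.
have := solution_unique d0 Kd est GL m01 (ex_intro _ _ uB) (yC (x - x0)) ub (yb (x - x0)) 0.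
rewrite ys u0 subrr normr0 mulr0 mul0r normr_le0 subr_eq0 => /eqP <-.
by rewrite addrC subrK.
Qed.

Lemma family_origin : y 0 0 = 0.
Proof.
have zb : bs (fun t => G 0) (fun _ => 0).
  split; last by exists 0 => t; rewrite normr0 mul0r.
  by move=> t; rewrite G0 linear0 addr0; exact: is_derive_cst.
have zC : exists C, forall t, `|(0 : nvect E)| <= C * weight m0 t.
  by exists 0 => t; rewrite normr0 mul0r.
have := solution_unique d0 Kd est GL m01 (yC 0) zC (yb 0) zb 0.
by rewrite ys subrr normr0 mulr0 mul0r normr_le0 subr0 => /eqP.
Qed.

Lemma mk2 : 2 * m0 <= m1.
Proof.
apply: le_trans mk; rewrite ler_wpM2r ?(ltW m00)//.
by case: k k0 => // j _; have [H _] := mst_step R j; have := mst_ge1 R j; lra.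
Qed.

Lemma est_zero g v m c : m0 <= m -> m <= m1 -> bs g v ->
  (forall t, `|g t| <= c * weight m t) -> pc (v 0) = 0 ->
  forall t, `|v t| <= K * c * weight m t.
Proof. by move=> h1 h2 gv gc p0 t; have := est h1 h2 gv gc t; rewrite p0 normr0 addr0. Qed.

(** [y x] is compared with the solution [z] of the linear equation that has the same center part and
    no hyperbolic part. Their difference is the response to [G] along [y x], which is o(|x|) in the
    weight [2 * m0] because [G] and its differential vanish at 0. *)
Lemma family_tangent e : 0 < e ->
  exists2 r, 0 < r & forall x, `|x| <= r -> `|ph (y x 0)| <= e * `|x|.
Proof.
move=> e0; have [C C0 HC] := family_lipschitz K0 d0 Kd est GL yC yb ys m01.
have [q q0 hq] := lin_bounded ph.
pose e1 := e / (2 * (q * K * (C + 1))).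
have qK : 0 < q * K by rewrite mulr_gt0.
have C1 : 0 < 2 * (q * K * (C + 1)) by rewrite !mulr_gt0// ltr_wpDl.
have e10 : 0 < e1 by rewrite divr_gt0.
have GU1 : Ub 1 G by exact: UbW k0 GU.
have [M M0 HM] := Ub_taylor GU1 e10.
pose a := M * C * C; have a0 : 0 <= a by rewrite !mulr_ge0.
have A1 : 0 < 2 * (q * K * (a + 1)) by rewrite !mulr_gt0// ltr_wpDl.
exists (e / (2 * (q * K * (a + 1)))) => [|x hx]; first by rewrite divr_gt0.
have h0 := normr_ge0 x.
have yx t : `|y x t| <= C * `|x| * weight m0 t.
  have := HC 0 x t; rewrite add0r.
  have yt0 : y 0 t = 0.
    have := flow_of_family 0 t; rewrite family_origin addr0 => <-.
    have zd (s : R) : is_derive s (1 : R) (fun _ : R => x0) (F x0).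
      by rewrite /perturbation subrr linear0 G0 addr0; exact: is_derive_cst.
    have [l l0 FL] := perturbation_lipschitz L x0 GL.
    have ld : 0 <= l + d by rewrite addr_ge0// ltW.
    rewrite -[phi t x0]/((phi^~ x0) t) (ode_unique ld FL (phiF.2 x0) zd) ?subrr//.
    by rewrite phiF.1.
  by rewrite yt0 subr0.
have gb t : `|G (y x t)| <= (e1 * C + a * `|x|) * `|x| * weight (2 * m0) t.
  have := HM 0 (y x t); rewrite add0r G0 subr0 dG0 subr0 => /le_trans; apply.
  have s0 : 0 <= e1 + M * `|y x t| by apply: addr_ge0; [exact: ltW|exact: mulr_ge0].
  apply: (@le_trans _ _ ((e1 + M * (C * `|x| * weight m0 t)) * (C * `|x| * weight m0 t))).
    by apply: (ler_pM s0 (normr_ge0 _) _ (yx t)); rewrite lerD2l; exact: ler_wpM2l.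
  have w2 : weight m0 t * weight m0 t = weight (2 * m0) t.
    by rewrite weightD (_ : m0 + m0 = 2 * m0)//; ring.
  have w3 : weight m0 t <= weight (2 * m0) t by rewrite weight_le// ler_peMl ?ler1n ?(ltW m00).
  exact: (taylor_weight M (ltW e10) C0 h0 w2 w3).
have zc : continuous (fun _ : R => 0 : nvect E) by move=> t; exact: cvg_cst.
have zw (t : R) : `|0 : nvect E| <= 0 * weight m0 t by rewrite normr0 mul0r.
have [z zb zs] := exist (lexx m0) m01 zc zw (pcc L x).
have phz : ph (z 0) = 0.
  apply/eqP; rewrite -normr_le0 -[leRHS](mulr0 K).
  by apply: (hyp_est zb) => t; rewrite normr0.
have m02 : m0 <= 2 * m0 by rewrite ler_peMl ?ler1n ?(ltW m00).
have gb' t : `|G (y x t) - 0| <= (e1 * C + a * `|x|) * `|x| * weight (2 * m0) t.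
  by rewrite subr0.
have pz : pc (y x 0 - z 0) = 0.
  apply: (etrans (linearB pc (y x 0) (z 0))); apply/eqP; rewrite subr_eq0; apply/eqP.
  exact: (etrans (ys x) (esym zs)).
have := est_zero m02 mk2 (bs_sub (yb x) zb) gb' pz 0.
rewrite weight0 mulr1 => H.
have e2 : ph (y x 0) = ph (y x 0 - z 0) := lin_sub0 (y x 0) phz.
rewrite e2.
rewrite (le_trans (hq _))// (le_trans (ler_wpM2l (ltW q0) H))//.
rewrite (_ : q * (K * ((e1 * C + a * `|x|) * `|x|)) = (q * K * (e1 * C) + q * K * (a * `|x|)) * `|x|);
  last by ring.
apply: ler_wpM2r => //.
have k1 : q * K * (e1 * C) <= e / 2.
  rewrite (_ : q * K * (e1 * C) = e / 2 * (C / (C + 1))).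
    by rewrite ler_piMr ?divr_ge0 ?(ltW e0)// ler_pdivrMr ?mul1r ?ltr_wpDl// lerDl.
  by rewrite /e1; field; rewrite !gt_eqF// ltr_wpDl.
have k2 : q * K * (a * `|x|) <= e / 2.
  apply: (@le_trans _ _ (q * K * (a * (e / (2 * (q * K * (a + 1))))))).
    by apply: ler_wpM2l; [exact: ltW|exact: ler_wpM2l].
  rewrite (_ : q * K * _ = e / 2 * (a / (a + 1))).
    by rewrite ler_piMr ?divr_ge0 ?(ltW e0)// ler_pdivrMr ?mul1r ?ltr_wpDl// lerDl.
  by field; rewrite !gt_eqF// ltr_wpDl.
by rewrite [leRHS]splitr lerD.
Qed.

Lemma perturbation_manifold : global_center_manifold k F x0
  [set x | exists c : R, forall t, `|(pi_h L (phi t x - x0) : nvect E)| <= c].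
Proof.
have Gd : differentiable G 0 by move: k0 GU; case: (k) => // j _ [_ []].
have LE : linearization F x0 = L by exact: perturbation_linearization.
rewrite /global_center_manifold LE; split.
- by apply: perturbation_Ck; exact: Ub_Ck GU.
- by rewrite /perturbation subrr linear0 G0 addr0.
exists phi; split => //.
pose Uc := center_space L; pose Uh := hyperbolic_space L.
have vC : continuous (nval Uc) by exact: lin_continuous.
pose psi (v : nvect (subvs_of Uc)) : nvect (subvs_of Uh) := nproj Uh (ph (y (nval Uc v) 0)).
have psiE v : nval Uh (psi v) = ph (y (nval Uc v) 0).
  by apply: nprojK; exact: memv_pi.
have pcv (v : nvect (subvs_of Uc)) : pc (nval Uc v) = nval Uc v.
  exact: (pi_c_id (subvsP v)).
have yE (v : nvect (subvs_of Uc)) : y (nval Uc v) 0 = nval Uc v + nval Uh (psi v).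
  have e1 : pc (y (nval Uc v) 0) = nval Uc v := etrans (ys _) (pcv v).
  exact (etrans (nlin_ch L (y (nval Uc v) 0))
    (f_equal2 (fun a b : nvect E => a + b) e1 (esym (psiE v)))).
exists psi; split.
- apply/CkE; apply: Cn_post; first exact: lin_continuous.
  apply: Cn_post; first exact: lin_continuous.
  have yk : Cn k (fun x => y x 0).
    apply/CkE; apply: wC_eval.
    exact: (family_wC m00 K0 d0 Kd est exist GL yC yb ys GU mk).
  have := Cn_pre 0 vC yk.
  by congr (Cn _ _); apply/funext => v; rewrite addr0.
- by rewrite /psi linear0 family_origin !linear0.
- have h00 : ph (y 0 0) = 0 by rewrite family_origin linear0.
  exact (@little_o_diff0 R E Uc Uh (fun x => ph (y x 0)) h00 family_tangent).
apply/seteqP; split=> x /=.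
  move=> /bounded_flow_family xE.
  have pE : nval Uc (nproj Uc (pc (x - x0))) = pc (x - x0) by apply: nprojK; exact: memv_pi.
  exists (nproj Uc (pc (x - x0))) => //.
  rewrite -[LHS]addrA -[X in x0 + X]/(nval Uc (nproj Uc (pc (x - x0))) + nval Uh (psi (nproj Uc (pc (x - x0))))).
  rewrite -yE pE.
  rewrite {2}xE; congr (_ + _).
  have xC := yC (pc (x - x0)).
  have := solution_unique d0 Kd est GL m01 (yC (x - x0)) (yC (pc (x - x0))) (yb _) (yb _) 0.
  rewrite !ys pcc subrr normr0 mulr0 mul0r normr_le0 subr_eq0.
  by move=> /eqP.
move=> [v _ <-].
have xE : x0 + nval Uc v + nval Uh (psi v) = x0 + y (nval Uc v) 0.
  exact (etrans (esym (addrA _ _ _)) (congr1 (fun z : nvect E => x0 + z) (esym (yE v)))).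
exact (eq_ind_r (fun z => exists c : R, forall t, `|ph (phi t z - x0)| <= c)
  (family_mem (nval Uc v)) xE).
Qed.

End Manifold.

(** The size [d] is quantified before [G]: it depends on [L] and [k] alone, so the truncation can be
    adapted to it. *)
Theorem center_manifold_theorem (R : realType) (E : vectType R) (L : 'End(E)) (k : nat) : (0 < k)%N ->
  exists2 d, 0 < d & forall (G : nvect E -> nvect E) (x0 : nvect E) phi,
    Ub k G -> (forall a b, `|G a - G b| <= d * `|a - b|) -> G 0 = 0 -> (forall v, 'd G 0 v = 0) ->
    is_flow (perturbation L x0 G) phi ->
    global_center_manifold k (perturbation L x0 G) x0
      [set x | exists c : R, forall t, `|(pi_h L (phi t x - x0) : nvect E)| <= c].
Proof.
move=> k0; have [a a0 Ha] := linear_estimates L.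
have M1 := mst_ge1 R k; have M0 : 0 < mst R k by exact: lt_le_trans M1.
(* [m1] lies below the spectral gap, and [m0] is so small that [k] differentiations keep the
   exponent at most [m1]. *)
pose m1 := a / 2; have m10 : 0 < m1 by rewrite divr_gt0.
pose m0 := m1 / mst R k; have m00 : 0 < m0 by rewrite divr_gt0.
have mk : mst R k * m0 <= m1 by rewrite /m0 mulrCA divff ?gt_eqF// mulr1.
have m01 : m0 <= m1 by rewrite ler_pdivrMr// ler_peMr// ltW.
have m1a : m1 < a by rewrite ltr_pdivrMr// ltr_pMr// ltr1n.
have [K K0 [est hest ex]] := Ha m0 m1 m00 m01 m1a.
have d0 : 0 < (2 * K)^-1 by rewrite invr_gt0 mulr_gt0.
have Kd : K * (2 * K)^-1 <= 2^-1 by rewrite invfM mulrCA divff ?gt_eqF// mulr1.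
exists (2 * K)^-1 => // G x0 phi GU GL G0 dG phiF.
have [y [yC yb ys]] := @center_family_exists _ _ _ _ _ _ _ m01 (ltW d0) Kd est ex G GL G0.
exact: (perturbation_manifold m00 m01 K0 (ltW d0) Kd est hest ex k0 mk GU GL G0 dG phiF yC yb ys).
Qed.

(** * Truncation *)

Section CompactSupport.
Variables (R : realType) (E : vectType R).

(** Compactness of closed balls of row vectors, transported by the coordinates, which preserve the
    norm. *)
Lemma bounded_cluster (a : nat -> nvect E) (r : R) : (forall n, `|a n| <= r) ->
  exists x, forall d : R, 0 < d -> forall N, exists2 n, (N <= n)%N & `|x - a n| <= d.
Proof.
move=> ar; pose e := vbasis {: E}; pose b n := rVof e (a n : E).
have K : compact [set v : 'rV[R]_(\dim {: E}) | `|v| <= r].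
  apply: bounded_closed_compact.
    by exists r; split; [exact: num_real|move=> M rM v /= vr; exact: le_trans vr (ltW rM)].
  apply: (@preimage_closed _ _ (fun v : 'rV[R]_(\dim {: E}) => `|v|) [set x | x <= r]).
    by move=> v _; exact: norm_continuous.
  exact: closed_le.
have [|v [vK vc]] := K (b @ \oo).
  by exists 0%N => // n _; exact: ar.
exists (vecof e v) => d d0 N.
have [||w [[n Nn <-]]] := vc (b @` [set n | (N <= n)%N]) (ball v d).
- by exists N => // n /= Nn; exists n.
- exact: nbhsx_ballx.
rewrite -ball_normE /= => /ltW vd; exists n => //.
have -> : `|(vecof e v : nvect E) - a n| = `|rVof e (vecof e v - a n)| by [].
by rewrite linearB/= vecofK//; exact: vbasisP.
Qed.

Variables (W : normedModType R) (h : nvect E -> W) (r : R).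
Hypothesis hc : continuous h.
Hypothesis hr : forall x, r < `|x| -> h x = 0.

Lemma support_bounded : exists2 M : R, 0 <= M & forall x, `|h x| <= M.
Proof.
have [//|H] := pselect (exists2 M : R, 0 <= M & forall x, `|h x| <= M).
have Hn (n : nat) : exists x, n%:R < `|h x|.
  apply: contrapT => /forallNP Hx; apply: H; exists n%:R => // x.
  by have /negP := Hx x; rewrite -leNgt.
have [a Ha] := choice Hn.
have ar n : `|a n| <= r.
  by rewrite leNgt; apply/negP => /hr h0; have := Ha n; rewrite h0 normr0 ltNge ler0n.
have [x Hx] := bounded_cluster ar.
have /eps_continuous/(_ 1 ltr01)[d d0 hd] := hc (x := x).
have [N HN] : exists N : nat, `|h x| + 1 <= N%:R.
  exists (Num.Def.archi_bound (`|h x| + 1)); apply/ltW.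
  by apply: archi_boundP; rewrite addr_ge0.
have [n Nn xn] := Hx d d0 N.
have := Ha n; rewrite ltNge (_ : `|h (a n)| <= n%:R)//.
apply: (@le_trans _ _ N%:R); last by rewrite ler_nat.
apply: le_trans HN; rewrite -lerBlDl (le_trans (lerB_dist _ _))//.
by rewrite distrC; exact: hd.
Qed.

(** If no [M] works, there are pairs of points violating the bound with M = n. Their distances tend
    to 0 because [h] is bounded, and continuity fails at a cluster point. *)
Lemma support_modulus (e : R) : 0 < e -> exists2 M : R, 0 <= M &
  forall a b, `|h a - h b| <= e + M * `|a - b|.
Proof.
move=> e0; have [B B0 hB] := support_bounded.
have [//|H] := pselect (exists2 M : R, 0 <= M & forall a b, `|h a - h b| <= e + M * `|a - b|).
have Hn (n : nat) : exists p : nvect E * nvect E, `|p.1| <= r /\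
    e + n%:R * `|p.1 - p.2| < `|h p.1 - h p.2|.
  have [p Hp] : exists p : nvect E * nvect E, e + n%:R * `|p.1 - p.2| < `|h p.1 - h p.2|.
    apply: contrapT => /forallNP Hx; apply: H; exists n%:R => // a b.
    by have /negP := Hx (a, b); rewrite -leNgt.
  (* [h] vanishes outside the ball, so at least one of the two points is inside. The roles are
     exchanged if it is the second. *)
  have [p1|p1] := leP `|p.1| r; first by exists p.
  have [p2|p2] := leP `|p.2| r; first by exists (p.2, p.1); rewrite /= distrC (distrC (h _)).
  move: Hp; rewrite !hr// subrr normr0 => /lt_le_trans/(_ (ltW e0)).
  by rewrite -subr_gt0 opprD addrA subrr sub0r oppr_gt0 ltNge mulr_ge0.
have [p Hp] := choice Hn.
have [x Hx] := bounded_cluster (fun n => (Hp n).1).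
have e20 : 0 < e / 2 by rewrite divr_gt0.
have /eps_continuous/(_ _ e20)[d d0 hd] := hc (x := x).
have d20 : 0 < d / 2 by rewrite divr_gt0.
have [N HN] : exists N : nat, 2 * B / (d / 2) <= N%:R.
  exists (Num.Def.archi_bound (2 * B / (d / 2))); apply/ltW.
  by apply: archi_boundP; apply: divr_ge0; [exact: (mulr_ge0 _ B0)|exact: ltW].
have [n Nn xn] := Hx (d / 2) d20 N.+1.
have [_ Hpn] := Hp n.
have n0 : (0 : R) < n%:R by rewrite ltr0n (leq_trans _ Nn).
have pn : `|(p n).1 - (p n).2| <= d / 2.
  have : n%:R * `|(p n).1 - (p n).2| <= 2 * B.
    have := le_trans (ltW Hpn) (ler_normB _ _).
    move=> /le_trans/(_ (lerD (hB _) (hB _))).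
    by move: (n%:R * _) => z; lra.
  have : 2 * B <= n%:R * (d / 2).
    rewrite -ler_pdivrMr// (le_trans HN)// ler_nat ltnW//.
  move=> h1 /le_trans/(_ h1); rewrite ler_pM2l//.
have h1 : `|h x - h (p n).1| <= e / 2.
  by apply: hd; rewrite (le_trans xn)// ler_pdivrMr// ler_peMr ?ler1n// ltW.
have h2 : `|h x - h (p n).2| <= e / 2.
  apply: hd; have -> : x - (p n).2 = (x - (p n).1) + ((p n).1 - (p n).2) by rewrite addrA subrK.
  by rewrite (le_trans (ler_normD _ _))// [leRHS]splitr lerD.
move: Hpn; rewrite ltNge => /negP[].
have -> : h (p n).1 - h (p n).2 = (h x - h (p n).2) - (h x - h (p n).1).
  by rewrite opprB [RHS]addrC addrA subrK.
rewrite (le_trans (ler_normB _ _))// (le_trans (lerD h2 h1))// -splitr lerDl mulr_ge0//.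
Qed.

End CompactSupport.

Lemma diff_support (R : realType) (V W : normedModType R) (h : V -> W) (r : R) :
  (forall x, r < `|x| -> h x = 0) -> forall x v, r < `|x| -> 'd h x v = 0.
Proof.
move=> hr x v rx.
have e0 : 0 < `|x| - r by rewrite subr_gt0.
have [_ H] : differentiable h x /\ forall v, 'd h x v = (\0 : {linear V -> W}) v.
  apply: diff_criterion_gen; first by move=> y; exact: cst_continuous.
  move=> e e1; exists ((`|x| - r) / 2); first by rewrite divr_gt0.
  move=> k hk; rewrite !hr//; first by rewrite subr0 subrr normr0 mulr_ge0// ltW.
  have : `|x| <= `|x + k| + `|k| by rewrite -[in leLHS](addrK k x) ler_normB.
  have : `|k| < `|x| - r by rewrite (le_lt_trans hk)// ltr_pdivrMr// ltr_pMr// ltr1n.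
  by move: (`|x|) (`|k|) (`|x + k|) => p q s; lra.
by rewrite H.
Qed.

Lemma Ub_support (R : realType) (E F : vectType R) j (h : nvect E -> nvect F) (r : R) :
  Cn j h -> (forall x, r < `|x| -> h x = 0) -> Ub j h.
Proof.
have ucbS (g : nvect E -> nvect F) : continuous g -> (forall x, r < `|x| -> g x = 0) -> ucb g.
  move=> gc gr; split; last exact: support_modulus gc gr.
  by have [M _ HM] := support_bounded gc gr; exists M.
elim: j h => [|j IH] h hC hr; first by split => //; exact: ucbS.
have hc := Cn_continuous hC; move: hC => [hd hC].
split; first exact: ucbS.
split=> // v; apply: IH (hC v) _ => x; exact: diff_support.
Qed.

Section PosPower.
Variable R : realType.
Implicit Types s : R.

(** A power of the positive part, of class C^n. Only finitely many derivatives are needed, so a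
    piecewise polynomial cutoff is enough. *)
Definition pospow (n : nat) s : R := (Num.max s 0) ^+ n.+1.

Lemma pospow0 n s : s <= 0 -> pospow n s = 0.
Proof. by move=> s0; rewrite /pospow max_r// expr0n. Qed.

Lemma pospow_ge0 n s : 0 <= pospow n s.
Proof. by rewrite exprn_ge0// le_max lexx orbT. Qed.

Lemma pospow_le1 n s : s <= 1 -> pospow n s <= 1.
Proof. by move=> s1; rewrite exprn_ile1// ?le_max ?lexx ?orbT// ge_max s1 ler01. Qed.

Lemma pospow_ge1 n s : 1 <= s -> 1 <= pospow n s.
Proof. by move=> s1; rewrite exprn_ege1// le_max s1. Qed.

Lemma pospowS n s : pospow n.+1 s = s *: pospow n s.
Proof.
rewrite /pospow exprS -[RHS]/(s * _); have [s0|s0] := leP s 0 => //.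
by rewrite expr0n !mulr0.
Qed.

Lemma pospow_continuous n : continuous (pospow n).
Proof.
move=> s; apply: (@continuous_comp _ _ _ (fun s => Num.max s 0) (fun x => x ^+ n.+1)).
  by apply: continuous_max; [exact: cvg_id|exact: cvg_cst].
exact: exprn_continuous.
Qed.

(** The square of the positive part is differentiated by hand, with a remainder of at most h^2.
    Higher powers follow from [pospowS] and the product rule. *)
Lemma pospow_diff n s : differentiable (pospow n.+1) s /\
  forall v, 'd (pospow n.+1) s v = v *: (n.+2%:R * pospow n s).
Proof.
elim: n s => [|n IH] s.
  have lin : linear (fun v : R => v *: (2 * pospow 0 s)).
    by move=> a x y; rewrite -[LHS]/((a * x + y) * (2 * pospow 0 s)) mulrDl -mulrA.
  pose A := GRing.isLinear.Build R R R _ _ lin.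
  pose A' : {linear R -> R} := HB.pack (fun v : R => v *: (2 * pospow 0 s)) A.
  apply: (@diff_criterion_gen _ _ _ _ A').
    by move=> x; apply: cvgZ; [exact: cvg_id|exact: cvg_cst].
  move=> e e0; exists e => // h he.
  have : `|pospow 1 (s + h) - pospow 1 s - h * (2 * pospow 0 s)| <= h ^+ 2.
    rewrite /pospow expr1 ler_norml.
    by have [s0|s0] := leP s 0; have [h0|h0] := leP (s + h) 0; apply/andP; split; nra.
  move=> /le_trans; apply.
  by rewrite -real_normK ?num_real// expr2 ler_wpM2r.
have PE : pospow n.+2 = fun s => idfun s *: pospow n.+1 s by apply/funext => x; exact: pospowS.
have idd : differentiable (idfun : R -> R) s by exact: ex_diff.
have [D1 D2] := diff_scale idd (IH s).1.
rewrite PE; split=> [|v]; first exact: D1.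
rewrite D2 (IH s).2.
have -> : 'd (idfun : R -> R) s v = v by rewrite (_ : 'd (idfun : R -> R) s = idfun :> (R -> R))// diff_val.
rewrite pospowS -[LHS]/(v * (s * pospow n s) + s * (v * (n.+2%:R * pospow n s))).
rewrite -[RHS]/(v * (n.+3%:R * (s * pospow n s))) -[n.+3]addn1 natrD.
ring.
Qed.

Lemma Cn_pospow k : Cn k (pospow k).
Proof.
elim: k => [|k IH]; first exact: pospow_continuous.
split=> [s|v]; first exact: (pospow_diff k s).1.
have -> : (fun x => 'd (pospow k.+1) x v) = (fun x => (v * k.+2%:R) *: pospow k x).
  by apply/funext => x; rewrite (pospow_diff k x).2 -[RHS]/(_ * _) -mulrA.
by apply: CnZ => //; exact: Cn_cst.
Qed.

End PosPower.

Section Cutoff.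
Variables (R : realType) (E : vectType R) (k : nat).

(** With q the sum of the squared coordinates, it is 1 for q <= 1 and 0 for q >= 2. The sum of
    squares replaces the sup norm, which is not differentiable. *)
Definition bump (x : nvect E) : R :=
  pospow k (1 - pospow k (\sum_i coord_of i x *: coord_of i x - 1)).

Lemma Cn_bump : Cn k bump.
Proof.
apply: (@Cn_comp_real _ _ _ _ (fun x => 1 - pospow k (\sum_i coord_of i x *: coord_of i x - 1)));
  last exact: Cn_pospow.
have -> : (fun x : nvect E => 1 - pospow k (\sum_i coord_of i x *: coord_of i x - 1)) =
   fun x => 1 + (-1) *: pospow k (\sum_i coord_of i x *: coord_of i x + (- 1)).
  by apply/funext => x; rewrite scaleN1r.
apply: CnD; first exact: Cn_cst.
apply: CnZ; first exact: Cn_cst.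
apply: (@Cn_comp_real _ _ _ _ (fun x => \sum_i coord_of i x *: coord_of i x + (- 1)));
  last exact: Cn_pospow.
apply: CnD; last exact: Cn_cst.
have cC i : Cn k (coord_of i : nvect E -> R).
  exact: (@Cn_lin _ _ _ _ (coord_of i : {linear nvect E -> R}) (@coord_of_continuous _ _ i)).
by apply: Cn_sum => i; apply: CnZ.
Qed.

Lemma bump01 x : 0 <= bump x <= 1.
Proof.
rewrite pospow_ge0/= pospow_le1// lerBlDr lerDl; exact: pospow_ge0.
Qed.

Lemma bump_near : exists2 r : R, 0 < r & forall x, `|x| <= r -> bump x = 1.
Proof.
pose D : R := (\dim {: E})%:R + 1; have D1 : 1 <= D by rewrite lerDr.
have D0 : 0 < D by exact: lt_le_trans D1.
exists D^-1 => [|x xD]; first by rewrite invr_gt0.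
rewrite /bump [pospow k (_ - 1)]pospow0; first by rewrite subr0 /pospow max_l// expr1n.
rewrite subr_le0.
have H i : coord_of i x *: coord_of i x <= D^-1.
  rewrite -[leLHS]/(coord_of i x * coord_of i x) (le_trans (ler_norm _))// normrM.
  have h := le_trans (coord_norm i x) xD.
  apply: (le_trans (ler_pM (normr_ge0 _) (normr_ge0 _) h h)).
  by rewrite ler_piMr ?invr_ge0 ?(ltW D0)// invf_le1.
rewrite (le_trans (ler_sum _ (fun i _ => H i)))// sumr_const card_ord -[leLHS]mulr_natl.
by rewrite ler_pdivrMr// mul1r lerDl.
Qed.

Lemma bump_far x : 2 < `|x| -> bump x = 0.
Proof.
move=> x2; apply: pospow0; rewrite subr_le0; apply: pospow_ge1.
have [i hi] : exists i, 2 < `|coord_of i x|.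
  apply: contrapT => /forallNP H; move: x2; rewrite ltNge => /negP[].
  by apply: norm_coord => // i; have /negP := H i; rewrite -leNgt.
rewrite (bigD1 i)//= lerBrDr -[1 + 1]addr0 lerD//; last first.
  by apply: sumr_ge0 => j _; rewrite -[leRHS]/(_ * _) -expr2 sqr_ge0.
rewrite -[leRHS]/(_ * _) -expr2 -real_normK ?num_real//.
by move: (`|_|) hi => z; nra.
Qed.

Lemma bump_diff_bounded : (0 < k)%N ->
  exists2 M : R, 0 <= M & forall x v, `|'d bump x v| <= M * `|v|.
Proof.
move=> k0; have [bd bC] : (forall x, differentiable bump x) /\ forall v, continuous (fun x => 'd bump x v).
  have := Cn_bump; move: k0; case: (k) bump => // j b _ [bd bC]; split=> // v.
  exact: Cn_continuous (bC v).
have Hi i : exists M : R, 0 <= M /\ forall x, `|'d bump x (base i)| <= M.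
  have [M M0 HM] := support_bounded (bC (base i)) (fun x => @diff_support _ _ _ _ _ bump_far x (base i)).
  by exists M.
have [M HM] := choice Hi.
exists (\sum_i M i) => [|x v]; first by apply: sumr_ge0 => i _; exact: (HM i).1.
rewrite {1}(coord_baseE v) linear_sum (le_trans (ler_norm_sum _ _ _))// mulr_suml.
apply: ler_sum => i _; rewrite linearZ/= normrM mulrC ler_pM//; [exact: (HM i).2|exact: coord_norm].
Qed.

End Cutoff.

Lemma diff_addE (R : realType) (V W : normedModType R) (f g : V -> W) x v :
  differentiable f x -> differentiable g x -> 'd (fun x => f x + g x) x v = 'd f x v + 'd g x v.
Proof. by move=> fd gd; rewrite -[(fun x => f x + g x)]/(f + g) (diffD fd gd). Qed.

Section UbClosure.
Variables (R : realType) (E F : vectType R).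

Lemma ucb_post (F' : vectType R) (A : {linear nvect F -> nvect F'}) (g : nvect E -> nvect F) :
  ucb g -> ucb (fun x => A (g x)).
Proof.
have [c c0 hc] := lin_bounded A.
move=> [[M HM] Hu]; split.
  by exists (c * M) => x; rewrite (le_trans (hc _))// ler_wpM2l// ltW.
move=> e e0; have [B B0 HB] := Hu (e / c) (divr_gt0 e0 c0).
exists (c * B) => [|a b]; first by rewrite mulr_ge0// ltW.
rewrite -linearB (le_trans (hc _))// (le_trans (ler_wpM2l (ltW c0) (HB a b)))//.
by rewrite mulrDr mulrCA divff ?gt_eqF// mulr1 mulrA.
Qed.

Lemma Ub_post (F' : vectType R) (A : {linear nvect F -> nvect F'}) j (g : nvect E -> nvect F) :
  Ub j g -> Ub j (fun x => A (g x)).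
Proof.
have Ac : continuous A by exact: lin_continuous.
elim: j g => [|j IH] g [gu gC]; first by split => //; exact: ucb_post.
move: gC => [gd gC]; split; first exact: ucb_post.
split=> [x|v]; first exact: (diff_post Ac (gd x)).1.
rewrite (_ : (fun _ => _) = (fun x => A ('d g x v))); first exact: (IH _ (gC v)).
by apply/funext => x; exact: (diff_post Ac (gd x)).2.
Qed.

Lemma ucb_pre (E' : vectType R) (A : {linear nvect E' -> nvect E}) (g : nvect E -> nvect F) :
  ucb g -> ucb (fun x => g (A x)).
Proof.
have [c c0 hc] := lin_bounded A.
move=> [[M HM] Hu]; split; first by exists M.
move=> e e0; have [B B0 HB] := Hu e e0.
exists (B * c) => [|a b]; first by rewrite mulr_ge0// ltW.
by rewrite (le_trans (HB _ _))// lerD2l -mulrA ler_wpM2l// -linearB.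
Qed.

Lemma Ub_pre (E' : vectType R) (A : {linear nvect E' -> nvect E}) j (g : nvect E -> nvect F) :
  Ub j g -> Ub j (fun x => g (A x)).
Proof.
have Ac : continuous A by exact: lin_continuous.
have gE (g' : nvect E -> nvect F) : (fun x => g' (A x)) = (fun x => g' (A x + 0)).
  by apply/funext => x; rewrite addr0.
elim: j g => [|j IH] g [gu gC]; first by split => //; exact: ucb_pre.
move: gC => [gd gC]; split; first exact: ucb_pre.
rewrite gE; split=> [x|v]; first exact: (diff_pre Ac (gd _)).1.
have := IH (fun y => 'd g y (A v)) (gC (A v)); congr (Ub _ _).
by apply/funext => x; rewrite (diff_pre Ac (gd _)).2 addr0.
Qed.

Lemma UbD j (g h : nvect E -> nvect F) : Ub j g -> Ub j h -> Ub j (fun x => g x + h x).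
Proof.
have uD (g' h' : nvect E -> nvect F) : ucb g' -> ucb h' -> ucb (fun x => g' x + h' x).
  move=> [[M HM] Hu] [[N HN] Hv]; split.
    by exists (M + N) => x; rewrite (le_trans (ler_normD _ _))// lerD.
  move=> e e0; have e20 : 0 < e / 2 by rewrite divr_gt0.
  have [B B0 HB] := Hu _ e20; have [C C0 HC] := Hv _ e20.
  exists (B + C) => [|a b]; first exact: addr_ge0.
  rewrite opprD addrACA (le_trans (ler_normD _ _))// (le_trans (lerD (HB a b) (HC a b)))//.
  by rewrite addrACA -splitr -mulrDl.
elim: j g h => [|j IH] g h [gu gC] [hu hC]; first by split => //; exact: uD.
move: gC hC => [gd gC] [hd hC]; split; first exact: uD.
split=> [x|v]; first exact: (differentiableD (gd x) (hd x)).
rewrite (_ : (fun _ => _) = (fun x => 'd g x v + 'd h x v)); first exact: (IH _ _ (gC v) (hC v)).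
by apply/funext => x; exact: diff_addE.
Qed.

Lemma Ub0 j : Ub j (fun _ : nvect E => 0 : nvect F).
Proof. by apply: (@Ub_support _ _ _ _ _ 0) => //; exact: Cn_cst. Qed.

Lemma Ub_sum j (I : Type) (r : seq I) (g : I -> nvect E -> nvect F) : (forall i, Ub j (g i)) ->
  Ub j (fun x => \sum_(i <- r) g i x).
Proof.
move=> gU; elim: r => [|i r IH].
  rewrite (_ : (fun _ => _) = (fun _ => 0)); first exact: Ub0.
  by apply/funext => x; rewrite big_nil.
rewrite (_ : (fun _ => _) = (fun x => g i x + \sum_(i <- r) g i x)); first exact: UbD.
by apply/funext => x; rewrite big_cons.
Qed.

End UbClosure.

Section Truncation.
Variables (R : realType) (E F : vectType R) (k : nat) (f : nvect E -> nvect F) (x0 : nvect E).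
Hypothesis k0 : (0 < k)%N.
Hypothesis fC : Ck k f.

Definition remainder (x : nvect E) : nvect F := f (x0 + x) - f x0 - 'd f x0 x.

Lemma f_C1 : (forall x, differentiable f x) /\ forall v, continuous (fun x => 'd f x v).
Proof.
move/CkE: fC; move: k0; case: (k) => // j _ [fd fc]; split => // v.
exact: Cn_continuous (fc v).
Qed.

Lemma remainder_Cn : Cn k remainder.
Proof.
have -> : remainder = fun x => f (idfun x + x0) + ((- f x0) + (-1) *: 'd f x0 x).
  by apply/funext => x; rewrite /remainder scaleN1r /= [x + x0]addrC addrA.
apply: CnD.
  by apply: Cn_pre; [move=> x; exact: cvg_id|apply/CkE].
apply: CnD; first exact: Cn_cst.
apply: CnZ; first exact: Cn_cst.
by apply: (@Cn_lin _ _ _ _ ('d f x0)); exact: lin_continuous.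
Qed.

Lemma remainder_diff x : differentiable remainder x /\
  forall v, 'd remainder x v = 'd f (x0 + x) v - 'd f x0 v.
Proof.
have [fd _] := f_C1.
have Rd : differentiable remainder x.
  by have := remainder_Cn; move: k0; case: (k) => // j _ [].
apply: diff_criterion_gen (('d f (x0 + x) : nvect E -> nvect F) \- 'd f x0 : {linear _ -> _}) _ _ _.
  exact: lin_continuous.
move=> e e0; have [r r0 hr] := diff_estimate (fd (x0 + x)) e0.
exists r => // h hh; rewrite (le_trans _ (hr h hh))// /remainder/= addrA.
rewrite le_eqVlt; apply/orP; left; apply/eqP; congr (`|_|).
rewrite linearD/=.
exact: taylor_shift.
Qed.

(** On the support |x| <= 2 c of the cutoff the remainder is at most 2 c e, while the derivative of
    the cutoff is at most M / c. The radius cancels from the product, and [e] becomes small with the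
    radius. *)
Lemma truncation (d : R) : 0 < d -> exists g : nvect E -> nvect F,
  [/\ Ub k g, forall a b, `|g a - g b| <= d * `|a - b|, g 0 = 0, forall v, 'd g 0 v = 0 &
    exists2 r : R, 0 < r & forall x, `|x| <= r -> g x = remainder x].
Proof.
move=> d0; have [fd fc] := f_C1.
have [M M0 HM] := @bump_diff_bounded R E k k0.
pose D : R := (\dim {: E})%:R.
have q0 : 0 < 2 * M + D + 1 by rewrite ltr_wpDl// addr_ge0 ?mulr_ge0.
(* The product rule gives 2 M e from the derivative of the cutoff and D e from that of the
   remainder; their sum has to be at most [d]. *)
pose e := d / (2 * M + D + 1); have e0 : 0 < e by rewrite divr_gt0.
have [r1 r10 hr1] := diff_estimate (fd x0) e0.
have [r2 r20 hr2] : exists2 r : R, 0 < r & forall h, `|h| <= r ->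
    forall i, `|'d f (x0 + h) (base i) - 'd f x0 (base i)| <= e.
  apply: common_radius => i.
  have /eps_continuous/(_ e e0)[r r0 hr] := fc (base i) x0.
  exists r => // h hh; rewrite distrC; apply: hr.
  by rewrite opprD addrA subrr sub0r normrN.
(* [bump] vanishes beyond radius 2, so the rescaled cutoff is supported in the ball of radius
   [2 * c], where both smallness conditions hold. *)
pose c := Num.min r1 r2 / 2.
have c0 : 0 < c by rewrite divr_gt0// lt_min r10.
have c2 : 2 * c = Num.min r1 r2 by rewrite /c mulrC divfK.
pose A : {linear nvect E -> nvect E} := ( *:%R c^-1 : nvect E -> nvect E).
have Ac : continuous A by exact: lin_continuous.
pose chi x := bump k (A x + 0).
have chiC : Cn k chi by apply: Cn_pre => //; exact: Cn_bump.
pose g x := chi x *: remainder x.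
have gC : Cn k g by apply: CnZ => //; exact: remainder_Cn.
have nA x : `|A x| = c^-1 * `|x| by rewrite normrZ gtr0_norm ?invr_gt0.
have gfar x : 2 * c < `|x| -> g x = 0.
  move=> xc; rewrite /g /chi addr0 bump_far ?scale0r// nA.
  by rewrite mulrC ltr_pdivlMr.
have r0 : remainder 0 = 0 by rewrite /remainder addr0 linear0 subrr subr0.
have C1 (u : nvect E -> R) : Cn k u -> forall x, differentiable u x.
  by move: k0; case: (k) => // j _ [].
have bumpd := C1 _ (@Cn_bump R E k).
have gd x : differentiable g x /\
    forall v, 'd g x v = 'd chi x v *: remainder x + chi x *: 'd remainder x v.
  by apply: diff_scale; [exact: C1|exact: (remainder_diff x).1].
have chid x v : `|'d chi x v| <= M * (c^-1 * `|v|).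
  rewrite (diff_pre Ac (bumpd _)).2 (le_trans (HM _ _))// ler_wpM2l// nA.
  exact: lexx.
have dg x v : `|'d g x v| <= d * `|v|.
  have [xc|xc] := ltP (2 * c) `|x|.
    by rewrite (diff_support gfar)// normr0 mulr_ge0// ltW.
  have [x1 x2] : `|x| <= r1 /\ `|x| <= r2 by move: xc; rewrite c2 le_min => /andP.
  have rx : `|remainder x| <= e * (2 * c).
    by rewrite (le_trans (hr1 x x1))// ler_wpM2l// ltW.
  have drx : `|'d remainder x v| <= D * `|v| * e.
    rewrite (remainder_diff x).2 (diff_coordE f (x0 + x) v) (diff_coordE f x0 v) -sumrB.
    rewrite (eq_bigr (fun i => coord_of i v *: ('d f (x0 + x) (base i) - 'd f x0 (base i)))).
      exact: coord_sum_le (hr2 x x2).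
    by move=> i _; rewrite scalerBr.
  have /andP[b0 b1] := bump01 k (A x + 0).
  rewrite (gd x).2 (le_trans (ler_normD _ _))// !normrZ.
  have t1 : `|'d chi x v| * `|remainder x| <= 2 * M * e * `|v|.
    rewrite (le_trans (ler_pM (normr_ge0 _) (normr_ge0 _) (chid x v) rx))//.
    by rewrite le_eqVlt; apply/orP; left; apply/eqP; field; rewrite gt_eqF.
  have t2 : `|chi x| * `|'d remainder x v| <= D * e * `|v|.
    rewrite ger0_norm// (le_trans (ler_wpM2l b0 drx))// mulrAC.
    by apply: ler_piMl => //; exact: (mulr_ge0 (mulr_ge0 (ler0n _ _) (ltW e0)) (normr_ge0 _)).
  rewrite (le_trans (lerD t1 t2))// -mulrDl ler_wpM2r// -mulrDl.
  by rewrite /e mulrCA ler_piMr ?(ltW d0)// ler_pdivrMr// mul1r lerDl.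
exists g; split.
- exact: Ub_support gC gfar.
- move=> a b; have := @mean_value_diff _ _ _ g (\0 : {linear _ -> _}) b (a - b) (d * `|a - b|).
  rewrite [b + (a - b)]addrC subrK subr0; apply=> [x|s _]; first exact: (gd x).1.
  by rewrite subr0.
- by rewrite /g r0 scaler0.
- by move=> v; rewrite (gd 0).2 r0 scaler0 (remainder_diff 0).2 addr0 subrr scaler0 addr0.
have [r rp hr] := @bump_near R E k.
exists (r * c) => [|x hx]; first by rewrite mulr_gt0.
by rewrite /g /chi addr0 hr ?scale1r// nA mulrC ler_pdivrMr.
Qed.

End Truncation.

(** * Quotients and charts *)

Lemma near_linearization (R : realType) (E : vectType R) (F F' : nvect E -> nvect E) (x : nvect E) (r : R) :
  0 < r -> (forall h, `|h| <= r -> F' (x + h) = F (x + h)) -> differentiable F' x ->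
  linearization F x = linearization F' x.
Proof.
move=> r0 FF' Fd.
have [_ dE] : differentiable F x /\ forall h, 'd F x h = 'd F' x h.
  apply: diff_criterion => e e0; have [d d0 hd] := diff_estimate Fd e0.
  exists (Num.min r d) => [|h]; first by rewrite lt_min r0.
  rewrite le_min => /andP[hr hh]; rewrite -FF'// -[in X in _ - X - _](addr0 x) -FF'.
    by rewrite addr0; exact: hd.
  by rewrite normr0 ltW.
apply/lfunP => v; rewrite /linearization.
rewrite [LHS](lfunE ('d F x : {linear E -> E}) v) [RHS](lfunE ('d F' x : {linear E -> E}) v).
exact: dE.
Qed.

Section Quotient.
Variables (R : realType) (E : vectType R) (L : 'End(E)) (U : {vspace E}) (k : nat).
Hypothesis LU : forall x, x \in U -> L x \in U.

Definition quotient_lin : 'End(subvs_of U) :=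
  linfun (fun u : subvs_of U => vsproj U (L (vsval u))).

Lemma quotient_linE u : vsval (quotient_lin u) = L (vsval u).
Proof.
pose A : {linear subvs_of U -> subvs_of U} := vsproj U \o L \o @vsval _ _ U.
have -> : quotient_lin u = A u by rewrite -(lfunE A u).
by rewrite /= vsprojK// LU// subvsP.
Qed.

Lemma quotient_pi_h (u : subvs_of U) : vsval (pi_h quotient_lin u) = pi_h L (vsval u).
Proof.
pose T : 'Hom(subvs_of U, E) := linfun (@vsval _ _ U).
have TE v : T v = vsval v by rewrite lfunE.
have TL v : T (quotient_lin v) = L (T v) by rewrite !TE quotient_linE.
have := daddv_intertwine TL u (S := fun l => complex.Re l != 0) (S' := fun l => complex.Re l == 0).
rewrite !TE; apply; first by case.
by move=> l; rewrite negbK.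
Qed.

Hypothesis k0 : (0 < k)%N.

Definition quotient_manifolds (d : R) : Prop := forall (G : nvect E -> nvect E) (x0 : nvect E) phi,
    Ub k G -> (forall a b, `|G a - G b| <= d * `|a - b|) -> G 0 = 0 -> (forall v, 'd G 0 v = 0) ->
    x0 \in U -> (forall x, x \in U -> G x \in U) ->
    is_flow (perturbation L x0 G) phi ->
    exists Mq : set (nvect (subvs_of U)),
      @global_center_manifold R (subvs_of U) k (@restrict_to R E U (perturbation L x0 G)) (nproj U x0) Mq /\
      nval U @` Mq = [set x | exists c : R, forall t, `|(pi_h L (phi t x - x0) : nvect E)| <= c]
        `&` [set x | x \in U].

(** The restriction of a perturbation to [U] is a perturbation of [quotient_lin]. The inclusion of
    [U] intertwines the flows and the hyperbolic projections, so the bounded-orbit descriptions of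
    the two manifolds correspond. *)
Lemma quotient_theorem : exists2 d : R, 0 < d & quotient_manifolds d.
Proof.
have [dq dq0 H] := center_manifold_theorem quotient_lin k0.
have [cp cp0 hp] := lin_bounded (nproj U); have [cv cv0 hv] := lin_bounded (nval U).
have c0 : 0 < cp * cv by rewrite mulr_gt0.
(* The norms of [U] and [E] come from unrelated bases. Passing through inclusion and projection
   costs the factor [cp * cv]. *)
exists (dq / (cp * cv)) => [|G x0 phi GU GL G0 dG x0U GUU phiF]; first by rewrite divr_gt0.
pose Gq (u : nvect (subvs_of U)) : nvect (subvs_of U) := nproj U (G (nval U u)).
have nvalK (u : nvect (subvs_of U)) : nproj U (nval U u) = u by exact: vsvalK.
pose xq : nvect (subvs_of U) := nproj U x0.
have xqE : nval U xq = x0 by exact: nprojK.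
pose Fq := perturbation quotient_lin xq Gq.
have FqE u : nval U (Fq u) = perturbation L x0 G (nval U u).
  rewrite /Fq /perturbation linearD /Gq nprojK; last by apply: GUU; exact: subvsP.
  have uE : nval U (u - xq) = nval U u - x0 by rewrite linearB xqE.
  have -> : nval U (nlin quotient_lin (u - xq)) = nlin L (nval U (u - xq)) by exact: quotient_linE.
  by rewrite uE.
have rE : @restrict_to R E U (perturbation L x0 G) = Fq.
  by apply/funext => u; apply: subvs_inj; rewrite [RHS]FqE vsprojK// -FqE; exact: subvsP.
have GqL a b : `|Gq a - Gq b| <= dq * `|a - b|.
  rewrite /Gq -linearB (le_trans (hp _))// (le_trans (ler_wpM2l (ltW cp0) (GL _ _)))//.
  rewrite -linearB.
  have d0 : 0 <= cp * (dq / (cp * cv)) by rewrite mulr_ge0 ?divr_ge0 ?(ltW cp0) ?(ltW dq0) ?(ltW c0).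
  rewrite mulrA (le_trans (ler_wpM2l d0 (hv _)))// le_eqVlt; apply/orP; left; apply/eqP.
  by field; rewrite !gt_eqF.
have GqU : Ub k Gq by apply: Ub_post; apply: Ub_pre.
have Gq0 : Gq 0 = 0 by rewrite /Gq linear0 G0 linear0.
have vc : continuous (nval U) by exact: lin_continuous.
have Gd : forall x, differentiable G x by move: k0 GU; case: (k) => // j _ [_ []].
have Gd' : differentiable G (nval U 0 + 0) by exact: Gd.
have dGq v : 'd Gq 0 v = 0.
  have [D1 D2] := diff_pre vc Gd'.
  have -> : Gq = fun x => nproj U (G (nval U x + 0)) by apply/funext => x; rewrite addr0.
  have pc : continuous (nproj U) by exact: lin_continuous.
  by rewrite (diff_post pc D1).2 D2 addr0 linear0 dG linear0.
have [l l0 FqL] := perturbation_lipschitz quotient_lin xq GqL.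
have ld : 0 <= l + dq by rewrite addr_ge0// ltW.
have [phiq phiqF] := lipschitz_flow ld FqL.
have := H Gq xq phiq GqU GqL Gq0 dGq phiqF.
set Mq := [set x | _] => HM; exists Mq; split; first by rewrite rE.
have [l' l'0 FL] := perturbation_lipschitz L x0 GL.
have ld' : 0 <= l' + dq / (cp * cv) by rewrite addr_ge0 ?divr_ge0 ?(ltW l'0) ?(ltW dq0) ?(ltW c0).
have flowE t u : nval U (phiq t u) = phi t (nval U u).
  have vd (s : R) : is_derive s (1 : R) (fun s => nval U (phiq s u)) (perturbation L x0 G (nval U (phiq s u))).
    by rewrite -FqE; exact: (is_derive_lin vc (phiqF.2 u s)).
  rewrite -[RHS]/((phi^~ (nval U u)) t) -(ode_unique ld' FL vd (phiF.2 (nval U u)))//.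
  by rewrite phiqF.1 phiF.1.
have piE t u : nval U (pi_h quotient_lin (phiq t u - xq)) = pi_h L (phi t (nval U u) - x0).
  rewrite [LHS]quotient_pi_h -flowE; congr (pi_h L _).
  by rewrite -[LHS]/(nval U (phiq t u - xq)) linearB/= xqE.
apply/seteqP; split=> x /=.
  move=> [u [c hc] <-]; split; last exact: subvsP.
  exists (cv * c) => t; rewrite -[vsval u]/(nval U u) -piE (le_trans (hv _))//.
  by rewrite ler_wpM2l// ltW.
move=> [[c hc] xU]; exists (nproj U x); last exact: nprojK.
exists (cp * c) => t; rewrite -[X in `|X|]nvalK piE nprojK//.
by rewrite (le_trans (hp _))// ler_wpM2l// ltW.
Qed.

End Quotient.

Lemma pi_c_hyperbolic (R : realType) (E : vectType R) (L : 'End(E)) (x : E) :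
  x \in hyperbolic_space L -> pi_c L x = 0.
Proof.
move=> xh; have hv : pi_h L x = x.
  by rewrite /pi_h daddv_pi_id//; apply: spectral_capv => l; rewrite negbK.
have e : x = pi_c L x + x := etrans (pi_ch L x) (f_equal2 (fun a b => a + b) erefl hv).
have e' : pi_c L x + x = 0 + x by rewrite add0r; exact (esym e).
exact (@addIr E x _ _ e').
Qed.

Section CenterChart.
Variables (R : realType) (E : vectType R) (k : nat) (F : nvect E -> nvect E) (x0 : nvect E).
Variable M : set (nvect E).
Hypothesis FM : global_center_manifold k F x0 M.
Local Notation L := (linearization F x0).
Local Notation pc := (nlin (pi_c L)).

(* x0 + xc + psi xc as a function of a point of E, through pi_c. *)
Lemma center_chart : exists point : nvect E -> nvect E,
  [/\ Ck k point, forall x, M (point x), forall x, pc (point x - x0) = pc x,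
      forall x, M x -> point (x - x0) = x & forall x y, pc x = pc y -> point x = point y].
Proof.
have [_ _ [phi [_ _ [psi [psiC _ _ ME]]]]] := FM.
pose Uc := center_space L; pose Uh := hyperbolic_space L.
pose point (x : nvect E) : nvect E :=
  x0 + nval Uc (nproj Uc (pc x)) + nval Uh (psi (nproj Uc (pc x))).
have hz (v : nvect (subvs_of Uh)) : pc (nval Uh v) = 0.
  exact: (pi_c_hyperbolic (subvsP v)).
have cz (v : nvect (subvs_of Uc)) : pc (nval Uc v) = nval Uc v by exact: (pi_c_id (subvsP v)).
have pK x : nval Uc (nproj Uc (pc x)) = pc x by apply: nprojK; exact: memv_pi.
have pc_point (v : nvect (subvs_of Uc)) (z : nvect (subvs_of Uh)) :
    pc (x0 + nval Uc v + nval Uh z - x0) = nval Uc v.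
  have e (a b c : nvect E) : a + b + c - a = b + c by rewrite addrC -addrA addKr.
  rewrite e; apply: (etrans (linearD pc (nval Uc v) (nval Uh z))).
  by rewrite (hz z) (cz v) addr0.
exists point; split.
- apply/CkE; apply: CnD.
    apply: CnD; first exact: Cn_cst.
    apply: Cn_post; first exact: lin_continuous.
    apply: Cn_post; first exact: lin_continuous.
    by apply: Cn_lin; exact: lin_continuous.
  apply: Cn_post; first exact: lin_continuous.
  apply: (@Cn_comp_vect _ _ _ _ _ (fun x => nproj Uc (pc x)) psi); last exact/CkE.
  apply: Cn_post; first exact: lin_continuous.
  by apply: Cn_lin; exact: lin_continuous.
- by move=> x; rewrite ME; exists (nproj Uc (pc x)).
- by move=> x; exact (etrans (pc_point _ _) (pK x)).
- move=> x; rewrite {1}ME => -[v _ <-].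
  have e : nproj Uc (pc (x0 + nval Uc v + nval Uh (psi v) - x0)) = v.
  exact (etrans (congr1 (nproj Uc) (pc_point v (psi v))) (vsvalK v)).
  exact (congr1 (fun w : nvect (subvs_of Uc) => x0 + nval Uc w + nval Uh (psi w)) e).
move=> x z e.
exact (congr1 (fun w => x0 + nval Uc (nproj Uc w) + nval Uh (psi (nproj Uc w))) e).
Qed.

End CenterChart.

(** * Networks *)

Section Network.
Variables (R : realType) (V : vectType R) (N : nat) (Sigma : {set {ffun 'I_N -> 'I_N}}).
Hypothesis SM : is_symmetry_monoid Sigma.
Local Notation cell := (cell Sigma).
Local Notation phase := (phase Sigma V).
Implicit Types (s t u : cell) (X Y : phase).

Lemma val_cell_comp t s : val (cell_comp t s) = [ffun i => val t (val s i)].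
Proof. by rewrite /cell_comp insubdK//; apply: SM.2; exact: valP. Qed.

Lemma cell_compA u t s : cell_comp (cell_comp u t) s = cell_comp u (cell_comp t s).
Proof. by apply: val_inj; rewrite !val_cell_comp; apply/ffunP => i; rewrite !ffunE. Qed.

Definition cell1 : cell := Sub [ffun i => i] SM.1.

Lemma cell_1comp s : cell_comp cell1 s = s.
Proof. by apply: val_inj; rewrite val_cell_comp SubK; apply/ffunP => i; rewrite !ffunE. Qed.

Lemma cell_comp1 s : cell_comp s cell1 = s.
Proof. by apply: val_inj; rewrite val_cell_comp SubK; apply/ffunP => i; rewrite !ffunE. Qed.

Lemma act1 X : act cell1 X = X.
Proof. by apply/ffunP => t; rewrite ffunE cell_comp1. Qed.

Lemma act_comp s t X : act s (act t X) = act (cell_comp s t) X.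
Proof. by apply/ffunP => u; rewrite !ffunE cell_compA. Qed.

Lemma act_cell1 s X : act s X cell1 = X s.
Proof. by rewrite ffunE cell_1comp. Qed.

Lemma act_linear s : linear (@act N Sigma R V s).
Proof. by move=> a X Y; apply/ffunP => t; rewrite !ffunE. Qed.

HB.instance Definition _ s := GRing.isLinear.Build R phase phase _ (@act N Sigma R V s) (act_linear s).

Lemma fully_synchronous_act s X : fully_synchronous X -> act s X = X.
Proof. by move=> Xs; apply/ffunP => t; rewrite ffunE; exact: Xs. Qed.

Lemma admissible_act (g : phase -> V) s X : admissible g (act s X) = act s (admissible g X).
Proof. by apply/ffunP => t; rewrite !ffunE act_comp. Qed.

Lemma admissible_cell1 (g : phase -> V) X : admissible g X cell1 = g X.
Proof. by rewrite ffunE act1. Qed.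

Definition component s (X : phase) : V := X s.

Lemma component_linear s : linear (component s).
Proof. by move=> a X Y; rewrite /component !ffunE. Qed.

HB.instance Definition _ s := GRing.isLinear.Build R phase V _ (component s) (component_linear s).

Definition in_cell s (v : V) : phase := [ffun t => if t == s then v else 0].

Lemma in_cell_linear s : linear (in_cell s).
Proof.
move=> a v w; apply/ffunP => t; rewrite !ffunE.
by case: ifP => //; rewrite scaler0 addr0.
Qed.

HB.instance Definition _ s := GRing.isLinear.Build R V phase _ (in_cell s) (in_cell_linear s).

Lemma sum_in_cell X : X = \sum_s in_cell s (X s).
Proof.
apply/ffunP => t; rewrite sum_ffunE (bigD1 t)//= ffunE eqxx big1 ?addr0// => s st.
by rewrite ffunE eq_sym (negPf st).
Qed.

Definition nact s : {linear nvect phase -> nvect phase} :=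
  (@act N Sigma R V s : {linear phase -> phase}).
Definition ncomponent s : {linear nvect phase -> nvect V} := (component s : {linear phase -> V}).
Definition nin_cell s : {linear nvect V -> nvect phase} := (in_cell s : {linear V -> phase}).

(** In this form the admissible field is a sum of compositions of [g] with linear maps, so its
    regularity follows from the closure properties of [Ub]. *)
Lemma admissibleE (g : nvect phase -> nvect V) :
  (admissible g : nvect phase -> nvect phase) = fun X => \sum_s nin_cell s (g (nact s X)).
Proof.
apply/funext => X; rewrite [LHS]sum_in_cell; apply: eq_bigr => s _.
by rewrite ffunE.
Qed.

Lemma admissible_Ub j (g : nvect phase -> nvect V) : Ub j g ->
  Ub j (admissible g : nvect phase -> nvect phase).
Proof.
move=> gU; rewrite admissibleE; apply: Ub_sum => s.
apply: (@Ub_post _ _ _ _ (nin_cell s) j (fun X => g (nact s X))).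
exact: Ub_pre.
Qed.

(** The norm of [phase] comes from a basis that need not be adapted to the cells, and [act s] need
    not be a contraction for it; [C] collects these operator norms. *)
Lemma admissible_lipschitz : exists2 C : R, 0 < C & forall (g : nvect phase -> nvect V) d, 0 <= d ->
  (forall a b, `|g a - g b| <= d * `|a - b|) ->
  forall a b : nvect phase,
    `|(admissible g a : nvect phase) - (admissible g b : nvect phase)| <= C * d * `|a - b|.
Proof.
have H s : exists c : R, 0 < c /\ forall (g : nvect phase -> nvect V) d, 0 <= d ->
  (forall a b, `|g a - g b| <= d * `|a - b|) ->
  forall a b : nvect phase,
    `|nin_cell s (g (nact s a)) - nin_cell s (g (nact s b))| <= c * d * `|a - b|.
  have [p p0 hp] := lin_bounded (nin_cell s); have [q q0 hq] := lin_bounded (nact s).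
  exists (p * q); split=> [|g d d0 gL a b]; first exact: mulr_gt0.
  rewrite -linearB (le_trans (hp _))// -!mulrA ler_wpM2l ?(ltW p0)//.
  rewrite (le_trans (gL _ _))// mulrCA ler_wpM2l// -linearB; exact: hq.
have [c Hc] := choice H.
exists (\sum_s c s + 1) => [|g d d0 gL a b].
  by rewrite ltr_wpDl// sumr_ge0// => s _; exact: ltW (Hc s).1.
rewrite admissibleE -sumrB (le_trans (ler_norm_sum _ _ _))//.
rewrite (@le_trans _ _ (\sum_s c s * d * `|a - b|))//.
  by apply: ler_sum => s _; exact: (Hc s).2.
by rewrite -!mulr_suml ler_wpM2r// ler_wpM2r// lerDl.
Qed.

Lemma admissible_diff0 (g : nvect phase -> nvect V) : (forall X : nvect phase, differentiable g X) ->
  (forall X : nvect phase, differentiable (admissible g : nvect phase -> nvect phase) X) ->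
  (forall v, 'd g 0 v = 0) ->
  forall v, 'd (admissible g : nvect phase -> nvect phase) 0 v = 0.
Proof.
move=> gd Gd dg v; apply/ffunP => s.
have cc : continuous (ncomponent s) by exact: lin_continuous.
have ac : continuous (nact s) by exact: lin_continuous.
have := (diff_post cc (Gd 0)).2 v.
rewrite (_ : (fun x => ncomponent s _) = fun x => g (nact s x + 0)); last first.
  by apply/funext => x; rewrite addr0 /ncomponent/= /component ffunE.
have gd' : differentiable g (nact s 0 + 0) by exact: gd.
rewrite (diff_pre ac gd').2 linear0 addr0 dg => H.
rewrite [RHS]ffunE; exact (esym H).
Qed.

(** At a fully synchronous point, which every [act s] fixes, the linearization of an admissible
    field has this form, with the differential of the response function for [A]. *)
Definition admissible_lin (A : {linear nvect phase -> nvect V}) : 'End(phase) :=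
  linfun (fun X : phase => admissible A X).

Lemma admissible_linE A X : admissible_lin A X = admissible A X.
Proof.
have lin : linear (fun X : phase => admissible A X).
  move=> a Y Z; apply/ffunP => t; rewrite !ffunE !linearP.
  by [].
pose h := GRing.isLinear.Build R phase phase _ _ lin.
pose B : {linear phase -> phase} := HB.pack (fun X : phase => admissible A X) h.
exact: (lfunE B X).
Qed.

(* Robustness for the response function X |-> X_u compares X_(u o s) and X_(u o t). *)
Lemma synchronous_act k (P : {set {set cell}}) s t X : robust V k P -> same_block P s t ->
  X \in synchrony_space V P -> act s X = act t X.
Proof.
move=> PR st XP; apply/ffunP => u.
have uC : Ck k (component u : nvect phase -> nvect V).
  by apply/CkE; apply: (@Cn_lin _ _ _ _ (ncomponent u)); exact: lin_continuous.
have /mem_synchrony_space/(_ s t st) := PR _ uC X XP.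
by rewrite [LHS]ffunE [RHS]ffunE.
Qed.

Lemma robust_inside_synchrony k (P : {set {set cell}}) (M : set phase) : robust V k P ->
  robust_inside M P.
Proof.
move=> PR G GE X MX XP; apply/mem_synchrony_space => s t st.
by rewrite -act_cell1 -GE// (synchronous_act PR st XP) GE// act_cell1.
Qed.

Section AdmissibleOn.
Variables (k : nat) (Gamma F point : nvect phase -> nvect phase) (x0 : nvect phase).
Variables (M : set phase) (L : 'End(phase)).
Hypothesis LE : linearization Gamma x0 = L.
Hypothesis x0s : fully_synchronous x0.
Hypothesis FG : \forall X \near x0, F X = Gamma X.
Hypothesis FC : Ck k F.
Hypothesis pointC : Ck k point.
Hypothesis Fa : forall s X, F (act s X) = act s (F X).
Hypothesis La : forall s X, pi_c L (act s X) = act s (pi_c L X).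
Hypothesis Ma : forall s X, M X -> M (act s X).
Hypothesis Mp : forall X, M (point X).
Hypothesis chart_point : forall X, pi_c L (point X - x0) = pi_c L X.
Hypothesis point_chart : forall X, M X -> point (X - x0) = X.
Hypothesis point_pi_c : forall X Y, pi_c L X = pi_c L Y -> point X = point Y.

Let actB s X : act s (X - x0) = act s X - x0.
Proof. by rewrite linearB/= (fully_synchronous_act s x0s). Qed.

(** Both sides lie on [M] and have the same center part, and a point of [M] is determined by its
    center part. *)
Lemma act_point s X : point (act s X) = act s (point X).
Proof.
rewrite -[RHS]point_chart; last exact: Ma.
by apply: point_pi_c; rewrite -actB !La chart_point.
Qed.

(** The field in the chart commutes with the action. Such a field is admissible, and its response
    function is its component at the identity cell. *)
Definition chart_response (X : phase) : V := component cell1 (pi_c L (F (point X))).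

Lemma chart_responseE X : admissible chart_response X = pi_c L (F (point X)).
Proof.
apply/ffunP => s; rewrite ffunE /chart_response act_point Fa La.
exact: act_cell1.
Qed.

Lemma chart_response_Ck : Ck k (chart_response : nvect phase -> nvect V).
Proof.
have H : Cn k (fun X : nvect phase => ncomponent cell1 (nlin (pi_c L) (F (point X)))).
  apply: Cn_post; first exact: lin_continuous.
  apply: Cn_post; first exact: lin_continuous.
  by apply: Cn_comp_vect; exact/CkE.
by apply/CkE; exact: H.
Qed.

Lemma center_manifold_admissible_on : admissible_on k Gamma x0 M.
Proof.
rewrite /admissible_on LE; split.
- split.
  + by move=> X _; exact: memv_pi.
  + move=> X Y /set_mem MX /set_mem MY XY.
    by rewrite -(point_chart MX) -(point_chart MY); exact: point_pi_c.
  + by move=> Y /= YC; exists (point Y) => //; rewrite chart_point pi_c_id.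
- by move=> s X MX; rewrite -actB; exact: La.
exists chart_response; split.
- exact: chart_response_Ck.
- by move=> Y _; rewrite chart_responseE; exact: memv_pi.
apply: filterS FG => X FX MX; rewrite chart_responseE -FX; congr (pi_c L (F _)).
rewrite -[LHS](point_chart MX); apply: point_pi_c.
exact: (esym (pi_c_id (memv_pi _ _ _))).
Qed.

End AdmissibleOn.

End Network.

(** * Symmetries of the truncated field, its flow and its center manifold *)

Section EquivariantManifold.
Variables (R : realType) (E : vectType R) (L T : 'End(E)) (x0 : nvect E) (G : nvect E -> nvect E) (d : R).
Variable phi : R -> nvect E -> nvect E.
Local Notation F := (perturbation L x0 G).
Hypothesis d0 : 0 <= d.
Hypothesis GL : forall a b, `|G a - G b| <= d * `|a - b|.
Hypothesis phiF : is_flow F phi.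

Lemma flow_unique (c : R -> nvect E) : (forall t : R, is_derive t (1 : R) c (F (c t))) ->
  forall t, c t = phi t (c 0).
Proof.
move=> cd t; have [l l0 FL] := perturbation_lipschitz L x0 GL.
have ld : 0 <= l + d by rewrite addr_ge0// ltW.
have c0 : c 0 = phi 0 (c 0) by rewrite phiF.1.
exact: (congr1 (fun h => h t) (ode_unique ld FL cd (phiF.2 (c 0)) c0)).
Qed.

Lemma flowD s t x : phi (s + t) x = phi s (phi t x).
Proof.
have cd (r : R) : is_derive r (1 : R) (fun r => phi (t + 1 * r) x) (F (phi (t + 1 * r) x)).
  have := is_derive_affine (phiF.2 x (t + 1 * r)); rewrite scale1r; exact.
have := flow_unique cd s; rewrite mul1r mulr0 addr0 addrC; exact.
Qed.

Hypothesis TL : forall x, T (L x) = L (T x).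
Hypothesis TG : forall x, T (G x) = G (T x).
Hypothesis Tx0 : T x0 = x0.

Lemma equivariant_sub y : T (y - x0) = T y - x0.
Proof. by rewrite -[in RHS]Tx0; exact: (linearB (nlin T) y x0). Qed.

Lemma equivariant_perturbation y : nlin T (F y) = F (nlin T y).
Proof.
rewrite /perturbation [LHS](linearD (nlin T)) !nlinE TL TG.
by rewrite equivariant_sub.
Qed.

Lemma equivariant_flow t x : T (phi t x) = phi t (T x).
Proof.
have Tc : continuous (nlin T) by exact: lin_continuous.
have cd (s : R) : is_derive s (1 : R) (fun s => nlin T (phi s x)) (F (nlin T (phi s x))).
  by have := is_derive_lin Tc (phiF.2 x s); rewrite equivariant_perturbation.
by have := flow_unique cd t; rewrite phiF.1.
Qed.

Lemma equivariant_pi_c x : T (pi_c L x) = pi_c L (T x).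
Proof.
apply: (daddv_intertwine TL x (S := fun l => complex.Re l == 0)); first by case.
by [].
Qed.

Lemma equivariant_pi_h x : T (pi_h L x) = pi_h L (T x).
Proof.
apply: (daddv_intertwine TL x (S := fun l => complex.Re l != 0)); first by case.
by move=> l; rewrite negbK.
Qed.

(** No inverse of [T] is involved: the hyperbolic part of the image orbit is the image of the
    hyperbolic part, so its bound is multiplied by a norm of [T]. *)
Lemma equivariant_manifold x : (exists c : R, forall t, `|(pi_h L (phi t x - x0) : nvect E)| <= c) ->
  exists c : R, forall t, `|(pi_h L (phi t (T x) - x0) : nvect E)| <= c.
Proof.
move=> [c hc]; have [q q0 hq] := lin_bounded (nlin T).
exists (q * c) => t.
have -> : pi_h L (phi t (T x) - x0) = nlin T (pi_h L (phi t x - x0)).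
  by rewrite nlinE equivariant_pi_h equivariant_sub equivariant_flow.
by rewrite (le_trans (hq _))// ler_wpM2l// ltW.
Qed.

Lemma invariant_manifold s x : (exists c : R, forall t, `|(pi_h L (phi t x - x0) : nvect E)| <= c) ->
  exists c : R, forall t, `|(pi_h L (phi t (phi s x) - x0) : nvect E)| <= c.
Proof. by move=> [c hc]; exists c => t; rewrite -flowD. Qed.

End EquivariantManifold.

Theorem theorem1p1 (R : realType) (V : vectType R) (N k : nat)
    (Sigma : {set {ffun 'I_N -> 'I_N}})
    (f : nvect (phase Sigma V) -> nvect V) (x0 : nvect (phase Sigma V)) :
  let Gamma : nvect (phase Sigma V) -> nvect (phase Sigma V) :=
    admissible f in
  is_symmetry_monoid Sigma -> (0 < k)%N -> Ck k f ->
  fully_synchronous x0 -> Gamma x0 = 0 ->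
  exists M : set (nvect (phase Sigma V)),
    [/\ local_center_manifold k Gamma x0 M,
        invariant_set M,
        \forall X \near x0, M X -> tangent_to M X (Gamma X),
        equivariant_on M Gamma /\ admissible_on k Gamma x0 M &
        forall P : {set {set cell Sigma}},
          cell_partition P -> robust V k P ->
          let Syn := synchrony_space V P in
          (exists Mq : set (nvect (subvs_of Syn)),
             local_center_manifold k (restrict_to Gamma) (vsproj Syn x0) Mq /\
             vsval @` Mq = M `&` [set X | X \in Syn]) /\
          robust_inside M P].
Proof.
move=> Gamma SM k0 fC x0s Gx0.
have fx0 : f x0 = 0.
  by rewrite -(admissible_cell1 SM f x0) -[admissible f x0]/(Gamma x0) Gx0 ffunE.
have [fd _] := f_C1 k0 fC.
pose A : {linear nvect (phase Sigma V) -> nvect V} := 'd f x0.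
pose L := admissible_lin A.
have x0a s : act s x0 = x0 by exact: fully_synchronous_act.
have AC : Ck k A by apply/CkE; apply: Cn_lin; exact: lin_continuous.
have Lsyn P : robust V k P -> forall X, X \in synchrony_space V P -> L X \in synchrony_space V P.
  by move=> PR X XP; rewrite admissible_linE; exact: PR.
have [dw dw0 Hw] := center_manifold_theorem L k0.
have HP (P : {set {set cell Sigma}}) : exists d : R, 0 < d /\
    (robust V k P -> quotient_manifolds L (synchrony_space V P) k d).
  (* A size is chosen for every partition; those that are not robust get the dummy value 1. *)
  have [PR|PR] := pselect (robust V k P); last by exists 1; split.
  by have [d d0 Hd] := quotient_theorem (Lsyn P PR) k0; exists d.
have [dP HdP] := choice HP.
(* One truncation has to serve the fundamental network and all its quotients. *)
have [dm dm0 Hdm] := @seq_gap R _ (index_enum _) dP predT (fun P _ _ => (HdP P).1).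
pose d := Num.min dw dm; have d0 : 0 < d by rewrite lt_min dw0.
have [C C0 HC] := @admissible_lipschitz R V N Sigma.
(* The response function is truncated with constant [d / C] in order that the assembled field have
   Lipschitz constant [d]. *)
have dC : 0 < d / C by rewrite divr_gt0.
have [g [gU gL g0 dg [r r0 gr]]] := truncation x0 k0 fC dC.
pose G : nvect (phase Sigma V) -> nvect (phase Sigma V) := admissible g.
have GU : Ub k G by exact: admissible_Ub.
have GL a b : `|G a - G b| <= d * `|a - b|.
  by have := HC g _ (ltW dC) gL a b; rewrite [C * _]mulrC divfK// gt_eqF.
have GLe e : d <= e -> forall a b, `|G a - G b| <= e * `|a - b|.
  by move=> de a b; rewrite (le_trans (GL a b))// ler_wpM2r.
have G0 : G 0 = 0 by apply/ffunP => s; rewrite ffunE linear0 g0 ffunE.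
have C1 (E E' : vectType R) (h : nvect E -> nvect E') : Ck k h -> forall x, differentiable h x.
  by move: k0; case: (k) => // j _ [].
have Gd := C1 _ _ _ (Ub_Ck GU).
have gd := C1 _ _ _ (Ub_Ck gU).
have dG : forall v, 'd G 0 v = 0 by exact: admissible_diff0.
pose F := perturbation L x0 G.
have FC : Ck k F by apply: perturbation_Ck; exact: Ub_Ck.
have LF : linearization F x0 = L by exact: perturbation_linearization.
(* The field evaluates [g] at every [act s h], and all these points must lie in the ball where [g]
   is the untruncated remainder. *)
have [rad rad0 Hrad] : exists2 e : R, 0 < e & forall h : nvect (phase Sigma V), `|h| <= e ->
    forall s, `|nact V s h| <= r.
  apply: common_radius => s; have [q q0 hq] := lin_bounded (nact V s).
  exists (r / q) => [|h]; first by rewrite divr_gt0.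
  by rewrite ler_pdivlMr// mulrC => /(le_trans (hq h)).
have FGamma h : `|h| <= rad -> F (x0 + h) = Gamma (x0 + h).
  move=> hh; rewrite /F /perturbation.
  have -> : x0 + h - x0 = h by rewrite addrC addKr.
  apply/ffunP => s; rewrite ffunE nlinE admissible_linE ffunE [G h s]ffunE [RHS]ffunE.
  rewrite [act s (x0 + h)]linearD/= x0a [g _](gr (nact V s h) (Hrad h hh s)) /remainder fx0 subr0.
  by rewrite addrC subrK.
have nearF : \forall X \near x0, F X = Gamma X.
  apply/nbhs_ballP; exists rad => // X; rewrite -ball_normE /= => /ltW hX.
  by rewrite -[X](subrK x0) addrC FGamma// distrC.
have LG : linearization Gamma x0 = L.
  by rewrite -LF; apply: near_linearization rad0 FGamma _; exact: C1.
have [l l0 FL] := perturbation_lipschitz L x0 GL.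
have ld : 0 <= l + d by rewrite addr_ge0 ?(ltW l0) ?(ltW d0).
have [phi phiF] := lipschitz_flow ld FL.
pose M := [set x | exists c : R, forall t, `|(pi_h L (phi t x - x0) : nvect (phase Sigma V))| <= c].
have dw_le : d <= dw by rewrite ge_min lexx.
have HM : global_center_manifold k F x0 M by exact: Hw (GLe _ dw_le) G0 dG phiF.
pose T s : 'End(phase Sigma V) := linfun (@act N Sigma R V s).
have TE s X : T s X = act s X by rewrite lfunE.
have TL s X : T s (L X) = L (T s X) by rewrite !TE !admissible_linE admissible_act.
have TG s X : T s (G X) = G (T s X) by rewrite !TE /G admissible_act.
have Tx0 s : T s x0 = x0 by rewrite TE.
have Ma s X : M X -> M (act s X).
  by move=> MX; rewrite -TE; exact: (equivariant_manifold (ltW d0) GL phiF (TL s) (TG s) (Tx0 s) MX).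
exists M; split.
- by exists F.
- by move=> s _ [X MX <-]; exact: Ma.
(* The orbit of the truncated field stays in [M] for all times. Its velocity at time 0 is that of
   [Gamma] because the fields agree near [x0]. *)
- apply: filterS nearF => X FX MX; exists (fun t => phi t X); split.
  + by move=> t; exact: (invariant_manifold (ltW d0) GL phiF).
  + exact: phiF.1.
  + by have := phiF.2 X 0; rewrite phiF.1 -/F FX.
- split; first by move=> s X _; exact: admissible_act.
  have := center_chart HM; rewrite LF => -[point [pC pM cp pch pe]].
  apply: (center_manifold_admissible_on SM LG x0s nearF FC pC) => //.
  + move=> s X; rewrite -!TE.
    exact: (esym (equivariant_perturbation (TL s) (TG s) (Tx0 s) X)).
  + by move=> s X; rewrite -!TE (equivariant_pi_c (TL s)).
move=> P _ PR Syn; split; last exact: (robust_inside_synchrony SM PR).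
have dP_le : d <= dP P by rewrite ge_min (Hdm P) ?orbT ?mem_index_enum.
have x0S : x0 \in Syn by apply/mem_synchrony_space => s t _; exact: x0s.
have GS X : X \in Syn -> G X \in Syn by apply: PR; exact: Ub_Ck.
have [Mq [HMq MqE]] := (HdP P).2 PR G x0 phi GU (GLe _ dP_le) G0 dG x0S GS phiF.
(* The quotient uses the restriction of the same truncated field, which makes its center manifold
   exactly the intersection of [M] with the synchrony space. *)
exists Mq; split => //; exists (@restrict_to R (phase Sigma V) Syn F); split => //.
have vc : continuous (nval Syn) by exact: lin_continuous.
have xqE : nval Syn (nproj Syn x0) = x0 by exact: nprojK.
have nearFq : nbhs (nval Syn (nproj Syn x0)) (fun X => F X = Gamma X) by rewrite xqE.
have H : nbhs (nproj Syn x0) (fun u => F (nval Syn u) = Gamma (nval Syn u)).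
  exact: (vc (nproj Syn x0) _ nearFq).
apply: filterS H => u Fu.
exact (congr1 (nproj Syn) Fu).
Qed.
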